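(* Consider the logit model $\log\{\mathbb P(Z_i=\ell)/\mathbb P(Z_i=0)\}=X_{i(\ell)}^T\beta$, $\ell=1,\dots,m-1$, $i=1,\dots,n$, with true coefficient vector $\beta_0\in\mathbb R^d$, and the group-sparse prior $\Pi$ on $\beta\in\mathbb R^d$ described in the context (with constants $A_1,A_2,A_3,A_4>0$). For $M>0$ let $$\mathcal B_1(M)=\Big\{\beta_0\in\mathbb R^d: s_0\sqrt{\max\{\log p,\overline g\log n\}}\;\max_{1\le i\le n}\lVert X_i\rVert_\ast\le M\,\phi^2(S_0)\,\lVert X\rVert_\ast\Big\}.$$ Then there exists a constant $M_1>0$ such that for any $M_2>3$, $$\sup_{\beta_0\in\mathcal B_1(M_1)}\mathbb E_0\,\Pi\Big\{\beta: s_\beta> s_0+\frac{M_2}{A_4}\Big(1+\frac{33}{\phi^2(S_0)}\Big)s_0\;\Big|\;Y\Big\}\to 0\qquad\text{as } n\to\infty .$$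
   Context: Model. $m\ge2$ is a fixed integer (number of categories). For each sample size $n$, $Z_1,\dots,Z_n$ are independent with values in $\{0,1,\dots,m-1\}$; $X_i\in\mathbb R^{(m-1)\times d}$ are deterministic design matrices, $X_{i(\ell)}\in\mathbb R^d$ is the $\ell$th row of $X_i$, and $X=(X_1^T,\dots,X_n^T)^T\in\mathbb R^{n(m-1)\times d}$ ($X\neq0$). The quantities $d$, $p$, the groups and the design may depend on $n$; ''constant'' means independent of $n$. Set $Y_{i\ell}=\mathbf 1(Z_i=\ell)$, $Y_i=(Y_{i1},\dots,Y_{i,m-1})^T$, $Y=(Y_1^T,\dots,Y_n^T)^T\in\mathbb R^{n(m-1)}$. The density of $Y$ w.r.t. counting measure under parameter $\beta$ is $f_\beta^n$, i.e. $f^n_\beta(Y)=\prod_{i=1}^n \exp(Y_i^TX_i\beta)/\{1+\sum_{\ell=1}^{m-1}\exp(X_{i(\ell)}^T\beta)\}$. $\mathbb E_0$ is the expectation under the true parameter $\beta_0$; $\mu=\mathbb E_0Y$ and $W=\mathbb E_0\{(Y-\mu)(Y-\mu)^T\}$ (so $W$ depends on $\beta_0$). Groups and norms. $G_1,\dots,G_p$ is a partition of $\{1,\dots,d\}$ into nonempty sets; $g_j=|G_j|$, $\overline g=\max_j g_j$. $\beta_j\in\mathbb R^{g_j}$ is the subvector of $\beta\in\mathbb R^d$ indexed by $G_j$. For a matrix $A$ with $d$ columns, $A_{\cdot j}$ is the submatrix of columns indexed by $G_j$ and $\lVert A\rVert_\ast=\max_{1\le j\le p}\lVert A_{\cdot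 j}\rVert_{\rm sp}$ with $\lVert\cdot\rVert_{\rm sp}$ the spectral norm (this applies to $A=X$ and to each $A=X_i$). $\lVert\beta\rVert_{2,1}=\sum_{j=1}^p\lVert\beta_j\rVert_2$. For $S\subset\{1,\dots,p\}$: $s=|S|$, $\beta_S=\{\beta_j:j\in S\}$, $\beta_{S^c}=\{\beta_j:j\notin S\}$, $\lVert\beta_S\rVert_{2,1}=\sum_{j\in S}\lVert\beta_j\rVert_2$ (similarly for $S^c$), $d_S=\sum_{j\in S}g_j$. $S_\beta=\{j:\beta_j\ne0\}$, $s_\beta=|S_\beta|$; $S_0=S_{\beta_0}$, $s_0=|S_0|$. Compatibility number: $$\phi(S)=\inf\Big\{\frac{\lVert W^{1/2}X\beta\rVert_2\sqrt s}{\lVert X\rVert_\ast\lVert\beta\rVert_{2,1}}:\ \lVert\beta_{S^c}\rVert_{2,1}\le7\lVert\beta_S\rVert_{2,1},\ \beta_S\ne0\Big\}.$$ Prior. $\Pi$ is the law of $\beta$ under: draw $s\in\{0,\dots,p\}$ from a probability mass function $\pi_p$; given $s$ draw $S\subset\{1,\dots,p\}$ uniformly among subsets of size $s$; given $S$ draw $\beta_S$ from the density $h_S$ on $\mathbb R^{d_S}$ and set $\beta_{S^c}=0$. Here, for fixed constants $A_1,A_2,A_3,A_4>0$, $$\frac{A_1}{\max\{p,n^{\overline g}\}^{A_3}}\le\frac{\pi_p(s)}{\pi_p(s-1)}\le\frac{A_2}{\max\{p,n^{\overline g}\}^{A_4}},\quad s=1,\dots,p,$$ $$h_S(\beta_S)=\Big(\frac{\lambda}{\sqrt\pi}\Big)^{d_S}\frac{\prod_{j\in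 S}\Gamma(g_j/2)}{2^s\prod_{j\in S}\Gamma(g_j)}e^{-\lambda\lVert\beta_S\rVert_{2,1}},\qquad \lambda=8\lVert X\rVert_\ast\sqrt{\max\{\log p,\overline g\log n\}}.$$ $\Pi(\cdot\mid Y)$ is the posterior: $\Pi(B\mid Y)=\int_B f_\beta^n(Y)\,d\Pi(\beta)/\int_{\mathbb R^d}f^n_\beta(Y)\,d\Pi(\beta)$. *)

(* Defs.v *)
From HB Require Import structures.
From mathcomp Require Import all_boot all_order all_algebra.
From mathcomp Require Import all_classical all_reals all_analysis.
From mathcomp Require Import measurable_realfun.

Set Implicit Arguments.
Unset Strict Implicit.
Unset Printing Implicit Defensive.
Import Order.TTheory GRing.Theory Num.Theory.
Import numFieldNormedType.Exports.

Local Open Scope classical_set_scope.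
Local Open Scope ring_scope.

Section lebesgue_tuple.
Context {R : realType}.
Local Open Scope ereal_scope.

Definition cons_pair k (x : R * k.-tuple R) : k.+1.-tuple R :=
  [tuple of x.1 :: x.2].

Lemma measurable_cons_pair k : measurable_fun setT (@cons_pair k).
Proof. exact: measurable_cons. Qed.

Definition lebesgue_cons k
    (mu : {sigma_finite_measure set (k.-tuple R) -> \bar R}) :
    set (k.+1.-tuple R) -> \bar R :=
  pushforward (@lebesgue_measure R \x mu) (@cons_pair k).

Section instances.
Variables (k : nat) (mu : {sigma_finite_measure set (k.-tuple R) -> \bar R}).

Let lc0 : lebesgue_cons mu set0 = 0.
Proof. by rewrite /lebesgue_cons /pushforward preimage_set0 measure0. Qed.

Let lc_ge0 A : 0 <= lebesgue_cons mu A.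
Proof. by rewrite /lebesgue_cons /pushforward measure_ge0. Qed.

Let lc_sigma_additive : semi_sigma_additive (lebesgue_cons mu).
Proof.
move=> F mF tF mUF; rewrite /lebesgue_cons /pushforward preimage_bigcup.
apply: measure_semi_sigma_additive.
- by move=> n; rewrite -[X in measurable X]setTI; exact: measurable_cons_pair.
- apply/trivIsetP => /= i j _ _ ij; rewrite -preimage_setI.
  by move/trivIsetP : tF => /(_ _ _ _ _ ij) ->//; rewrite preimage_set0.
- rewrite -preimage_bigcup -[X in measurable X]setTI.
  exact: measurable_cons_pair.
Qed.

HB.instance Definition _ := isMeasure.Build _ _ _ (lebesgue_cons mu)
  lc0 lc_ge0 lc_sigma_additive.

Let lc_sigma_finite : sigma_finite setT (lebesgue_cons mu).
Proof.
have /sigma_finiteP[F [TF ndF Foo]] := sigma_finiteT (@lebesgue_measure R).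
have /sigma_finiteP[G [TG ndG Goo]] := sigma_finiteT mu.
pose u (t : k.+1.-tuple R) : R * k.-tuple R := (thead t, [tuple of behead t]).
have mu_ : measurable_fun setT u.
  apply/measurable_fun_pairP; split.
    exact: (@measurable_tnth _ _ k.+1 ord0).
  exact: measurable_behead.
exists (fun i => u @^-1` (F i `*` G i)).
  rewrite -preimage_bigcup (_ : \bigcup_i _ = setT) ?preimage_setT//.
  rewrite -setXTT TF TG predeqE => -[x y]; split.
    move=> [n _ []/= ? ?]; split; exists n => //.
  move=> [/= [n _ Fnx] [l _ Gly]]; exists (maxn n l) => //; split.
  - by move: x Fnx; exact/subsetPset/ndF/leq_maxl.
  - by move: y Gly; exact/subsetPset/ndG/leq_maxr.
move=> i; have [? ?] := Foo i; have [? ?] := Goo i; split.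
  by rewrite -[X in measurable X]setTI; apply: mu_ => //; exact: measurableX.
rewrite /lebesgue_cons /pushforward -comp_preimage.
rewrite (_ : u \o _ = id).
  by rewrite preimage_id product_measure1E// lte_mul_pinfty// ge0_fin_numE.
by apply/funext => -[x t]; rewrite /u /cons_pair/=; congr (_, _); exact/val_inj.
Qed.

HB.instance Definition _ := Measure_isSigmaFinite.Build _ _ _
  (lebesgue_cons mu) lc_sigma_finite.

End instances.

(* k-dimensional Lebesgue measure; R^0 carries the unit mass *)
Fixpoint lebesgue_tuple k :
    {sigma_finite_measure set (k.-tuple R) -> \bar R} :=
  if k is k'.+1 then [the {sigma_finite_measure set _ -> \bar R} of
                      lebesgue_cons (lebesgue_tuple k')]
  else [the {sigma_finite_measure set _ -> \bar R} of \d_([tuple])].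

End lebesgue_tuple.

Section euclidean.
Context {R : realType}.

Definition l2norm k (v : 'cV[R]_k) : R := Num.sqrt (\sum_i v i 0 ^+ 2).

Definition spnorm k l (A : 'M[R]_(k, l)) : R :=
  sup [set l2norm (A *m v) | v in [set v : 'cV[R]_l | l2norm v <= 1]].

Definition is_psd k (W : 'M[R]_k) : Prop :=
  W^T = W /\ forall v : 'cV[R]_k, 0 <= (v^T *m W *m v) 0 0.

(* W^{1/2}: a positive semidefinite W has exactly one positive semidefinite
   square root; the default value 0 is only used when W is not psd *)
Definition psd_sqrt k (W : 'M[R]_k) : 'M[R]_k :=
  xget 0 [set B | is_psd B /\ B *m B = W].

Definition tcol k (t : k.-tuple R) : 'cV[R]_k := \col_i tnth t i.

Definition Gamma (x : R) : R :=
  \int[lebesgue_measure]_(t in `]0, +oo[) (t `^ (x - 1) * expR (- t)).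

Lemma Gamma_ge0 x : 0 <= Gamma x.
Proof.
by apply: Rintegral_ge0 => // t _; rewrite mulr_ge0 ?powR_ge0 ?expR_ge0.
Qed.

End euclidean.

Section groups.
Context {R : realType} {d p : nat}.
Variable G : 'I_p -> {set 'I_d}.

Definition group_partition : Prop :=
  [/\ forall j, G j != finset.set0,
      forall j k, j != k -> (G j :&: G k)%SET = finset.set0 &
      (\bigcup_j G j)%SET = [set: 'I_d]%SET].

Definition gsize (j : 'I_p) : nat := #|G j|.
Definition gbar : nat := \max_(j < p) gsize j.
Definition dimS (S : {set 'I_p}) : nat := \sum_(j in S) gsize j.

Definition colgroup k (A : 'M[R]_(k, d)) (j : 'I_p) : 'M[R]_(k, gsize j) :=
  colsub (@enum_val _ (mem (G j))) A.
Definition vecgroup (b : 'cV[R]_d) (j : 'I_p) : 'cV[R]_(gsize j) :=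
  rowsub (@enum_val _ (mem (G j))) b.

Definition gnorm k (A : 'M[R]_(k, d)) : R :=
  \big[Num.max/0]_(j < p) spnorm (colgroup A j).

Definition norm21 (S : {set 'I_p}) (b : 'cV[R]_d) : R :=
  \sum_(j in S) l2norm (vecgroup b j).

Definition gsupp (b : 'cV[R]_d) : {set 'I_p} := [set j | vecgroup b j != 0].

Definition coordS (S : {set 'I_p}) : {set 'I_d} := (\bigcup_(j in S) G j)%SET.

Lemma card_coordS S : group_partition -> #|coordS S| = dimS S.
Proof.
move=> [_ dis _]; rewrite /dimS /gsize /coordS -sum1_card.
rewrite (eq_bigl (fun i => i \in (\bigcup_j if j \in S then G j else finset.set0)%SET)); last first.
  by move=> i; rewrite [in LHS]big_mkcond.
rewrite partition_disjoint_bigcup.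
  rewrite [RHS]big_mkcond/=; apply: eq_bigr => j _; rewrite sum1_card.
  by case: ifP; rewrite ?cards0.
move=> i j ij; rewrite -setI_eq0; case: ifP => _; last by rewrite finset.set0I.
by case: ifP => _; [rewrite dis|rewrite finset.setI0].
Qed.

(* (beta_S, 0_{S^c}) as a vector of R^d: the coordinates of beta_S follow the
   increasing enumeration of coordS S, and i \notin coordS S gets the default
   value 0, since then index i _ = #|coordS S| = dimS S *)
Definition embedS (S : {set 'I_p}) (b : (dimS S).-tuple R) : d.-tuple R :=
  [tuple nth 0 b (index i (enum (coordS S))) | i < d].

Lemma measurable_embedS S : measurable_fun setT (@embedS S).
Proof.
apply/measurable_fun_tnthP => i.
rewrite (_ : _ \o _ = fun b : (dimS S).-tuple R =>
  nth 0 b (index i (enum (coordS S)))); last first.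
  by apply/funext => b /=; rewrite tnth_mktuple.
have [lt_i|ge_i] := ltnP (index i (enum (coordS S))) (dimS S).
  rewrite (_ : (fun b => _) = @tnth _ R ^~ (Ordinal lt_i)).
    exact: measurable_tnth.
  by apply/funext => b; rewrite (tnth_nth 0).
rewrite (_ : (fun b => _) = cst 0); first exact: measurable_cst.
by apply/funext => b /=; rewrite nth_default// size_tuple.
Qed.

Lemma gnorm_ge0 k (A : 'M[R]_(k, d)) : 0 <= gnorm A.
Proof. exact: bigmax_ge_id. Qed.

Lemma measurable_norm21 S :
  measurable_fun setT (fun t : d.-tuple R => norm21 S (tcol t)).
Proof.
rewrite /norm21; under eq_fun do rewrite -big_enum/=.
apply: measurable_sum => j.
rewrite /l2norm; apply: measurableT_comp => /=.
  by apply: continuous_measurable_fun; exact: sqrt_continuous.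
apply: measurable_sum => i; apply: measurable_funX.
under eq_fun do rewrite !mxE.
exact: measurable_tnth.
Qed.

End groups.

Section logit.
Context {R : realType} {m n d : nat}.
Implicit Types (Xi : 'M[R]_(m.-1, d)) (b : 'cV[R]_d).

(* the category l <> 0 has row index l - 1 in Y_i and X_i *)
Definition indicator (l : 'I_m) : 'cV[R]_(m.-1) :=
  \col_k (l == k.+1 :> nat)%:R.

Definition likelihood1 Xi b (y : 'cV[R]_(m.-1)) : R :=
  expR ((y^T *m Xi *m b) 0 0) / (1 + \sum_(k < m.-1) expR ((Xi *m b) k 0)).

Definition likelihood (X : 'I_n -> 'M[R]_(m.-1, d)) b
    (Y : 'I_n -> 'cV[R]_(m.-1)) : R :=
  \prod_i likelihood1 (X i) b (Y i).

Definition response (z : {ffun 'I_n -> 'I_m}) (i : 'I_n) : 'cV[R]_(m.-1) :=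
  indicator (z i).

(* expectation under parameter b of a function of Z = (Z_1, ..., Z_n), for the
   law of Z on {0, ..., m - 1}^n determined by the density of Y *)
Definition expect (X : 'I_n -> 'M[R]_(m.-1, d)) b (V : lmodType R)
    (F : {ffun 'I_n -> 'I_m} -> V) : V :=
  \sum_z likelihood X b (response z) *: F z.

Definition stackX (X : 'I_n -> 'M[R]_(m.-1, d)) := \mxcol_(i < n) X i.
Definition stackY (z : {ffun 'I_n -> 'I_m}) := \mxcol_(i < n) response z i.

Definition meanY X b := expect X b stackY.
Definition covY X b :=
  expect X b (fun z => (stackY z - meanY X b) *m (stackY z - meanY X b)^T).

End logit.

Section logit_lemmas.
Context {R : realType} {k d : nat}.
Variables (Xi : 'M[R]_(k, d)) (b : 'cV[R]_d).
Local Notation f l := (likelihood1 (m := k.+1) Xi b (indicator l)).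

Let D_gt0 : 0 < 1 + \sum_(i < k) expR ((Xi *m b) i 0).
Proof. by rewrite ltr_pwDl// sumr_ge0// => i _; exact: expR_ge0. Qed.

Let indicator0 : indicator (m := k.+1) ord0 = 0 :> 'cV[R]_k.
Proof. by apply/colP => i; rewrite !mxE. Qed.

Let indicatorS i : indicator (m := k.+1) (lift ord0 i) = delta_mx i 0 :> 'cV[R]_k.
Proof.
apply/colP => j; rewrite !mxE eqxx andbT lift0 eqSS; congr (nat_of_bool _)%:R.
by rewrite eq_sym.
Qed.

Let f0 : f ord0 = (1 + \sum_(i < k) expR ((Xi *m b) i 0))^-1.
Proof. by rewrite /likelihood1 indicator0 trmx0 !mul0mx mxE expR0 mul1r. Qed.

Let fS i : f (lift ord0 i) =
  expR ((Xi *m b) i 0) / (1 + \sum_(i < k) expR ((Xi *m b) i 0)).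
Proof.
by rewrite /likelihood1 indicatorS trmx_delta -mulmxA -rowE mxE.
Qed.

Lemma likelihood1_logit (i : 'I_k) :
  ln (f (lift ord0 i) / f ord0) = (Xi *m b) i 0.
Proof. by rewrite f0 fS invrK mulfVK ?gt_eqF// expRK. Qed.

Lemma likelihood1_sum1 : \sum_(l < k.+1) f l = 1.
Proof.
rewrite big_ord_recl/= f0; under eq_bigr do rewrite fS.
by rewrite -mulr_suml -[X in X + _]mul1r -mulrDl mulfV// gt_eqF.
Qed.

End logit_lemmas.

Section compatibility.
Context {R : realType} {m n d p : nat}.
Variables (G : 'I_p -> {set 'I_d}) (X : 'I_n -> 'M[R]_(m.-1, d)).

(* the infimum over the empty set, i.e. phi(set0), is +oo *)
Definition compat (b0 : 'cV[R]_d) (S : {set 'I_p}) : \bar R :=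
  ereal_inf [set (l2norm (psd_sqrt (covY X b0) *m stackX X *m b) *
                    Num.sqrt #|S|%:R /
                  (gnorm G (stackX X) * norm21 G [set: 'I_p]%SET b))%:E |
    b in [set b : 'cV[R]_d |
            norm21 G (~: S)%SET b <= 7 * norm21 G S b /\
            exists2 j, j \in S & vecgroup G b j != 0]].

Definition rate : R := Num.max (ln p%:R) ((gbar G)%:R * ln n%:R).

Definition Bset (M : R) : set 'cV[R]_d :=
  [set b0 | ((#|gsupp G b0|%:R * Num.sqrt rate *
                \big[Num.max/0]_(i < n) gnorm G (X i))%:E <=
             M%:E * compat b0 (gsupp G b0) ^+ 2 *
               (gnorm G (stackX X))%:E)%E].

End compatibility.

(* only the values at 0, ..., p are used *)
Record dim_pmf (R : realType) (p : nat) := DimPmf {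
  dim_pmf_fun :> nat -> R;
  dim_pmf_ge0 : forall s, 0 <= dim_pmf_fun s;
  dim_pmf_sum1 : \sum_(s < p.+1) dim_pmf_fun s = 1 }.

Section prior.
Context {R : realType} {m n d p : nat}.
Variables (G : 'I_p -> {set 'I_d}) (X : 'I_n -> 'M[R]_(m.-1, d)).
Variable (ppi : dim_pmf R p).

Definition pn_max : R := (maxn p (n ^ gbar G))%:R.

Definition dim_pmf_decay (A1 A2 A3 A4 : R) : Prop :=
  forall s, (1 <= s <= p)%N ->
    A1 / pn_max `^ A3 <= ppi s / ppi s.-1 <= A2 / pn_max `^ A4.

Definition lambda : R :=
  8 * gnorm G (stackX X) * Num.sqrt (rate (R := R) (n := n) G).

Definition slab (S : {set 'I_p}) (t : (dimS G S).-tuple R) : R :=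
  (lambda / Num.sqrt pi) ^+ dimS G S *
  ((\prod_(j in S) Gamma ((gsize G j)%:R / 2)) /
   (2 ^+ #|S| * \prod_(j in S) Gamma (gsize G j)%:R)) *
  expR (- (lambda * norm21 G S (tcol (embedS t)))).

Lemma slab_ge0 S t : 0 <= @slab S t.
Proof.
rewrite !mulr_ge0 ?expR_ge0//.
- by rewrite exprn_ge0// !mulr_ge0 ?invr_ge0 ?sqrtr_ge0 ?gnorm_ge0.
- by rewrite prodr_ge0// => j _; exact: Gamma_ge0.
- rewrite invr_ge0 mulr_ge0 ?exprn_ge0// prodr_ge0// => j _; exact: Gamma_ge0.
Qed.

Lemma measurable_slab S : measurable_fun setT (@slab S).
Proof.
apply: measurable_funM => //; apply: measurableT_comp => //.
apply: measurableT_comp => //; apply: measurable_funM => //.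
apply: (measurableT_comp (measurable_norm21 G S)).
exact: measurable_embedS.
Qed.

Definition prior_given (S : {set 'I_p}) (B : set (d.-tuple R)) : \bar R :=
  (\int[lebesgue_tuple (dimS G S)]_(t in @embedS _ _ _ G S @^-1` B)
     (slab t)%:E)%E.

Definition prior (B : set (d.-tuple R)) : \bar R :=
  (\sum_(S : {set 'I_p})
     (ppi #|S| / 'C(p, #|S|)%:R)%:E * prior_given S B)%E.

Section instances.
Local Open Scope ereal_scope.

Let pg0 S : prior_given S set0 = 0.
Proof. by rewrite /prior_given preimage_set0 integral_set0. Qed.

Let pg_ge0 S B : 0 <= prior_given S B.
Proof. by apply: integral_ge0 => t _; rewrite lee_fin slab_ge0. Qed.

Let pg_sigma_additive S : semi_sigma_additive (prior_given S).
Proof.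
move=> F mF tF mUF; rewrite /prior_given preimage_bigcup.
rewrite ge0_integral_bigcup//.
- by apply: is_cvg_ereal_nneg_natsum => i _; exact: pg_ge0.
- move=> i; rewrite -[X in measurable X]setTI.
  by apply: measurable_embedS.
- apply/measurable_EFinP; apply: measurable_funTS.
  exact: measurable_slab.
- by move=> t _; rewrite lee_fin slab_ge0.
- apply/trivIsetP => /= i j _ _ ij; rewrite -preimage_setI.
  by move/trivIsetP : tF => /(_ _ _ _ _ ij) ->//; rewrite preimage_set0.
Qed.

HB.instance Definition _ S := isMeasure.Build _ _ _ (prior_given S)
  (pg0 S) (pg_ge0 S) (@pg_sigma_additive S).

Let w_ge0 (S : {set 'I_p}) : (0 <= ppi #|S| / 'C(p, #|S|)%:R)%R.
Proof. by rewrite divr_ge0 ?dim_pmf_ge0. Qed.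

Let prior0 : prior set0 = 0.
Proof. by rewrite /prior big1// => S _; rewrite measure0 mule0. Qed.

Let prior_ge0 B : 0 <= prior B.
Proof. by apply: sume_ge0 => S _; rewrite mule_ge0 ?lee_fin. Qed.

Let prior_sigma_additive : semi_sigma_additive prior.
Proof.
move=> F mF tF mUF; rewrite [X in _ --> X](_ : _ =
    lim ((fun k => \sum_(0 <= i < k) prior (F i)) @ \oo)).
  by apply: is_cvg_ereal_nneg_natsum => i _; exact: prior_ge0.
rewrite nneseries_sum//; last by move=> S j _; rewrite mule_ge0 ?lee_fin.
apply: eq_bigr => S _.
pose mS := mscale (NngNum (w_ge0 S)) (prior_given S).
exact: (@measure_semi_bigcup _ _ _ mS).
Qed.

HB.instance Definition _ := isMeasure.Build _ _ _ prior
  prior0 prior_ge0 prior_sigma_additive.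

End instances.

Definition posterior (Y : 'I_n -> 'cV[R]_(m.-1)) (B : set 'cV[R]_d) : R :=
  (\int[prior]_(t in @tcol R d @^-1` B) likelihood X (tcol t) Y) /
  (\int[prior]_t likelihood X (tcol t) Y).

End prior.

(* Main.v *)
Require Import Defs.
From HB Require Import structures.
From mathcomp Require Import all_boot all_order all_algebra.
From mathcomp Require Import all_classical all_reals all_analysis.
From mathcomp Require Import measurable_realfun.
From mathcomp Require Import ring lra.
Import Defs.

Set Implicit Arguments.
Unset Strict Implicit.
Unset Printing Implicit Defensive.
Import Order.TTheory GRing.Theory Num.Theory.
Import numFieldNormedType.Exports.
Local Open Scope classical_set_scope.
Local Open Scope ring_scope.

(* Write r for [rate], |X| for [gnorm G (stackX X)], N for the full (2,1)-norm, s0 = |S0|, and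
   let c = b - b0.
   By a subgaussian bound, every group of the score X^T (Y - mu) has norm at most 3 |X| sqrt r with
   probability tending to 1. On that event the log-likelihood ratio of b against b0 is at most
   3 |X| sqrt r N(c) minus a curvature term comparable to |W^(1/2) X c|^2 / (1 + max_i |X_i| N(c)).
   The penalty lambda = 8 |X| sqrt r of the slab absorbs the linear term when c is outside the
   compatibility cone; inside the cone the curvature does, because b0 lies in [Bset], at the cost of
   a factor exp(96 s0 r / phi(S0)^2). In both cases exp(- lambda N(c) / 16) remains, whose integral
   against the density of a slab of dimension D is at most 16 ^ D. The evidence is bounded below by
   the contribution of the model S0, of which a fraction n ^ (- dim S0) / const is kept. As the
   weights of the dimensions decrease like exp(- A4 r), the models that are larger than the
   threshold have a vanishing share. *)

(** * Integration over tuples and Gamma functions *)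

(** The condition [3 < M2] and the factor 33 leave a fixed budget. The threshold exceeds s0 by at
    least (3 / A4) (s0 + 33 E) with E = s0 / phi^2. Each extra group costs exp(- A4 r), and 1/100 of
    that exponent is set aside to absorb [A2], the factor 16 ^ gbar and a vanishing factor. The
    remaining gain 2.97 s0 r + 98.01 E r must beat 96 E r + 3 s0 r, which it does because phi <= 1
    gives s0 <= E. So the peak of the penalized log-likelihood has to stay below 96 E r: with linear
    coefficient 8 + 3 + 1/2 and quadratic coefficient 9/25 it is about 92, and the rest pays for the
    damping of the curvature. The score level is 3 because 3^2 / 8 = 9/8 exceeds 1: one r is spent
    on the union over the p groups, and r / 8 makes the tail vanish. No derivative of the
    log-likelihood is taken. Likelihood ratios are exponential tilts, and upper and lower bounds on
    their moment generating functions replace Taylor expansions. Slab integrals are reduced to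
    Gaussian ones by homogeneity, so that no volume of a ball is computed. *)

Section lebesgue_affine.
Context {R : realType}.
Local Open Scope ereal_scope.
Notation mu := (@lebesgue_measure R).
Implicit Types (c a : R) (f : R -> \bar R).

Let affine c a (x : measurableTypeR R) : measurableTypeR R := (c * x + a)%R.

Let measurable_affine c a : measurable_fun setT (affine c a).
Proof. by apply: measurable_funD => //; apply: measurable_funM. Qed.

(** Lebesgue measure is determined by half-open intervals, and [c] times its image under the affine
    map gives them the same mass. *)
Lemma ge0_integral_affine c a f : (0 < c)%R ->
    measurable_fun setT f -> (forall x, 0 <= f x) ->
  \int[mu]_x f x = c%:E * \int[mu]_x f (c * x + a)%R.
Proof.
move=> c0 mf f0.
have ma := measurable_affine c a.
pose nu_of : {measure set _ -> \bar R} := pushforward mu (affine c a).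
pose nu := nu_of ma.
have c00 : (0 <= c)%R by exact: ltW.
have E (A : set (measurableTypeR R)) : measurable A ->
    mu A = (mscale (NngNum c00) nu) A.
  apply: lebesgue_measure_unique => _ [[u v]] _ <-.
  rewrite [RHS](_ : _ = c%:E * mu (affine c a @^-1` `]u, v]%classic))//.
  rewrite (_ : affine c a @^-1` _ = `](u - a) / c, (v - a) / c]%classic%R); last first.
    apply/seteqP; split => x /=; rewrite /affine !in_itv/= ltr_pdivrMr// ler_pdivlMr//;
      rewrite ltrBlDr lerBrDr mulrC; exact.
  rewrite !lebesgue_measure_itv/= !lte_fin ltr_pM2r ?invr_gt0// ltrD2r.
  case: ifPn; last by rewrite mule0.
  move=> uv; rewrite -!EFinB -EFinM; congr EFin.
  by field; rewrite gt_eqF.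
transitivity (\int[mscale (NngNum c00) nu]_x f x).
  by apply: eq_measure_integral => A mA _; exact: E.
rewrite ge0_integral_mscale//; by congr (_ * _); rewrite ge0_integral_pushforward.
Qed.

End lebesgue_affine.

Section lebesgue_tuple.
Context {R : realType}.
Local Open Scope ereal_scope.
Notation mu := (@lebesgue_measure R).
Notation leb := (@lebesgue_tuple R).

Lemma ge0_integral_lebesgue_tupleS k (f : k.+1.-tuple R -> \bar R) :
    measurable_fun setT f -> (forall x, 0 <= f x) ->
  \int[leb k.+1]_t f t = \int[mu]_x \int[leb k]_t f (cons_pair (x, t)).
Proof.
move=> mf f0 /=; rewrite ge0_integral_pushforward//; last exact: measurable_cons_pair.
rewrite preimage_setT fubini_tonelli1//.
by apply: measurableT_comp => //; exact: measurable_cons_pair.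
by move=> x; exact: f0.
Qed.

Lemma ge0_integral_lebesgue_tuple0 (f : 0.-tuple R -> \bar R) :
    measurable_fun setT f -> \int[leb 0]_t f t = f [tuple].
Proof. by move=> mf; rewrite integral_dirac// diracT mul1e. Qed.

(** One map serves two purposes: [c] dilates the coordinates of a block, and [a] recentres a slab at
    another vector. *)
Definition taffine k (c a : 'I_k -> R) (t : k.-tuple R) : k.-tuple R :=
  [tuple (c i * tnth t i + a i)%R | i < k].

Lemma measurable_taffine k (c a : 'I_k -> R) : measurable_fun setT (taffine c a).
Proof.
apply/measurable_fun_tnthP => i.
rewrite (_ : _ \o _ = fun t => c i * tnth t i + a i)%R; last first.
  by apply/funext => t /=; rewrite tnth_mktuple.
apply: measurable_funD => //; apply: measurable_funM => //.
exact: measurable_tnth.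
Qed.

Lemma ge0_integral_taffine k (c a : 'I_k -> R) (f : k.-tuple R -> \bar R) :
    (forall i, 0 < c i)%R -> measurable_fun setT f -> (forall x, 0 <= f x) ->
  \int[leb k]_t f t = (\prod_i c i)%:E * \int[leb k]_t f (taffine c a t).
Proof.
elim: k c a f => [|k IH] c a f c0 mf f0.
  rewrite big_ord0 mul1e; apply: eq_integral => t _; congr f.
  by rewrite (tuple0 t) (tuple0 (taffine _ _ _)).
rewrite ge0_integral_lebesgue_tupleS// big_ord_recl EFinM -muleA.
have mft : measurable_fun setT (f \o taffine c a).
  by apply: measurableT_comp => //; exact: measurable_taffine.
rewrite [in RHS]ge0_integral_lebesgue_tupleS//.
have mfc : measurable_fun setT (fun x => f (cons_pair x)).
  by apply: measurableT_comp => //; exact: measurable_cons_pair.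
rewrite (@ge0_integral_affine _ (c ord0) (a ord0)) => //; last 2 first.
  - by apply: (measurable_fun_fubini_tonelli_F (m2 := leb k) (fun x => f (cons_pair x))) => // x; exact: f0.
  - by move=> x; apply: integral_ge0.
congr (_ * _).
have mI : measurable_fun setT (fun x => \int[leb k]_t f (taffine c a (cons_pair (x, t)))).
  apply: (measurable_fun_fubini_tonelli_F (m2 := leb k) (fun x => f (taffine c a (cons_pair x)))).
    by apply: (measurableT_comp mft); exact: measurable_cons_pair.
  by move=> ?; exact: f0.
rewrite -ge0_integralZl//; last 2 first.
  - by move=> x _; apply: integral_ge0.
  - by rewrite lee_fin; apply: prodr_ge0 => i _; exact: ltW.
apply: eq_integral => x _.
rewrite (IH (fun i => c (lift ord0 i)) (fun i => a (lift ord0 i))) => //; last first.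
  apply: (@measurableT_comp _ _ _ _ _ _ (fun x => f (cons_pair x))) => //.
congr (_ * _); apply: eq_integral => t _; congr f.
apply: eq_from_tnth => i; rewrite tnth_mktuple.
case: (unliftP ord0 i) => [j ->|->]; last by rewrite !(tnth_nth 0%R).
rewrite !(tnth_nth 0%R)/= nth_mktuple (tnth_nth 0%R)//.
Qed.

(** The reference value: the Gaussian integrand factorises over every grouping of the coordinates,
    so the integrals of exponentials of group norms are reduced to it. *)
Lemma integral_gauss_tuple k :
  \int[leb k]_t (expR (- \sum_i tnth t i ^+ 2))%:E = (Num.sqrt pi ^+ k)%:E.
Proof.
have mf j : measurable_fun setT (fun t : j.-tuple R => (expR (- \sum_i tnth t i ^+ 2))%:E).
  apply/measurable_EFinP; apply: measurableT_comp => //; apply: measurableT_comp => //.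
  by apply: measurable_sum => i; apply: measurable_funX; exact: measurable_tnth.
elim: k => [|k IH].
  by rewrite ge0_integral_lebesgue_tuple0// big_ord0 oppr0 expR0 expr0.
rewrite ge0_integral_lebesgue_tupleS//.
transitivity (\int[mu]_x ((gauss_fun x)%:E * (Num.sqrt pi ^+ k)%:E)).
  apply: eq_integral => x _; rewrite -IH.
  rewrite -ge0_integralZl//; last by rewrite lee_fin; exact: gauss_fun_ge0.
  apply: eq_integral => t _; rewrite -EFinM /gauss_fun -expRD big_ord_recl opprD.
  congr (expR (_ + - _))%:E.
  by apply: eq_bigr => i _; rewrite !(tnth_nth 0%R).
  exact: mf.
rewrite ge0_integralZr//.
- by rewrite integralT_gauss -EFinM exprS.
- apply/measurable_EFinP; exact: measurable_gauss_fun.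
- by move=> x _; rewrite lee_fin; exact: gauss_fun_ge0.
Qed.

End lebesgue_tuple.

Lemma measurable_natb d (T : measurableType d) (R : realType) (b : T -> bool) :
  measurable_fun setT b -> measurable_fun setT (fun t => (b t)%:R : R).
Proof.
move=> mb; rewrite (_ : (fun _ => _) = (fun t => if b t then 1 else 0 : R)).
  exact: measurable_fun_ifT.
by apply/funext => t; case: (b t).
Qed.

(** * Gamma integrals and exponentials of norms by the layer cake formula *)

Section gamma.
Context {R : realType}.
Local Open Scope ereal_scope.
Notation mu := (@lebesgue_measure R).

(** Writes exp(- q) as an integral over the levels above [q], which is what the layer cake formula
    integrates. Shifting by [q] leaves the density of the standard exponential law. *)
Lemma integral_expRN_tail (q : R) :
  \int[mu]_s ((q < s)%R%:R * expR (- s))%:E = (expR (- q))%:E.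
Proof.
have m1 : measurable_fun setT (fun s : R => ((q < s)%R%:R * expR (- s))%:E).
  apply/measurable_EFinP; apply: measurable_funM; last exact: measurableT_comp.
  by apply: measurable_natb; exact: measurable_fun_ltr.
rewrite (@ge0_integral_affine _ 1 q)//.
rewrite mul1e -[RHS]mule1 -(@integral_exponential_pdf R 1)//.
rewrite -ge0_integralZl//; last 2 first.
- by apply/measurable_EFinP; exact: measurable_exponential_pdf.
- by move=> s _; rewrite lee_fin exponential_pdf_ge0.
transitivity (\int[mu]_(s in `]0%R, +oo[) (expR (- q) * exponential_pdf 1 s)%:E).
  rewrite [RHS]integral_mkcond; apply: eq_integral => s _; rewrite patchE mem_setE.
  rewrite in_itv/= andbT mul1r ltrDr; case: ifPn => s0; last by rewrite mul0r.
  by rewrite exponential_pdfE ?(ltW s0)// !mul1r -expRD mulN1r opprD addrC.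
rewrite integral_itv_obnd_cbnd; last first.
  apply: measurable_funTS; apply/measurable_EFinP; apply: measurable_funM => //.
  exact: measurable_exponential_pdf.
rewrite [LHS]integral_mkcond; apply: eq_integral => s _; rewrite patchE mem_setE.
rewrite in_itv/= andbT; case: ifPn => [_|/negP s0]; first by rewrite EFinM.
by rewrite lt0_exponential_pdf ?mule0// ltNge; exact/negP.
Qed.

Lemma integral_powR_itv (x s : R) : (0 < x)%R -> (0 < s)%R ->
  \int[mu]_(t in `]0%R, s]) (x * t `^ (x - 1))%:E = (s `^ x)%:E.
Proof.
move=> x0 s0.
have mf : measurable_fun setT (fun t : R => (x * t `^ (x - 1))%:E).
  by apply/measurable_EFinP; apply: measurable_funM => //; exact: measurable_powR.
(* For [x < 1] the integrand is unbounded at 0, so the fundamental theorem is applied on intervals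
   away from 0 that increase to the whole one. The divisor [n.+2] keeps the left end strictly below
   [s]. *)
pose F n : set R := `[(s / n.+2%:R)%R, s]%classic.
have en (n : nat) : (0 < s / n.+2%:R)%R by rewrite divr_gt0.
have FU : (`]0%R, s]%classic : set R) = \bigcup_n F n.
  apply/seteqP; split => t /=.
    rewrite in_itv/= => /andP[t0 ts].
    exists (Num.truncn (s / t)) => //=; rewrite /F/= in_itv/= ts andbT.
    rewrite ler_pdivrMr// mulrC -ler_pdivrMr//.
    rewrite (@le_trans _ _ (Num.truncn (s / t)).+1%:R)//.
      by rewrite ltW// truncnS_gt.
    by rewrite ler_nat.
  by move=> [n _ /=]; rewrite /F/= !in_itv/= => /andP[nt ->]; rewrite (lt_le_trans (en n)).
have cvg1 : \int[mu]_(t in F n) (x * t `^ (x - 1))%:E @[n --> \oo] -->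
    \int[mu]_(t in `]0%R, s]) (x * t `^ (x - 1))%:E.
  rewrite FU; apply: ge0_nondecreasing_set_cvg_integral => //.
  - apply/nondecreasing_seqP => n; rewrite subsetEset /F => t /=.
    rewrite !in_itv/= => /andP[+ ->]; rewrite andbT; apply: le_trans.
    by rewrite ler_pM2l// lef_pV2 ?posrE// ler_nat.
  - by move=> i; rewrite /F.
  - by move=> i; apply: measurable_funTS.
  - by move=> i t _; rewrite lee_fin mulr_ge0 ?powR_ge0// ltW.
have FE n : \int[mu]_(t in F n) (x * t `^ (x - 1))%:E = (s `^ x - (s / n.+2%:R) `^ x)%:E.
  have lt_s : (s / n.+2%:R < s)%R by rewrite ltr_pdivrMr// ltr_pMr// ltr1n.
  have dF (t : R) : (0 < t)%R -> derivable (@powR R ^~ x) t 1.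
    by move=> t0; apply: derivable_powR; rewrite in_itv/= t0.
  have cF (y : R) (t : R) : (0 < t)%R -> {for t, continuous (@powR R ^~ y)}.
    move=> t0; apply: differentiable_continuous; apply/derivable1_diffP.
    by apply: derivable_powR; rewrite in_itv/= t0.
  rewrite (@continuous_FTC2 _ _ (@powR R ^~ x))//.
  - apply: continuous_in_subspaceT => t; rewrite inE/= in_itv/= => /andP[st _].
    by apply: cvgM; [exact: cvg_cst|apply: cF; exact: lt_le_trans st].
  - split.
    + by move=> t; rewrite in_itv/= => /andP[st _]; apply: dF; exact: lt_trans st.
    + by apply: cvg_at_right_filter; apply: cF.
    + by apply: cvg_at_left_filter; apply: cF.
  - move=> t; rewrite in_itv/= => /andP[st _]; rewrite powR_derive1//.
    by rewrite in_itv/= andbT (lt_trans _ st).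
apply: (cvg_unique _ cvg1) => //.
rewrite (_ : (fun n => _) = (fun n => (s `^ x - (s / n.+2%:R) `^ x)%:E)); last first.
  by apply/funext => n; exact: FE.
apply: cvg_EFin; first by near=> n.
rewrite -[X in _ --> X]subr0; apply: cvgB; first exact: cvg_cst.
have /cvg_at_rightP := @powR_cvg0 _ _ x0; apply; split => //.
rewrite (cvg_shiftS (fun n => s / n.+1%:R)%R).
have h : (s / n.+1%:R)%R @[n --> \oo] --> (s * 0)%R.
  by apply: cvgM; [exact: cvg_cst|exact: cvg_harmonic].
by rewrite mulr0 in h.
Unshelve. all: by end_near. Qed.

(** Extended-real valued, so that identities can be proved before finiteness is known. The indicator
    is a factor of the integrand because the layer cake formula integrates over the whole line. *)
Definition egamma (x : R) : \bar R := \int[mu]_t ((0 < t)%R%:R * (t `^ (x - 1) * expR (- t)))%:E.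

Lemma GammaE (x : R) : Gamma x = fine (egamma x).
Proof.
rewrite /Gamma /Rintegral /egamma integral_mkcond; congr fine.
apply: eq_integral => t _; rewrite patchE mem_setE in_itv/= andbT.
by case: ifPn => _; rewrite ?mul1r ?mul0r.
Qed.

Section layer_cake.
Context d (T : measurableType d) (m : {sigma_finite_measure set T -> \bar R}).

(** By Tonelli, exp(- q) is the integral of exp(- s) over the levels s > q. If the sublevel sets of
    [q] have [H]-mass s^x V, what remains is V times the integral of s^x exp(- s). *)
Lemma ge0_layer_cake (x : R) (q : T -> R) (H : T -> \bar R) (V : \bar R) :
    measurable_fun setT q -> (forall t, 0 <= q t)%R ->
    measurable_fun setT H -> (forall t, 0 <= H t) -> 0 <= V ->
    (forall s, (0 < s)%R -> \int[m]_t ((q t < s)%R%:R%:E * H t) = (s `^ x)%:E * V) ->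
  \int[m]_t ((expR (- q t))%:E * H t) = egamma (x + 1) * V.
Proof.
move=> mq q0 mH H0 V0 HV.
pose f (z : T * measurableTypeR R) : \bar R := ((q z.1 < z.2)%R%:R * expR (- z.2))%:E * H z.1.
have mf : measurable_fun setT f.
  apply: emeasurable_funM; last exact: measurableT_comp.
  apply/measurable_EFinP; apply: measurable_funM.
    apply: measurable_natb; apply: measurable_fun_ltr => //.
    exact: measurableT_comp.
  by apply: measurableT_comp => //; apply: measurableT_comp.
have f0 z : 0 <= f z by rewrite mule_ge0// lee_fin mulr_ge0 ?expR_ge0.
transitivity (\int[m]_t \int[mu]_s f (t, s)).
  apply: eq_integral => t _; rewrite -integral_expRN_tail -ge0_integralZr//.
  apply/measurable_EFinP; apply: measurable_funM.
    by apply: measurable_natb; exact: measurable_fun_ltr.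
  exact: measurableT_comp.
rewrite fubini_tonelli//.
transitivity (\int[mu]_s (((0 < s)%R%:R * (s `^ (x + 1 - 1) * expR (- s)))%:E * V)).
  apply: eq_integral => s _.
  have [s0|s0] := ltP 0%R s.
    rewrite mul1r addrK EFinM muleAC -HV// muleC -ge0_integralZl//.
    - by apply: eq_integral => t _; rewrite /f/= EFinM muleCA muleA.
    - apply: emeasurable_funM => //; apply/measurable_EFinP; apply: measurable_natb.
      exact: measurable_fun_ltr.
    - by move=> t _; rewrite mule_ge0.
  rewrite mul0r mul0e integral0_eq// => t _.
  by rewrite /f/= ltNge (le_trans s0 (q0 t))/= mul0r mul0e.
rewrite ge0_integralZr//.
- apply/measurable_EFinP; apply: measurable_funM.
    by apply: measurable_natb; exact: measurable_fun_ltr.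
  apply: measurable_funM; first exact: measurable_powR.
  exact: measurableT_comp.
- by move=> s _; rewrite lee_fin !mulr_ge0 ?powR_ge0 ?expR_ge0.
Qed.

End layer_cake.
End gamma.

Section gamma_half.
Context {R : realType}.
Local Open Scope ereal_scope.
Notation mu := (@lebesgue_measure R).
Notation leb := (@lebesgue_tuple R).

(** Instead of an integration by parts, the layer cake formula is applied to the positive part of t
    with weight x t^(x - 1) on t > 0, whose mass below s is s^x. *)
Lemma egammaS (x : R) : (0 < x)%R -> egamma (x + 1) = x%:E * egamma x.
Proof.
move=> x0.
have mb : measurable_fun setT (fun t : R => (0 < t)%R%:R : R).
  by apply: measurable_natb; exact: measurable_fun_ltr.
pose H (t : measurableTypeR R) : \bar R := ((0 < t)%R%:R * (x * t `^ (x - 1)))%:E.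
have mH : measurable_fun setT H.
  apply/measurable_EFinP; apply: measurable_funM => //.
  by apply: measurable_funM => //; exact: measurable_powR.
have H0 t : 0 <= H t by rewrite lee_fin !mulr_ge0 ?powR_ge0// ltW.
rewrite -[LHS]mule1 -(@ge0_layer_cake _ _ _ mu x (Num.max^~ 0%R) H 1) => //; first last.
- move=> s s0; rewrite mule1 -integral_powR_itv//.
  rewrite -integral_itv_bndo_bndc; last first.
    by apply: measurable_funTS; apply/measurable_EFinP; apply: measurable_funM.
  rewrite [RHS]integral_mkcond; apply: eq_integral => t _.
  rewrite patchE mem_setE in_itv/= /H -EFinM gt_max s0 andbT.
  by case: (0 < t)%R; case: (t < s)%R; rewrite /= ?mul1r ?mul0r ?mulr0.
- by move=> t; rewrite le_max lexx orbT.
- by apply: measurable_maxr.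
rewrite /egamma -ge0_integralZl//; first last.
- by rewrite lee_fin ltW.
- by move=> t _; rewrite lee_fin !mulr_ge0 ?powR_ge0 ?expR_ge0.
- apply/measurable_EFinP; apply: measurable_funM => //; apply: measurable_funM.
    exact: measurable_powR.
  exact: measurableT_comp.
apply: eq_integral => t _; rewrite /H -!EFinM; congr EFin.
by have [t0|t0] := ltP 0%R t; [ring|rewrite !mul0r !mulr0].
Qed.

Lemma egamma1 : egamma (1 : R) = 1.
Proof.
have := integral_expRN_tail (0 : R); rewrite oppr0 expR0 => <-.
by apply: eq_integral => t _; rewrite subrr powRr0 mul1r.
Qed.

Section block.
Variables (k : nat) (K : {set 'I_k}) (H : k.-tuple R -> \bar R).
Hypotheses (mH : measurable_fun setT H) (H0 : forall t, 0 <= H t).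
Hypothesis HK : forall (c : 'I_k -> R) t, (forall i, i \notin K -> c i = 1)%R ->
  H (taffine c (fun=> 0%R) t) = H t.

Definition sqnorm_on (t : k.-tuple R) : R := \sum_(i in K) tnth t i ^+ 2.

Lemma sqnorm_on_ge0 t : (0 <= sqnorm_on t)%R.
Proof. by apply: sumr_ge0 => i _; exact: sqr_ge0. Qed.

Lemma measurable_sqnorm_on : measurable_fun setT sqnorm_on.
Proof.
rewrite /sqnorm_on; under eq_fun do rewrite -big_enum/=.
by apply: measurable_sum => i; apply: measurable_funX; exact: measurable_tnth.
Qed.

Lemma measurable_sqrt_sqnorm_on : measurable_fun setT (fun t => Num.sqrt (sqnorm_on t)).
Proof.
apply: measurableT_comp; last exact: measurable_sqnorm_on.
by apply: continuous_measurable_fun; exact: sqrt_continuous.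
Qed.

Let V := \int[leb k]_t ((Num.sqrt (sqnorm_on t) < 1)%R%:R%:E * H t).

Let V0 : 0 <= V.
Proof. by apply: integral_ge0 => t _; rewrite mule_ge0. Qed.

Let ball_scale (s : R) : (0 < s)%R ->
  \int[leb k]_t ((Num.sqrt (sqnorm_on t) < s)%R%:R%:E * H t) = (s ^+ #|K|)%:E * V.
Proof.
move=> s0; pose c i := if i \in K then s else 1%R.
rewrite (@ge0_integral_taffine _ _ c (fun=> 0%R)); last 3 first.
- by move=> i; rewrite /c; case: ifP.
- apply: emeasurable_funM => //; apply/measurable_EFinP; apply: measurable_natb.
  by apply: measurable_fun_ltr => //; exact: measurable_sqrt_sqnorm_on.
- by move=> t; rewrite mule_ge0.
congr (_%:E * _).
  by rewrite /c -big_mkcond/= prodr_const.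
apply: eq_integral => t _; rewrite HK; last by move=> i /negbTE; rewrite /c => ->.
congr ((_ : bool)%:R%:E * _).
rewrite (_ : sqnorm_on _ = s ^+ 2 * sqnorm_on t)%R; last first.
  rewrite /sqnorm_on mulr_sumr; apply: eq_bigr => i iK.
  by rewrite tnth_mktuple /c iK addr0 exprMn.
rewrite sqrtrM ?sqr_ge0// sqrtr_sqr gtr0_norm// -[X in (_ < X)%R]mulr1.
by rewrite ltr_pM2l.
Qed.

(** As [H] ignores dilations of the coordinates in [K], the balls of the block norm have mass s^k V
    with k = #|K|. The layer cake formula gives Gamma(k + 1) V for the norm and Gamma(k / 2 + 1) V
    for its square, and the unknown V cancels. The identity is multiplied out because neither V nor
    the Gamma values are known to be finite here. *)
Lemma ge0_integral_block : (0 < #|K|)%N ->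
  egamma (#|K|%:R / 2) * \int[leb k]_t ((expR (- Num.sqrt (sqnorm_on t)))%:E * H t) =
  2%:E * egamma #|K|%:R * \int[leb k]_t ((expR (- sqnorm_on t))%:E * H t).
Proof.
move=> K0; have k0 : (0 < #|K|%:R :> R)%R by rewrite ltr0n.
have E1 : \int[leb k]_t ((expR (- Num.sqrt (sqnorm_on t)))%:E * H t) =
    egamma (#|K|%:R + 1) * V.
  apply: ge0_layer_cake => //; first exact: measurable_sqrt_sqnorm_on.
  by move=> s s0; rewrite ball_scale// powR_mulrn// ltW.
have E2 : \int[leb k]_t ((expR (- sqnorm_on t))%:E * H t) =
    egamma (#|K|%:R / 2 + 1) * V.
  apply: ge0_layer_cake => //; first exact: measurable_sqnorm_on.
    exact: sqnorm_on_ge0.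
  move=> s s0; rewrite mulrC powRrM powR12_sqrt ?ltW// powR_mulrn ?sqrtr_ge0//.
  rewrite -ball_scale ?sqrtr_gt0//; apply: eq_integral => t _.
  by rewrite ltr_sqrt.
rewrite E1 E2 !egammaS ?divr_gt0//.
set a := egamma (_ / _); set b := egamma _.
have -> : #|K|%:R%:E = 2%:E * (#|K|%:R / 2)%:E :> \bar R.
  by rewrite -EFinM mulrCA divff// mulr1.
rewrite !muleA; congr (_ * V).
by rewrite (muleC a) -!muleA; congr (_ * _); rewrite [LHS]muleCA [RHS]muleCA (muleC a).
Qed.
End block.

(** For 1/2, the block identity on the line reads Gamma(1/2) A = 2 sqrt(pi), where A is the integral
    of exp(- |t|). As A >= 1, Gamma(1/2) is finite, and it is not 0 because the right-hand side is
    not. *)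
Lemma egamma_half k : (0 < k)%N -> exists2 r : R, (0 < r)%R & egamma (k%:R / 2) = r%:E.
Proof.
have half : exists2 r : R, (0 < r)%R & egamma (1%:R / 2) = r%:E.
  have := @ge0_integral_block 1 [set: 'I_1]%SET (cst 1).
  rewrite cardsT card_ord egamma1 mule1 => /(_ _ _ _ isT).
  have -> : \int[leb 1]_t ((expR (- sqnorm_on [set: 'I_1]%SET t))%:E * cst 1 t) =
      (Num.sqrt pi)%:E.
    have := @integral_gauss_tuple R 1; rewrite expr1 => <-; apply: eq_integral => t _.
    by rewrite mule1 /sqnorm_on; congr (expR (- _))%:E; apply: eq_bigl => i; rewrite inE.
  set A := \int[_]_t _ => /(_ (measurable_cst _) (fun=> lee01) (fun _ _ _ => erefl)) h.
  have mE : measurable_fun setT (fun t : 1.-tuple R =>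
      (expR (- Num.sqrt (sqnorm_on [set: 'I_1]%SET t)))%:E * cst 1 t).
    apply: emeasurable_funM => //; apply/measurable_EFinP; apply: measurableT_comp => //.
    by apply: measurableT_comp => //; exact: measurable_sqrt_sqnorm_on.
  have A1 : 1 <= A.
    rewrite /A ge0_integral_lebesgue_tupleS//; last by move=> t; rewrite mule_ge0.
    apply: (@le_trans _ _ (\int[mu]_s ((0 < s)%R%:R * expR (- s))%:E)).
      by rewrite integral_expRN_tail oppr0 expR0.
    have mE0 (x : R) : measurable_fun setT (fun t : 0.-tuple R =>
        (expR (- Num.sqrt (sqnorm_on [set: 'I_1]%SET (cons_pair (x, t)))))%:E * cst 1 (cons_pair (x, t))).
      apply: (measurableT_comp mE).
      by apply: (@measurable_cons _ _ _ _ (cst x) _ id).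
    apply: ge0_le_integral => //.
    - apply/measurable_EFinP; apply: measurable_funM; last exact: measurableT_comp.
      by apply: measurable_natb; exact: measurable_fun_ltr.
    - apply: (measurable_fun_fubini_tonelli_F (m2 := leb 0) (fun z : R * 0.-tuple R =>
        (expR (- Num.sqrt (sqnorm_on [set: 'I_1]%SET (cons_pair z))))%:E * cst 1 (cons_pair z))).
        by apply: (measurableT_comp mE); exact: measurable_cons_pair.
      by move=> ?; rewrite mule_ge0.
    move=> x _; rewrite (ge0_integral_lebesgue_tuple0 (mE0 x)).
    rewrite mule1 lee_fin /sqnorm_on (eq_bigl predT); last by move=> i; rewrite inE.
    rewrite big_ord_recl big_ord0 addr0 (tnth_nth 0%R)/= sqrtr_sqr.
    have [x0|x0] := ltP 0%R x; first by rewrite mul1r gtr0_norm.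
    by rewrite mul0r expR_ge0.
  have e0 : 0 <= egamma (1%:R / 2 : R).
    by apply: integral_ge0 => t _; rewrite lee_fin !mulr_ge0 ?powR_ge0 ?expR_ge0.
  have s0 : (0 < Num.sqrt (pi : R))%R by rewrite sqrtr_gt0 pi_gt0.
  have : egamma (1%:R / 2 : R) <= (2 * Num.sqrt pi)%:E.
    rewrite EFinM -h lee_pemulr//.
  have : egamma (1%:R / 2 : R) != 0.
    apply/eqP => e; move: h; rewrite e mul0e -EFinM => -[] /esym/eqP.
    by rewrite mulf_eq0 (gt_eqF s0) orbF pnatr_eq0.
  case: (egamma _) e0 => // r; rewrite lee_fin => r0 rn0 _; exists r => //.
  by rewrite lt_neqAle r0 andbT eq_sym.
(* The recursion moves the argument by 1, that is [k] by 2, so two consecutive values are carried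
   along. *)
suff : forall k, (exists2 r : R, (0 < r)%R & egamma (k.+1%:R / 2) = r%:E) /\
  (exists2 r : R, (0 < r)%R & egamma (k.+2%:R / 2) = r%:E).
  by move=> h; case: k => // k _; have [] := h k.
elim=> [|n [[r r0 rE] IH]].
  split; first exact: half.
  by exists 1%R => //; rewrite divff// egamma1.
split => //; rewrite (_ : n.+3%:R / 2 = n.+1%:R / 2 + 1)%R; last first.
  by rewrite -addn2 natrD mulrDl divff.
exists (n.+1%:R / 2 * r)%R; first by rewrite mulr_gt0 ?divr_gt0.
by rewrite egammaS ?rE// divr_gt0.
Qed.

End gamma_half.

Section exp_norms.
Context {R : realType}.
Local Open Scope ereal_scope.
Notation leb := (@lebesgue_tuple R).

Lemma Gamma_half k : (0 < k)%N ->
  (0 < Gamma (k%:R / 2 : R))%R /\ egamma (k%:R / 2 : R) = (Gamma (k%:R / 2))%:E.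
Proof. by move=> /(@egamma_half R)[r r0 rE]; rewrite GammaE rE. Qed.

Lemma Gamma_nat k : (0 < k)%N ->
  (0 < Gamma (k%:R : R))%R /\ egamma (k%:R : R) = (Gamma k%:R)%:E.
Proof.
move=> k0; rewrite (_ : k%:R = (2 * k)%:R / 2 :> R)%R; last first.
  by rewrite natrM mulrAC divff// mul1r.
by apply: Gamma_half; rewrite muln_gt0.
Qed.

Variables (D p : nat) (K : 'I_p -> {set 'I_D}).
Implicit Types (t : D.-tuple R) (r : seq 'I_p).

(** Interpolates between the exponential of the norms ([r2] empty) and the Gaussian integrand ([r1]
    empty). *)
Let expn r1 r2 t : R :=
  expR (- \sum_(j <- r1) Num.sqrt (sqnorm_on (K j) t) - \sum_(j <- r2) sqnorm_on (K j) t).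

Let measurable_expn r1 r2 : measurable_fun setT (fun t => (expn r1 r2 t)%:E).
Proof.
apply/measurable_EFinP; apply: measurableT_comp => //; apply: measurable_funB.
  apply: measurableT_comp => //; apply: measurable_sum => j.
  exact: measurable_sqrt_sqnorm_on.
by apply: measurable_sum => j; exact: measurable_sqnorm_on.
Qed.

Let sqnorm_on_taffine (c : 'I_D -> R) (j : 'I_p) (B : {set 'I_D}) t :
  [disjoint K j & B]%B -> (forall i, i \notin B -> c i = 1)%R ->
  sqnorm_on (K j) (taffine c (fun=> 0%R) t) = sqnorm_on (K j) t.
Proof.
move=> dj c1; apply: eq_bigr => i iK.
by rewrite tnth_mktuple addr0 c1 ?mul1r// (disjointFr dj).
Qed.

(** The groups move from [r1] to [r2] one at a time. Each move is [ge0_integral_block] with the rest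
    of the integrand as [H], which is insensitive to dilations of that group because the groups are
    disjoint. *)
Let swap r1 r2 : uniq (r1 ++ r2) ->
  {in r1 ++ r2 &, forall i j, i != j -> [disjoint K i & K j]%B} ->
  {in r1 ++ r2, forall j, 0 < #|K j|}%N ->
  (\prod_(j <- r1) Gamma (#|K j|%:R / 2 : R))%:E * \int[leb D]_t (expn r1 r2 t)%:E =
  (\prod_(j <- r1) (2 * Gamma (#|K j|%:R : R)))%:E * \int[leb D]_t (expn [::] (r1 ++ r2) t)%:E.
Proof.
elim: r1 r2 => [|j r1 IH] r2 /=; first by rewrite !big_nil.
rewrite mem_cat => /andP[jr ur] dK nK.
have pe : perm_eq (r1 ++ j :: r2) (j :: r1 ++ r2) by rewrite -cat1s perm_catCA.
have := IH (j :: r2); rewrite (perm_uniq pe)/= mem_cat jr ur => /(_ isT) {}IH.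
rewrite !big_cons !EFinM -!muleA.
have K0 : (0 < #|K j|)%N by apply: nK; rewrite inE eqxx.
have disj i : i \in r1 ++ r2 -> [disjoint K i & K j]%B.
  move=> ir; apply: dK; rewrite ?inE ?ir ?eqxx ?orbT//.
  by apply: contraNneq jr => <-; rewrite -mem_cat.
have H0 t : 0 <= (expn r1 r2 t)%:E by rewrite lee_fin expR_ge0.
have HK c t : (forall i, i \notin K j -> c i = 1)%R ->
    (expn r1 r2 (taffine c (fun=> 0%R) t))%:E = (expn r1 r2 t)%:E.
  move=> c1; have e i : i \in r1 ++ r2 ->
      sqnorm_on (K i) (taffine c (fun=> 0%R) t) = sqnorm_on (K i) t.
    by move=> ir; rewrite (@sqnorm_on_taffine c i (K j))// disj.
  rewrite /expn; under eq_big_seq => i ir do rewrite e ?mem_cat ?ir//.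
  by under [X in (_ - X)%R]eq_big_seq => i ir do rewrite e ?mem_cat ?ir ?orbT//.
have := ge0_integral_block (measurable_expn r1 r2) H0 HK K0.
rewrite (Gamma_half K0).2 (Gamma_nat K0).2 => h.
rewrite muleCA (_ : \int[leb D]_t (expn (j :: r1) r2 t)%:E =
  \int[leb D]_t ((expR (- Num.sqrt (sqnorm_on (K j) t)))%:E * (expn r1 r2 t)%:E)); last first.
  apply: eq_integral => t _; rewrite -EFinM -expRD /expn big_cons; congr (expR _)%:E.
  by rewrite opprD addrA.
rewrite h -!muleA [LHS]muleCA; congr (_ * _).
rewrite [LHS]muleCA; congr (_ * _).
rewrite (_ : \int[leb D]_t (expn [::] (j :: r1 ++ r2) t)%:E =
  \int[leb D]_t (expn [::] (r1 ++ j :: r2) t)%:E); last first.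
  by apply: eq_integral => t _; rewrite /expn (perm_big _ pe).
rewrite -IH//.
- congr (_ * _); apply: eq_integral => t _; rewrite -EFinM -expRD /expn big_cons; congr (expR _)%:E.
  by rewrite opprD addrCA.
- by move=> x y; rewrite !(perm_mem pe); exact: dK.
- by move=> x; rewrite (perm_mem pe); exact: nK.
Qed.

Lemma integral_expN_norms (S : {set 'I_p}) (a : R) : (0 < a)%R ->
  {in S &, forall i j, i != j -> [disjoint K i & K j]%B} ->
  {in S, forall j, 0 < #|K j|}%N ->
  (forall i, exists2 j, j \in S & i \in K j) ->
  \int[leb D]_t (expR (- (a * \sum_(j in S) Num.sqrt (sqnorm_on (K j) t))))%:E =
  ((Num.sqrt pi / a) ^+ D *
   \prod_(j in S) (2 * Gamma (#|K j|%:R : R) / Gamma (#|K j|%:R / 2)))%:E.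
Proof.
move=> a0 dK nK cK.
have E1 : \int[leb D]_t (expR (- \sum_(j in S) Num.sqrt (sqnorm_on (K j) t)))%:E =
    (Num.sqrt pi ^+ D * \prod_(j in S) (2 * Gamma (#|K j|%:R : R) / Gamma (#|K j|%:R / 2)))%:E.
  have := @swap (enum S) [::]; rewrite cats0 enum_uniq => /(_ isT).
  have -> : \int[leb D]_t (expn [::] (enum S) t)%:E = (Num.sqrt pi ^+ D)%:E.
    rewrite -integral_gauss_tuple; apply: eq_integral => t _.
    rewrite /expn big_nil oppr0 add0r big_enum/=; congr (expR (- _))%:E.
    (* Every coordinate lies in exactly one of the groups, so the squared group norms add up to the
       full sum of squares. *)
    rewrite /sqnorm_on (exchange_big_dep predT)//=; apply: eq_bigr => i _.
    have [j jS ij] := cK i; rewrite (big_pred1 j)// => j'; apply/andP/eqP => [[j'S ij']|->//].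
    by apply/eqP; apply: contraTT ij => jj'; rewrite (disjointFr (dK _ _ j'S jS jj')).
  move=> /(_ _ _)/wrap[].
  - by move=> x y; rewrite !mem_enum; exact: dK.
  - by move=> x; rewrite mem_enum; exact: nK.
  rewrite !big_enum/= -EFinM => h.
  have P0 : (0 < \prod_(j in S) Gamma (#|K j|%:R / 2 : R))%R.
    by apply: prodr_gt0 => j /nK/Gamma_half[].
  have -> : \int[leb D]_t (expR (- \sum_(j in S) Num.sqrt (sqnorm_on (K j) t)))%:E =
      \int[leb D]_t (expn (enum S) [::] t)%:E.
    by apply: eq_integral => t _; rewrite /expn big_nil subr0 big_enum.
  rewrite -[LHS]mul1e -[X in X%:E * _](@mulVf _ _ (lt0r_neq0 P0)) EFinM -muleA h -EFinM.
  by rewrite prodf_div [in LHS]mulrC -[in LHS]mulrA [in LHS]mulrCA.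
have mN : measurable_fun setT (fun t => (expR (- \sum_(j in S) Num.sqrt (sqnorm_on (K j) t)))%:E).
  under eq_fun do rewrite -big_enum/=.
  apply/measurable_EFinP; apply: measurableT_comp => //; apply: measurableT_comp => //.
  by apply: measurable_sum => j; exact: measurable_sqrt_sqnorm_on.
(* The rate [a] is brought in by dilating all coordinates in the case of rate 1. *)
rewrite (@ge0_integral_taffine _ _ (fun=> a) (fun=> 0%R) _ _ mN) in E1 => //.
rewrite expr_div_n -mulrA [X in (_ * X)%R]mulrC mulrA EFinM -E1 prodr_const card_ord.
rewrite muleC muleA -EFinM mulVf ?mul1e ?expf_neq0 ?gt_eqF//.
apply: eq_integral => t _; congr (expR (- _))%:E; rewrite mulr_sumr; apply: eq_bigr => j _.
rewrite (_ : sqnorm_on _ (taffine _ _ _) = a ^+ 2 * sqnorm_on (K j) t)%R; last first.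
  rewrite /sqnorm_on mulr_sumr; apply: eq_bigr => i iK.
  by rewrite tnth_mktuple addr0 exprMn.
by rewrite sqrtrM ?sqr_ge0// sqrtr_sqr gtr0_norm.
Qed.

End exp_norms.

(** * Integrals against the prior *)

Section density.
Context d1 d2 (T : measurableType d1) (U : measurableType d2) (R : realType).
Variables (m : {measure set T -> \bar R}) (nu : {measure set U -> \bar R}).
Variables (g : T -> R) (phi : T -> U).
Hypotheses (mg : measurable_fun setT g) (g0 : forall t, 0 <= g t).
Hypothesis mphi : measurable_fun setT phi.
Local Open Scope ereal_scope.
Hypothesis nuE : forall A, measurable A -> nu A = \int[m]_(t in phi @^-1` A) (g t)%:E.
Import HBNNSimple.

(** True for indicators by [nuE], hence for simple functions, hence for their increasing limits. *)
Lemma ge0_integral_density (f : U -> \bar R) :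
  measurable_fun setT f -> (forall u, 0 <= f u) ->
  \int[nu]_u f u = \int[m]_t ((g t)%:E * f (phi t)).
Proof.
move=> mf f0; pose f_ := nnsfun_approx measurableT mf.
have mgE : measurable_fun setT (fun t => (g t)%:E) by apply/measurable_EFinP.
transitivity (limn (fun n => \int[nu]_u (f_ n u)%:E)).
  rewrite -monotone_convergence//.
  - apply: eq_integral => u _; apply/esym/cvg_lim => //.
    exact: cvg_nnsfun_approx.
  - by move=> n; exact/measurable_EFinP/measurable_funP.
  - by move=> n y _; rewrite lee_fin.
  - by move=> y _ a b ab; rewrite lee_fin; exact/lefP/nd_nnsfun_approx.
have E n : \int[nu]_u (f_ n u)%:E = \int[m]_t ((g t)%:E * (f_ n (phi t))%:E).
  transitivity (\sum_(k \in range (f_ n)) \int[m]_t ((g t)%:E * (k * \1_(f_ n @^-1` [set k]) (phi t))%:E)).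
    under eq_integral do rewrite fimfunE -fsumEFin//.
    rewrite ge0_integral_fsum//; last 2 first.
    - by move=> r; exact/measurable_EFinP/measurable_funM.
    - by move=> r x _; rewrite nnfun_muleindic_ge0.
    apply: eq_fsbigr => r rf.
    have r0 : (0 <= r)%R by move: rf; rewrite inE => -[x _ <-].
    rewrite integralZl_indic_nnsfun// integral_indic// setIT nuE//.
    rewrite integral_mkcond -ge0_integralZl//; last 2 first.
    - apply/(measurable_restrictT _ _).1 => //.
        by rewrite -[X in measurable X]setTI; apply: mphi.
      exact: measurable_funTS.
    - by move=> t _; apply: erestrict_ge0 => x _; rewrite lee_fin.
    apply: eq_integral => t _; rewrite patchE/= indicE.
    rewrite (_ : (t \in phi @^-1` _) = (phi t \in f_ n @^-1` [set r])); last first.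
      by apply/idP/idP; rewrite !inE.
    by case: ifPn => _; rewrite ?mulr1 ?mulr0 ?mule0// muleC.
  rewrite -ge0_integral_fsum//.
  - apply: eq_integral => t _; rewrite (fimfunE (f_ n) (phi t)) -fsumEFin// ge0_mule_fsumr//.
    by move=> r; rewrite nnfun_muleindic_ge0.
  - move=> r; apply: emeasurable_funM => //; apply/measurable_EFinP; apply: measurable_funM => //.
    by apply: (@measurableT_comp _ _ _ _ _ _ (\1_(f_ n @^-1` [set r]) : U -> R)) => //.
  - move=> r t _; apply: mule_ge0; first by rewrite lee_fin.
    by rewrite EFinM nnfun_muleindic_ge0.
under eq_fun do rewrite E.
rewrite -monotone_convergence//.
- apply: eq_integral => t _; apply: cvg_lim => //; apply: cvgeZl => //.
  exact: cvg_nnsfun_approx.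
- move=> n; apply: emeasurable_funM => //; apply/measurable_EFinP.
  by apply: measurableT_comp.
- by move=> n t _; rewrite mule_ge0 ?lee_fin.
- move=> t _ a b ab; rewrite lee_wpmul2l ?lee_fin//.
  exact/lefP/nd_nnsfun_approx.
Qed.
End density.

Section prior_integral.
Context {R : realType} {m n d p : nat}.
Variables (G : 'I_p -> {set 'I_d}) (X : 'I_n -> 'M[R]_(m.-1, d)) (ppi : dim_pmf R p).
Local Open Scope ereal_scope.

Lemma ge0_integral_prior (f : d.-tuple R -> \bar R) :
  measurable_fun setT f -> (forall t, 0 <= f t) ->
  \int[prior G X ppi]_t f t = \sum_(S : {set 'I_p})
   (ppi #|S| / 'C(p, #|S|)%:R)%:E *
   \int[lebesgue_tuple (dimS G S)]_t ((slab X t)%:E * f (@embedS R _ _ G S t)).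
Proof.
move=> mf f0.
have w0 (S : {set 'I_p}) : (0 <= ppi #|S| / 'C(p, #|S|)%:R)%R.
  by rewrite divr_ge0 ?dim_pmf_ge0.
pose N := #|{: {set 'I_p}}|.
(* The subsets are numbered because [msum] adds an initial segment of a sequence of measures. *)
pose F (i : nat) : {set 'I_p} := nth finset.set0 (enum {: {set 'I_p}}) i.
pose mu_ (i : nat) : {measure set (d.-tuple R) -> \bar R} :=
  mscale (NngNum (w0 (F i))) (prior_given G X (F i)).
have sumE (h : {set 'I_p} -> \bar R) : \sum_(S : {set 'I_p}) h S = \sum_(i < N) h (F i).
  rewrite -big_enum/= (big_nth finset.set0) big_mkord /N -cardE.
  by [].
transitivity (\int[msum mu_ N]_t f t).
  apply: eq_measure_integral => A mA _.
  by rewrite /msum/= /prior sumE.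
rewrite ge0_integral_measure_sum// sumE; apply: eq_bigr => i _.
rewrite ge0_integral_mscale//; congr (_ * _).
apply: ge0_integral_density => //.
- exact: measurable_slab.
- by move=> t; exact: slab_ge0.
- exact: measurable_embedS.
Qed.

End prior_integral.

(** The normalisation of a slab times the value in [integral_expN_norms]. [P] and [Q] stand for the
    products of Gamma values and [c] for the power of 2. *)
Lemma slab_cancel (F : fieldType) (a P Q l s c : F) D :
  a != 0 -> P != 0 -> Q != 0 -> s != 0 -> c != 0 ->
  (l / s) ^+ D * (P / (c * Q)) * ((s / a) ^+ D * (c * Q / P)) = (l / a) ^+ D.
Proof.
move=> a0 P0 Q0 s0 c0; rewrite mulrACA -exprMn (_ : l / s * (s / a) = l / a); last first.
  by field; rewrite s0 a0.
by rewrite (_ : P / (c * Q) * (c * Q / P) = 1) ?mulr1//; field; rewrite P0 Q0 c0.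
Qed.

(** * Group norms and slab integrals *)

Section group_geometry.
Context {R : realType} {d p : nat}.
Variable G : 'I_p -> {set 'I_d}.
Hypothesis hG : group_partition G.
Implicit Types (S : {set 'I_p}) (b : 'cV[R]_d) (j : 'I_p).

Lemma group_disjoint j k : j != k -> [disjoint G j & G k]%B.
Proof. by case: hG => _ h _ /h; rewrite -setI_eq0 => ->. Qed.

Lemma gsize_gt0 j : (0 < gsize G j)%N.
Proof. by case: hG => h _ _; rewrite /gsize card_gt0. Qed.

Lemma mem_group i : exists j, i \in G j.
Proof.
case: hG => _ _ h; have : i \in [set: 'I_d]%SET by rewrite inE.
by rewrite -h => /finset.bigcupP[j _ ij]; exists j.
Qed.

Lemma l2norm_sqr k (v : 'cV[R]_k) : l2norm v ^+ 2 = \sum_i v i 0 ^+ 2.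
Proof. by rewrite sqr_sqrtr// sumr_ge0// => i _; exact: sqr_ge0. Qed.

Lemma l2norm_ge0 k (v : 'cV[R]_k) : 0 <= l2norm v.
Proof. exact: sqrtr_ge0. Qed.

Lemma l2norm_vecgroup b j : l2norm (vecgroup G b j) = Num.sqrt (\sum_(i in G j) b i 0 ^+ 2).
Proof.
rewrite /l2norm (big_enum_val (fun i => b i 0 ^+ 2))/=; congr Num.sqrt.
by apply: eq_bigr => i _; rewrite mxE.
Qed.

(** The place at which [embedS] puts the coordinate [i]; the cast is along [card_coordS]. *)
Definition coord_val S (i : 'I_(dimS G S)) : 'I_d :=
  enum_val (cast_ord (esym (card_coordS S hG)) i).
Definition coord_block S j : {set 'I_(dimS G S)} := [set i | coord_val i \in G j]%SET.

Lemma tnth_embedS S (t : (dimS G S).-tuple R) (i : 'I_(dimS G S)) :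
  tnth (embedS t) (coord_val i) = tnth t i.
Proof.
rewrite tnth_mktuple (tnth_nth 0); congr nth.
rewrite /coord_val; set k := cast_ord _ i.
rewrite (enum_val_nth (enum_val k)) index_uniq ?enum_uniq//.
by rewrite -cardE.
Qed.

Lemma sum_group_coord S j (F : 'I_d -> R) : j \in S ->
  \sum_(i in G j) F i = \sum_(i in coord_block S j) F (coord_val i).
Proof.
move=> jS.
transitivity (\sum_(i in coordS G S | i \in G j) F i).
  apply: eq_bigl => i; case: (boolP (i \in G j)) => iG; rewrite ?andbF// andbT.
  by apply/esym/finset.bigcupP; exists j.
rewrite (big_enum_val_cond (A := mem (coordS G S)) (fun i => i \in G j) F)/=.
rewrite (reindex (cast_ord (esym (card_coordS S hG))))/=; last first.
  by exists (cast_ord (card_coordS S hG)) => i _; rewrite ?cast_ordK ?cast_ordKV.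
by apply: eq_bigl => i; rewrite inE.
Qed.

Lemma card_coord_block S j : j \in S -> #|coord_block S j| = gsize G j.
Proof.
move=> jS; have := @sum_group_coord S j (fun=> 1) jS.
by rewrite !sumr_const => /eqP; rewrite eqr_nat => /eqP <-.
Qed.

Lemma norm21_embedS S (t : (dimS G S).-tuple R) :
  norm21 G S (tcol (embedS t)) = \sum_(j in S) Num.sqrt (sqnorm_on (coord_block S j) t).
Proof.
rewrite /norm21; apply: eq_bigr => j jS; rewrite l2norm_vecgroup; congr Num.sqrt.
rewrite (@sum_group_coord S)//; apply: eq_bigr => i _.
by rewrite mxE tnth_embedS.
Qed.

Definition shiftS b S (t : (dimS G S).-tuple R) : (dimS G S).-tuple R :=
  taffine (fun=> 1) (fun i => - b (coord_val i) 0) t.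

Lemma norm21_shiftS b S (t : (dimS G S).-tuple R) :
  norm21 G S (tcol (embedS (shiftS b t))) = norm21 G S (tcol (embedS t) - b).
Proof.
rewrite /norm21; apply: eq_bigr => j jS; rewrite !l2norm_vecgroup; congr Num.sqrt.
rewrite !(@sum_group_coord S)//; apply: eq_bigr => i _.
by rewrite !mxE !tnth_embedS tnth_mktuple mul1r.
Qed.

Section slab.
Context {m n : nat} (X : 'I_n -> 'M[R]_(m.-1, d)).

Definition slab_const S : R := (lambda G X / Num.sqrt pi) ^+ dimS G S *
  ((\prod_(j in S) Gamma ((gsize G j)%:R / 2)) /
   (2 ^+ #|S| * \prod_(j in S) Gamma (gsize G j)%:R)).

Lemma slab_const_ge0 S : 0 <= slab_const S.
Proof.
rewrite !mulr_ge0//.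
- by rewrite exprn_ge0// !mulr_ge0 ?invr_ge0 ?sqrtr_ge0 ?gnorm_ge0.
- by rewrite prodr_ge0// => j _; exact: Gamma_ge0.
- by rewrite invr_ge0 mulr_ge0 ?exprn_ge0// prodr_ge0// => j _; exact: Gamma_ge0.
Qed.

(** For [a] equal to a positive [lambda] this is the normalisation of the slab. A smaller rate costs
    a power of the ratio of the rates, which is the origin of 16 ^ D, and recentring at [b] is free
    by translation invariance. *)
Lemma integral_slab_scaled S a b : 0 < a ->
  (\int[lebesgue_tuple (dimS G S)]_t
     (slab_const S * expR (- (a * norm21 G S (tcol (embedS t) - b))))%:E =
   ((lambda G X / a) ^+ dimS G S)%:E)%E.
Proof.
move=> a0.
pose N t := norm21 G S (tcol (@embedS R _ _ G S t)).
have mN : measurable_fun setT (fun t => (expR (- (a * N t)))%:E).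
  apply/measurable_EFinP; apply: measurableT_comp => //; apply: measurableT_comp => //.
  apply: measurable_funM => //.
  by apply: (measurableT_comp (measurable_norm21 G S)); exact: measurable_embedS.
have mNs : measurable_fun setT (fun t => (expR (- (a * N (shiftS b t))))%:E).
  by apply: (measurableT_comp mN); exact: measurable_taffine.
have E : (\int[lebesgue_tuple (dimS G S)]_t (expR (- (a * N t)))%:E =
    \int[lebesgue_tuple (dimS G S)]_t (expR (- (a * N (shiftS b t))))%:E)%E.
  rewrite (@ge0_integral_taffine _ _ (fun=> 1) (fun i => - b (coord_val i) 0) _ _ mN).
  - by rewrite prodr_const expr1n mul1e.
  - by move=> i; exact: ltr01.
  - by move=> t; rewrite lee_fin expR_ge0.
transitivity ((slab_const S)%:E * \int[lebesgue_tuple (dimS G S)]_t (expR (- (a * N t)))%:E)%E.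
  rewrite E -(ge0_integralZl _ measurableT mNs); last 2 first.
  - by move=> t _; rewrite lee_fin expR_ge0.
  - by rewrite lee_fin slab_const_ge0.
  by apply: eq_integral => t _; rewrite -EFinM -norm21_shiftS.
rewrite (eq_integral (fun t => (expR (- (a * \sum_(j in S) Num.sqrt (sqnorm_on (coord_block S j) t))))%:E)); last first.
  by move=> t _; rewrite /N norm21_embedS.
have pos j : j \in S -> 0 < Gamma ((gsize G j)%:R / 2 : R) /\ 0 < Gamma ((gsize G j)%:R : R).
  by move=> jS; split; [apply: (Gamma_half (gsize_gt0 _)).1|apply: (Gamma_nat (gsize_gt0 _)).1].
rewrite (integral_expN_norms a0); last 3 first.
- move=> i j iS jS ij; rewrite -setI_eq0; apply/eqP/setP => k; rewrite !inE.
  by apply/andP => -[ki]; rewrite (disjointFr (group_disjoint ij) ki).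
- by move=> j jS; rewrite (card_coord_block jS); exact: gsize_gt0.
- move=> i; have : coord_val i \in coordS G S by exact: enum_valP.
  by move=> /finset.bigcupP[j jS ij]; exists j; [exact: jS|rewrite inE; exact: ij].
rewrite -EFinM; congr EFin; rewrite /slab_const.
have -> : \prod_(j in S) (2 * Gamma (#|coord_block S j|%:R : R) /
    Gamma (#|coord_block S j|%:R / 2)) =
    \prod_(j in S) (2 * Gamma (gsize G j)%:R / Gamma ((gsize G j)%:R / 2)).
  by apply: eq_bigr => j jS; rewrite (card_coord_block jS).
rewrite prodf_div big_split/= prodr_const.
apply: slab_cancel; last by rewrite expf_neq0// pnatr_eq0.
- by rewrite gt_eqF.
- by apply: lt0r_neq0; apply: prodr_gt0 => j jS; exact: (pos j jS).1.
- by apply: lt0r_neq0; apply: prodr_gt0 => j jS; exact: (pos j jS).2.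
- by apply: lt0r_neq0; rewrite sqrtr_gt0; exact: pi_gt0.
Qed.

End slab.
End group_geometry.

(** * Euclidean, spectral and group norms *)

Section l2norm.
Context {R : realType}.

Lemma sum_cauchy_schwarz (I : finType) (a b : I -> R) :
  (\sum_i a i * b i) ^+ 2 <= (\sum_i a i ^+ 2) * (\sum_i b i ^+ 2).
Proof.
set A := \sum_i a i ^+ 2; set B := \sum_i b i ^+ 2; set C := \sum_i _ * _.
have A0 : 0 <= A by apply: sumr_ge0 => i _; exact: sqr_ge0.
move: A0; rewrite le_eqVlt => /predU1P[A0|A0].
  have a0 i : a i = 0.
    have /eqP := esym A0; rewrite psumr_eq0; last by move=> *; exact: sqr_ge0.
    by move=> /allP/(_ i)/(_ (mem_index_enum i))/=; rewrite sqrf_eq0 => /eqP.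
  by rewrite -A0 mul0r /C big1 ?expr0n// => i _; rewrite a0 mul0r.
have : 0 <= \sum_i (A * b i - C * a i) ^+ 2 by apply: sumr_ge0 => i _; exact: sqr_ge0.
(* The squared residual of the projection of [b] on [a], scaled by [A] to avoid a division. *)
have -> : \sum_i (A * b i - C * a i) ^+ 2 = A * (A * B - C ^+ 2).
  transitivity (\sum_i (A ^+ 2 * b i ^+ 2 + (C ^+ 2 * a i ^+ 2 - 2 * A * C * (a i * b i)))).
    by apply: eq_bigr => i _; ring.
  rewrite !big_split/= sumrN -!mulr_sumr -/A -/B -/C; ring.
by rewrite pmulr_rge0// subr_ge0.
Qed.

Lemma l2norm_mulmx k (u v : 'cV[R]_k) : `|(u^T *m v) 0 0| <= l2norm u * l2norm v.
Proof.
rewrite -(@ler_pXn2r _ 2) ?nnegrE// ?mulr_ge0 ?l2norm_ge0//.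
rewrite real_normK ?num_real// exprMn !l2norm_sqr mxE.
under [X in X ^+ 2]eq_bigr do rewrite mxE.
exact: sum_cauchy_schwarz.
Qed.

Lemma l2norm_sqrE k (v : 'cV[R]_k) : l2norm v ^+ 2 = (v^T *m v) 0 0.
Proof. by rewrite l2norm_sqr mxE; apply: eq_bigr => i _; rewrite mxE expr2. Qed.

Lemma l2norm_eq0 k (v : 'cV[R]_k) : (l2norm v == 0) = (v == 0).
Proof.
apply/eqP/eqP => [v0|->]; last first.
  by rewrite /l2norm big1 ?sqrtr0// => i _; rewrite mxE expr0n.
apply/colP => i; rewrite mxE.
have /eqP : l2norm v ^+ 2 = 0 by rewrite v0 expr0n.
rewrite l2norm_sqr psumr_eq0; last by move=> *; exact: sqr_ge0.
by move=> /allP/(_ i)/(_ (mem_index_enum i))/=; rewrite sqrf_eq0 => /eqP.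
Qed.

Lemma l2norm0 k : l2norm (0 : 'cV[R]_k) = 0.
Proof. by apply/eqP; rewrite l2norm_eq0. Qed.

Lemma l2normD_sqr k (u v : 'cV[R]_k) :
  l2norm (u + v) ^+ 2 = l2norm u ^+ 2 + 2 * (u^T *m v) 0 0 + l2norm v ^+ 2.
Proof.
rewrite !l2norm_sqr mxE mulr_sumr -!big_split/=; apply: eq_bigr => i _.
by rewrite !mxE; ring.
Qed.

Lemma ler_l2normD k (u v : 'cV[R]_k) : l2norm (u + v) <= l2norm u + l2norm v.
Proof.
rewrite -(@ler_pXn2r _ 2) ?nnegrE ?addr_ge0 ?l2norm_ge0//.
have := le_trans (ler_norm _) (l2norm_mulmx u v).
by rewrite l2normD_sqr => h; nra.
Qed.

Lemma l2normZ k (a : R) (v : 'cV[R]_k) : l2norm (a *: v) = `|a| * l2norm v.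
Proof.
rewrite /l2norm -sqrtr_sqr -sqrtrM ?sqr_ge0// mulr_sumr; congr Num.sqrt.
by apply: eq_bigr => i _; rewrite mxE exprMn.
Qed.

Lemma l2normN k (v : 'cV[R]_k) : l2norm (- v) = l2norm v.
Proof. by rewrite -scaleN1r l2normZ normrN1 mul1r. Qed.

Lemma ler_l2norm_sum k I (r : seq I) (P : pred I) (F : I -> 'cV[R]_k) :
  l2norm (\sum_(i <- r | P i) F i) <= \sum_(i <- r | P i) l2norm (F i).
Proof.
elim/big_ind2 : _ => //; first by rewrite l2norm0.
by move=> u a v b ua vb; apply: le_trans (ler_l2normD _ _) _; rewrite lerD.
Qed.

Lemma l2norm_mxcol n k (v : 'I_n -> 'cV[R]_k) :
  l2norm (\mxcol_i v i) ^+ 2 = \sum_i l2norm (v i) ^+ 2.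
Proof.
rewrite l2norm_sqrE tr_mxcol mul_mxrow_mxcol summxE.
by apply: eq_bigr => i _; rewrite l2norm_sqrE.
Qed.

Section spnorm.
Variables (k l : nat) (A : 'M[R]_(k, l)).
Let B := [set l2norm (A *m v) | v in [set v : 'cV[R]_l | l2norm v <= 1]].

Let ubB : has_ubound B.
Proof.
(* The Frobenius norm is an upper bound, so the [sup] in [spnorm] is a true supremum. *)
exists (Num.sqrt (\sum_i \sum_j A i j ^+ 2)) => _ [v /= v1 <-].
rewrite ler_sqrt; last by apply: sumr_ge0 => i _; apply: sumr_ge0 => j _; exact: sqr_ge0.
apply: ler_sum => i _; rewrite mxE.
apply: le_trans (sum_cauchy_schwarz _ _) _.
rewrite ler_piMr//; first by apply: sumr_ge0 => j _; exact: sqr_ge0.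
by rewrite -l2norm_sqr exprn_ile1 ?l2norm_ge0.
Qed.

Lemma l2norm_mul_spnorm (v : 'cV[R]_l) : l2norm (A *m v) <= spnorm A * l2norm v.
Proof.
have [->|v0] := eqVneq v 0; first by rewrite mulmx0 !l2norm0 mulr0.
have nv : 0 < l2norm v by rewrite lt_neqAle l2norm_ge0 eq_sym l2norm_eq0 v0.
rewrite -ler_pdivrMr//.
have -> : l2norm (A *m v) / l2norm v = l2norm (A *m ((l2norm v)^-1 *: v)).
  by rewrite -scalemxAr l2normZ gtr0_norm ?invr_gt0// mulrC.
apply: ub_le_sup => //; exists ((l2norm v)^-1 *: v) => //=.
by rewrite l2normZ gtr0_norm ?invr_gt0// mulVf// gt_eqF.
Qed.

Lemma spnorm_le (c : R) : 0 <= c ->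
  (forall v, l2norm (A *m v) <= c * l2norm v) -> spnorm A <= c.
Proof.
move=> c0 h; apply: ge_sup.
  by exists (l2norm (A *m 0)), 0 => //=; rewrite l2norm0.
by move=> _ [v /= v1 <-]; apply: le_trans (h v) _; rewrite ler_piMr.
Qed.
End spnorm.

(** The signs are chosen greedily: each new term is turned against the sum of the others, so that no
    cross term is positive. *)
Lemma sign_sum_l2norm k (I : eqType) (r : seq I) (x : I -> 'cV[R]_k) : uniq r ->
  exists e : I -> R, (forall i, `|e i| = 1) /\
    l2norm (\sum_(i <- r) e i *: x i) ^+ 2 <= \sum_(i <- r) l2norm (x i) ^+ 2.
Proof.
elim: r => [_|i r IH /= /andP[ir ur]].
  by exists (fun=> 1); rewrite !big_nil l2norm0 expr0n/= normr1; split.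
have [e [e1 he]] := IH ur.
set u := \sum_(j <- r) e j *: x j in he.
pose s : R := if 0 <= (u^T *m x i) 0 0 then -1 else 1.
have s1 : `|s| = 1 by rewrite /s; case: ifP; rewrite ?normrN1 ?normr1.
have ss : s ^+ 2 = 1 by rewrite -real_normK ?num_real// s1 expr1n.
exists (fun j => if j == i then s else e j); split.
  by move=> j; case: ifP.
rewrite !big_cons eqxx (eq_big_seq (fun j => e j *: x j)); last first.
  by move=> j jr; case: eqP => // ji; rewrite -ji jr in ir.
rewrite -/u addrC l2normD_sqr l2normZ s1 mul1r [leRHS]addrC lerD2r.
rewrite (le_trans _ he)// gerDl pmulr_rle0// -scalemxAr mxE.
by rewrite /s; case: ifPn => h; [rewrite mulN1r oppr_le0|rewrite mul1r ltW// ltNge].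
Qed.
End l2norm.

Section gnorm.
Context {R : realType} {d p : nat}.
Variable G : 'I_p -> {set 'I_d}.
Implicit Types (S : {set 'I_p}) (b : 'cV[R]_d) (j : 'I_p).

Lemma norm21_ge0 S b : 0 <= norm21 G S b.
Proof. by apply: sumr_ge0 => j _; exact: l2norm_ge0. Qed.

Lemma norm21_setC S b :
  norm21 G [set: 'I_p]%SET b = norm21 G S b + norm21 G (~: S)%SET b.
Proof.
rewrite /norm21 (bigID (mem S))/=; congr (_ + _).
  by apply: eq_bigl => j; rewrite inE.
by apply: eq_bigl => j; rewrite !inE.
Qed.

Lemma ler_norm21_setT S b : norm21 G S b <= norm21 G [set: 'I_p]%SET b.
Proof. by rewrite (norm21_setC S) lerDl norm21_ge0. Qed.

Lemma vecgroupD b c j : vecgroup G (b + c) j = vecgroup G b j + vecgroup G c j.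
Proof. by apply/colP => i; rewrite !mxE. Qed.

Lemma vecgroupN b j : vecgroup G (- b) j = - vecgroup G b j.
Proof. by apply/colP => i; rewrite !mxE. Qed.

Lemma ler_norm21D S b c : norm21 G S (b + c) <= norm21 G S b + norm21 G S c.
Proof.
by rewrite -big_split/=; apply: ler_sum => j _; rewrite vecgroupD ler_l2normD.
Qed.

Lemma norm21N S b : norm21 G S (- b) = norm21 G S b.
Proof. by apply: eq_bigr => j _; rewrite vecgroupN l2normN. Qed.

Lemma l2norm_colgroup k (A : 'M[R]_(k, d)) j (u : 'cV[R]_(gsize G j)) :
  l2norm (colgroup G A j *m u) <= gnorm G A * l2norm u.
Proof.
apply: le_trans (l2norm_mul_spnorm _ _) _; rewrite ler_wpM2r ?l2norm_ge0//.
exact: (le_bigmax _ (fun j => spnorm (colgroup G A j))).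
Qed.

Hypothesis hG : group_partition G.

Lemma sum_groups (V : nmodType) (F : 'I_d -> V) : \sum_j \sum_(i in G j) F i = \sum_i F i.
Proof.
rewrite (exchange_big_dep predT)//=; apply: eq_bigr => i _.
have [j ij] := mem_group hG i; rewrite (big_pred1 j)// => k; apply/idP/eqP => [ik|->//].
by apply/eqP; apply: contraTT ij => jk; rewrite (disjointFr (group_disjoint hG jk) ik).
Qed.

Lemma mulmx_groups k (A : 'M[R]_(k, d)) b :
  A *m b = \sum_j colgroup G A j *m vecgroup G b j.
Proof.
apply/colP => i; rewrite summxE mxE -sum_groups; apply: eq_bigr => j _.
rewrite mxE (big_enum_val (fun l => A i l * b l 0))/=.
by apply: eq_bigr => l _; rewrite !mxE.
Qed.

Lemma l2norm_mulmx_norm21 k (A : 'M[R]_(k, d)) b :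
  l2norm (A *m b) <= gnorm G A * norm21 G [set: 'I_p]%SET b.
Proof.
rewrite mulmx_groups (le_trans (ler_l2norm_sum _ _ _))// /norm21 mulr_sumr.
rewrite [leRHS](eq_bigl predT); last by move=> j; rewrite inE.
by apply: ler_sum => j _; exact: l2norm_colgroup.
Qed.

Lemma gnorm_gt0 k (A : 'M[R]_(k, d)) : A != 0 -> 0 < gnorm G A.
Proof.
move=> A0; rewrite lt_neqAle gnorm_ge0 andbT; apply: contra_neq A0 => g0.
apply/matrixP => i l; rewrite mxE.
have := l2norm_mulmx_norm21 A (delta_mx l 0); rewrite -g0 mul0r => h.
have /eqP : l2norm (A *m delta_mx l 0) == 0 by rewrite eq_le h l2norm_ge0.
move/eqP; rewrite l2norm_eq0 => /eqP/matrixP/(_ i 0).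
rewrite mxE (bigD1 l)//= !mxE !eqxx mulr1 big1 ?addr0// => l' ll'.
by rewrite mxE (negbTE ll') mulr0.
Qed.

Lemma unit_group_vector j : exists2 b : 'cV[R]_d, l2norm (vecgroup G b j) = 1 &
  forall k, k != j -> vecgroup G b k = 0.
Proof.
have /card_gt0P[i ij] := gsize_gt0 hG j.
exists (delta_mx i 0).
  rewrite l2norm_vecgroup (bigD1 i)//= mxE !eqxx expr1n big1 ?addr0 ?sqrtr1// => l /andP[_ li].
  by rewrite mxE (negbTE li) expr0n.
move=> k kj; apply/colP => l; rewrite !mxE andbT.
case: eqP => // e; have := enum_valP l; rewrite e => ik.
by rewrite (disjointFr (group_disjoint hG kj) ik) in ij.
Qed.

(** The test vector that proves phi(S) <= 1: one unit vector per group of [S], with signs that keep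
    the image short. *)
Lemma sign_group_vector k (A : 'M[R]_(k, d)) S : exists b : 'cV[R]_d,
  [/\ forall j, j \in S -> l2norm (vecgroup G b j) = 1,
      forall j, j \notin S -> vecgroup G b j = 0 &
      l2norm (A *m b) ^+ 2 <= #|S|%:R * gnorm G A ^+ 2].
Proof.
have [u u1 u0] : exists2 u : 'I_p -> 'cV[R]_d,
    forall j, l2norm (vecgroup G (u j) j) = 1 &
    forall j k, k != j -> vecgroup G (u j) k = 0.
  have h j : { u : 'cV[R]_d | l2norm (vecgroup G u j) = 1 /\ forall k, k != j -> vecgroup G u k = 0 }.
    by apply: cid; have [u ? ?] := @unit_group_vector j; exists u.
  by exists (fun j => sval (h j)) => j; case: (svalP (h j)).
have [e [e1 he]] := sign_sum_l2norm (fun j => A *m u j) (enum_uniq S).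
exists (\sum_(j <- enum S) e j *: u j).
have vg i : vecgroup G (\sum_(j <- enum S) e j *: u j) i =
    if i \in S then e i *: vecgroup G (u i) i else 0.
  have -> : vecgroup G (\sum_(j <- enum S) e j *: u j) i =
      \sum_(j in S) e j *: vecgroup G (u j) i.
    rewrite big_enum/=; apply/colP => l; rewrite mxE !summxE.
    by apply: eq_bigr => j _; rewrite !mxE.
  case: ifP => iS.
    rewrite (bigD1 i)//= big1 ?addr0// => j /andP[_ ji].
    by rewrite u0 ?scaler0// eq_sym.
  rewrite big1// => j jS; rewrite u0 ?scaler0//.
  by apply: contraFneq iS => ->.
split.
- by move=> j jS; rewrite vg jS l2normZ e1 u1 mul1r.
- by move=> j /negbTE jS; rewrite vg jS.
- rewrite mulmx_sumr; under eq_bigr do rewrite -scalemxAr.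
  apply: le_trans he _; rewrite big_enum/= mulr_natl -sumr_const.
  apply: ler_sum => j _; rewrite ler_pXn2r ?nnegrE ?l2norm_ge0 ?gnorm_ge0//.
  apply: le_trans (l2norm_mulmx_norm21 _ _) _; rewrite ler_piMr ?gnorm_ge0//.
  rewrite /norm21 (bigD1 j)/= ?inE// u1 big1 ?addr0// => i /andP[_ ij].
  by rewrite u0// l2norm0.
Qed.

Section stack.
Context {m n : nat} (X : 'I_n -> 'M[R]_(m.-1, d)).

Lemma l2norm_stackX b : l2norm (stackX X *m b) ^+ 2 = \sum_i l2norm (X i *m b) ^+ 2.
Proof. by rewrite /stackX mxcol_mul l2norm_mxcol. Qed.

Lemma colgroup_stackX j (u : 'cV[R]_(gsize G j)) :
  colgroup G (stackX X) j *m u = \mxcol_i (colgroup G (X i) j *m u).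
Proof.
rewrite -mxcol_mul; congr (_ *m _).
by apply/matrixP => i l; rewrite !mxE.
Qed.

Lemma sum_l2norm_colgroup j (u : 'cV[R]_(gsize G j)) :
  \sum_i l2norm (colgroup G (X i) j *m u) ^+ 2 <= (gnorm G (stackX X) * l2norm u) ^+ 2.
Proof.
rewrite -l2norm_mxcol -colgroup_stackX ler_pXn2r ?nnegrE ?l2norm_ge0//.
  exact: l2norm_colgroup.
by rewrite mulr_ge0 ?gnorm_ge0 ?l2norm_ge0.
Qed.

Definition gnorm_max : R := \big[Num.max/0]_(i < n) gnorm G (X i).

Lemma gnorm_max_ge0 : 0 <= gnorm_max.
Proof. exact: bigmax_ge_id. Qed.

Lemma gnorm_le_max i : gnorm G (X i) <= gnorm_max.
Proof. exact: (le_bigmax _ (fun i => gnorm G (X i))). Qed.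

(** This lets membership in [Bset] be compared with the sample size, in [dimS_gsupp_lt]. *)
Lemma gnorm_stackX_le : gnorm G (stackX X) <= Num.sqrt n%:R * gnorm_max.
Proof.
have c0 : 0 <= Num.sqrt n%:R * gnorm_max by rewrite mulr_ge0 ?sqrtr_ge0 ?gnorm_max_ge0.
apply: bigmax_le => // j _; apply: spnorm_le => // v.
rewrite -(@ler_pXn2r _ 2) ?nnegrE ?l2norm_ge0 ?mulr_ge0 ?sqrtr_ge0 ?gnorm_max_ge0 ?l2norm_ge0//.
rewrite colgroup_stackX l2norm_mxcol !exprMn sqr_sqrtr// -mulrA mulr_natl -[n in _ *+ n]card_ord.
rewrite -sumr_const; apply: ler_sum => i _; rewrite -exprMn.
rewrite ler_pXn2r ?nnegrE ?l2norm_ge0 ?mulr_ge0 ?gnorm_max_ge0 ?l2norm_ge0//.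
apply: le_trans (l2norm_colgroup _ _) _.
by rewrite ler_wpM2r ?l2norm_ge0 ?gnorm_le_max.
Qed.
End stack.
End gnorm.

(** * Exponential moments and the likelihood *)

Section exponential_moments.
Context {R : realType}.
Implicit Types x : R.

Lemma expR_le_inv1B x : x < 1 -> expR x <= (1 - x)^-1.
Proof.
move=> x1; rewrite -[x]opprK expRN lef_pV2 ?posrE ?expR_gt0 ?opprK ?subr_gt0//.
exact: expR_ge1Dx.
Qed.

(* both sides satisfy the doubling relation f (2 x) = 2 f (x)^2 - 1, up to [<=] on the right *)
Lemma cosh_le_expR x : expR x + expR (- x) <= 2 * expR (4 / 5 * x ^+ 2).
Proof.
have small (y : R) : `|y| <= 4^-1 -> expR y + expR (- y) <= 2 * expR (4 / 5 * y ^+ 2).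
  move=> y4.
  have [yl yu] : - 4^-1 <= y /\ y <= 4^-1 by apply/andP; rewrite -ler_norml.
  have half (z : R) : `|z| <= 4^-1 -> expR z <= ((1 - z / 2) ^+ 2)^-1.
    move=> z4; have [zl zu] : - 4^-1 <= z /\ z <= 4^-1 by apply/andP; rewrite -ler_norml.
    have -> : expR z = expR (z / 2) ^+ 2 by rewrite -expRM_natl; congr expR; field.
    rewrite -exprVn ler_pXn2r ?nnegrE ?expR_ge0 ?invr_ge0//; last by lra.
    by apply: expR_le_inv1B; lra.
  have h1 := half y y4; have h2 := half (- y); rewrite normrN in h2.
  have {}h2 := h2 y4.
  apply: le_trans (lerD h1 h2) _.
  apply: (@le_trans _ _ (2 * (1 + 4 / 5 * y ^+ 2))); last first.
    by rewrite ler_pM2l// expR_ge1Dx.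
  (* The bound becomes 2 (1 + w) / (1 - w)^2 = 2 (1 + 3 w + ...), to be compared with 2 (1 + 16 w /
     5). The excess of 16/5 over 3 pays for the higher terms as long as w <= 1/64, hence the
     constant 4/5. *)
  set w := y ^+ 2 / 4.
  have w0 : 0 <= w by rewrite divr_ge0// sqr_ge0.
  have w1 : w <= 64^-1 by rewrite /w; nra.
  have d0 : 0 < 1 - w by lra.
  have -> : ((1 - y / 2) ^+ 2)^-1 + ((1 - - y / 2) ^+ 2)^-1 = 2 * (1 + w) / (1 - w) ^+ 2.
    rewrite /w; field; apply/and3P; split; rewrite gt_eqF//; nra.
  rewrite -mulrA ler_pM2l// ler_pdivrMr ?exprn_gt0//.
  rewrite (_ : 4 / 5 * y ^+ 2 = 16 / 5 * w); last by rewrite /w; field.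
  nra.
have double (y : R) : expR y + expR (- y) <= 2 * expR (4 / 5 * y ^+ 2) ->
    expR (2 * y) + expR (- (2 * y)) <= 2 * expR (4 / 5 * (2 * y) ^+ 2).
  move=> h; rewrite -mulrN !expRM_natl.
  rewrite (_ : 4 / 5 * (2 * y) ^+ 2 = 4%:R * (4 / 5 * y ^+ 2)); last by ring.
  rewrite expRM_natl; set a := expR (_ * _) in h *.
  have ee : expR y * expR (- y) = 1 by rewrite -expRD subrr expR0.
  have := expR_gt0 y; have := expR_gt0 (- y); have : 0 < a by exact: expR_gt0.
  set e1 := expR y in h ee *; set e2 := expR (- y) in h ee *.
  move=> a0 e20 e10.
  have : (e1 + e2) ^+ 2 <= (2 * a) ^+ 2 by rewrite ler_pXn2r// nnegrE; lra.
  have := sqr_ge0 (a ^+ 2 - 1).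
  nra.
have [k] : exists k : nat, `|x| <= 2 ^+ k * 4^-1.
  exists (Num.truncn (4 * `|x|)).+1; rewrite ler_pdivlMr// mulrC ltW//.
  apply: lt_trans (truncnS_gt _) _.
  by rewrite -natrX ltr_nat; exact: ltn_expl.
elim: k x => [|k IH] x; first by rewrite expr0 mul1r; exact: small.
move=> h; have -> : x = 2 * (x / 2) by field.
apply: double; apply: IH; rewrite normrM (@ger0_norm _ 2^-1)// ler_pdivrMr//.
by rewrite mulrAC -exprSr.
Qed.

Variables (I : finType) (P : I -> R).
Hypotheses (P0 : forall i, 0 <= P i) (P1 : \sum_i P i = 1).

Definition fmean (u : I -> R) := \sum_i P i * u i.
Definition fvar (u : I -> R) := \sum_i P i * (u i - fmean u) ^+ 2.

Lemma fmean_cst (c : R) : fmean (fun=> c) = c.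
Proof. by rewrite /fmean -mulr_suml P1 mul1r. Qed.

Lemma fmean_centered u : fmean (fun i => u i - fmean u) = 0.
Proof.
rewrite {1}/fmean; under eq_bigr do rewrite mulrBr.
by rewrite sumrB -mulr_suml P1 mul1r subrr.
Qed.

Lemma fmean_le u v : (forall i, u i <= v i) -> fmean u <= fmean v.
Proof. by move=> uv; apply: ler_sum => i _; rewrite ler_wpM2l. Qed.

(** Jensen's inequality, from the tangent of the exponential at the mean. *)
Lemma expR_fmean u : expR (fmean u) <= fmean (expR \o u).
Proof.
have h : fmean (fun i => expR (fmean u) * (1 + (u i - fmean u))) = expR (fmean u).
  rewrite /fmean; under eq_bigr do rewrite mulrCA mulrDr mulr1.
  by rewrite -mulr_sumr big_split/= P1 -/(fmean (fun i => u i - fmean u)) fmean_centered addr0 mulr1.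
rewrite -{1}h; apply: fmean_le => i /=.
by rewrite -[X in _ <= expR X](subrKC (fmean u)) expRD ler_wpM2l ?expR_ge0 ?expR_ge1Dx.
Qed.

(** Symmetrisation: by Jensen the mean in the exponent may be replaced by an independent copy, and
    averaging over the exchange of the two copies gives a hyperbolic cosine, bounded by
    [cosh_le_expR]. *)
Lemma fmean_expR_le u (M : R) : (forall i j, (u i - u j) ^+ 2 <= 2 * M) ->
  fmean (fun i => expR (u i - fmean u)) <= expR (8 / 5 * M).
Proof.
move=> uM.
set A := fmean (fun i => expR (u i)); set B := fmean (fun i => expR (- u i)).
have B0 : expR (- fmean u) <= B.
  have := expR_fmean (fun i => - u i); rewrite /fmean.
  by under eq_bigr do rewrite mulrN; rewrite sumrN.
have A0 : 0 <= A by apply: sumr_ge0 => i _; rewrite mulr_ge0 ?expR_ge0.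
have -> : fmean (fun i => expR (u i - fmean u)) = A * expR (- fmean u).
  by rewrite /A /fmean mulr_suml; apply: eq_bigr => i _; rewrite expRD mulrA.
apply: (@le_trans _ _ (A * B)); first by rewrite ler_wpM2l.
have E : 2 * (A * B) = \sum_i \sum_j P i * P j * (expR (u i - u j) + expR (- (u i - u j))).
  have -> : 2 * (A * B) = A * B + B * A by ring.
  rewrite /A /B /fmean !big_distrlr/= -big_split/=; apply: eq_bigr => i _.
  rewrite -big_split/=; apply: eq_bigr => j _.
  by rewrite opprB !expRD; ring.
rewrite -(@ler_pM2l _ 2)// E.
apply: (@le_trans _ _ (\sum_i \sum_j P i * P j * (2 * expR (8 / 5 * M)))).
  apply: ler_sum => i _; apply: ler_sum => j _.
  rewrite ler_wpM2l ?mulr_ge0//; apply: le_trans (cosh_le_expR _) _.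
  rewrite ler_pM2l// ler_expR.
  have := uM i j; lra.
under eq_bigr do rewrite -mulr_suml -mulr_sumr P1 mulr1.
by rewrite -mulr_suml P1 mul1r.
Qed.

(** From (1 + w / 4)^4 <= exp w: the coefficient of w^2 is 3/8, and the cubic term takes at most
    1/160 from it, which leaves 295/800. *)
Let quadratic_lower (w : R) : `|w| <= 10^-1 -> 1 + w + 295 / 800 * w ^+ 2 <= expR w.
Proof.
rewrite ler_norml => /andP[wl wu].
have -> : expR w = (expR (w / 4) ^+ 2) ^+ 2.
  by rewrite -exprM -expRM_natl; congr expR; field.
apply: (@le_trans _ _ (((1 + w / 4) ^+ 2) ^+ 2)); last first.
  rewrite ler_pXn2r ?nnegrE ?sqr_ge0// ler_pXn2r ?nnegrE ?expR_ge0//; last by lra.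
  exact: expR_ge1Dx.
have -> : ((1 + w / 4) ^+ 2) ^+ 2 = 1 + w + w ^+ 2 * (3 / 8 + w / 16) + w ^+ 4 / 256 by field.
have : 0 <= w ^+ 4 by rewrite (exprM w 2 2) sqr_ge0.
have : 0 <= w ^+ 2 by exact: sqr_ge0.
nra.
Qed.

(** The quadratic expansion is valid only for small arguments, so it is applied to t (u - mean) and
    carried back to t = 1 by convexity. The variance is thereby damped by the single factor t, about
    1 / B; this is why the curvature in the likelihood decays only like an inverse of the norm. *)
Lemma fmean_expR_ge u (B t : R) : (forall i, `|u i - fmean u| <= B) ->
  0 < t -> t <= 1 -> t * B <= 10^-1 ->
  expR (9 / 25 * t * fvar u) <= fmean (fun i => expR (u i - fmean u)).
Proof.
move=> uB t0 t1 tB; pose U i := u i - fmean u; set v := fvar u.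
have PU : fmean U = 0 by exact: fmean_centered.
have UB i : `|t * U i| <= 10^-1.
  rewrite normrM gtr0_norm// (le_trans _ tB)//; apply: ler_wpM2l; first exact: ltW.
  exact: uB.
have v0 : 0 <= v by apply: sumr_ge0 => i _; rewrite mulr_ge0 ?sqr_ge0.
have tv : t ^+ 2 * v <= 100^-1.
  rewrite /v /fvar mulr_sumr -(fmean_cst 100^-1); apply: ler_sum => i _.
  rewrite mulrCA ler_wpM2l// -exprMn -/(U i).
  have := UB i; rewrite ler_norml => /andP[h1 h2].
  nra.
set k := 9 / 25 * t * v.
(* The gap between 9/25 and 295/800 turns 1 + 295 s / 800 into an exponential for s <= 1/100. *)
have Z : expR (t * k) <= fmean (fun i => expR (t * U i)).
  apply: (@le_trans _ _ (1 + 295 / 800 * (t ^+ 2 * v))).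
    rewrite (_ : t * k = 9 / 25 * (t ^+ 2 * v)); last by rewrite /k; ring.
    have s0 : 0 <= t ^+ 2 * v by rewrite mulr_ge0// sqr_ge0.
    move: (t ^+ 2 * v) tv s0 => s s1 s0.
    apply: le_trans (expR_le_inv1B _) _; first by lra.
    rewrite -div1r ler_pdivrMr; last by lra.
    nra.
  have <- : fmean (fun i => 1 + t * U i + 295 / 800 * (t * U i) ^+ 2) =
      1 + 295 / 800 * (t ^+ 2 * v).
    have -> : fmean (fun i => 1 + t * U i + 295 / 800 * (t * U i) ^+ 2) =
        \sum_i (P i + (t * (P i * U i) + 295 / 800 * t ^+ 2 * (P i * (U i ^+ 2)))).
      by apply: eq_bigr => i _; ring.
    rewrite !big_split/= -!mulr_sumr P1 -/(fmean U) PU mulr0 add0r.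
    by rewrite (_ : \sum_i P i * U i ^+ 2 = v) ?mulrA.
  by apply: fmean_le => i; exact: quadratic_lower.
(* Convexity of the exponential between 0 and x. Applied to U - k it shows that a mean at least 1 at
   scale t forces a mean at least 1 at scale 1. *)
have tangent (x : R) : expR (t * x) <= t * expR x + (1 - t).
  have h1 : expR (t * x) * (1 + (1 - t) * x) <= expR x.
    rewrite -[X in _ <= expR X](_ : t * x + (1 - t) * x = x); last by ring.
    by rewrite expRD ler_wpM2l ?expR_ge0 ?expR_ge1Dx.
  have h2 : expR (t * x) * (1 - t * x) <= 1.
    rewrite -[leRHS]expR0 -(subrr (t * x)) expRD ler_wpM2l ?expR_ge0//.
    exact: expR_ge1Dx.
  by nra.
have : 1 <= fmean (fun i => t * expR (U i - k) + (1 - t)).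
  apply: (@le_trans _ _ (fmean (fun i => expR (t * (U i - k))))); last first.
    by apply: fmean_le => i; exact: tangent.
  have -> : fmean (fun i => expR (t * (U i - k))) = fmean (fun i => expR (t * U i)) * expR (- (t * k)).
    by rewrite /fmean mulr_suml; apply: eq_bigr => i _; rewrite mulrBr expRD mulrA.
  by rewrite expRN ler_pdivlMr ?expR_gt0// mul1r.
have -> : fmean (fun i => t * expR (U i - k) + (1 - t)) =
    t * (fmean (fun i => expR (U i)) * expR (- k)) + (1 - t).
  transitivity (\sum_i (t * (P i * expR (U i) * expR (- k)) + P i * (1 - t))).
    by apply: eq_bigr => i _; rewrite expRD; ring.
  by rewrite big_split/= -mulr_sumr -!mulr_suml P1 mul1r.
rewrite addrC -lerBlDl opprB addrC subrK -[leLHS]mulr1 ler_pM2l//.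
by rewrite expRN ler_pdivlMr ?expR_gt0// mul1r.
Qed.
End exponential_moments.

(** * The law of one observation and of the sample *)

Section category.
Context {R : realType} {m d : nat}.
Hypothesis m0 : (0 < m)%N.
Implicit Types (Xi : 'M[R]_(m.-1, d)) (b : 'cV[R]_d) (v : 'cV[R]_(m.-1)) (l : 'I_m).

(** The coordinate of [v] that belongs to the category [l], and 0 for the reference category. *)
Definition catval v l : R := ((indicator l)^T *m v) 0 0.
Definition catprob Xi b l : R := likelihood1 Xi b (indicator l).

Lemma catvalD u v l : catval (u + v) l = catval u l + catval v l.
Proof. by rewrite /catval mulmxDr mxE. Qed.

Lemma sum_indicator_le1 l : \sum_k (indicator l : 'cV[R]_(m.-1)) k 0 <= 1.
Proof.
case: (pickP (fun k : 'I_(m.-1) => l == k.+1 :> nat)) => [k /eqP lk|h].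
  rewrite (bigD1 k)//= mxE lk eqxx big1 ?addr0// => k' kk'.
  by rewrite mxE lk eqSS eq_sym (inj_eq val_inj) (negbTE kk').
by rewrite big1// => k _; rewrite mxE h.
Qed.

Lemma l2norm_indicatorB l l' :
  l2norm (indicator l - indicator l' : 'cV[R]_(m.-1)) ^+ 2 <= 2.
Proof.
rewrite l2norm_sqr (_ : 2 = 1 + 1)//.
apply: le_trans (lerD (sum_indicator_le1 l) (sum_indicator_le1 l')).
rewrite -big_split/=; apply: ler_sum => k _; rewrite !mxE.
by case: eqP => _; case: eqP => _ /=; lra.
Qed.

Lemma catval_sqrB v l l' : (catval v l - catval v l') ^+ 2 <= 2 * l2norm v ^+ 2.
Proof.
have -> : catval v l - catval v l' = ((indicator l - indicator l')^T *m v) 0 0.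
  by rewrite /catval [(_ - _)^T]linearB/= mulmxBl !mxE.
apply: le_trans (ler_wpM2r (sqr_ge0 _) (l2norm_indicatorB l l')).
rewrite -exprMn -real_normK ?num_real// ler_pXn2r ?nnegrE ?mulr_ge0 ?l2norm_ge0//.
exact: l2norm_mulmx.
Qed.

Lemma catval_abs v l : `|catval v l| <= l2norm v.
Proof.
apply: le_trans (l2norm_mulmx _ _) _; rewrite ler_piMl ?l2norm_ge0//.
rewrite -(@ler_pXn2r _ 2) ?nnegrE ?l2norm_ge0// expr1n l2norm_sqr.
apply: le_trans _ (sum_indicator_le1 l); apply: ler_sum => k _; rewrite mxE.
by case: eqP => _; rewrite ?expr1n ?expr0n.
Qed.

Lemma catprob_ge0 Xi b l : 0 <= catprob Xi b l.
Proof.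
rewrite divr_ge0 ?expR_ge0// addr_ge0// sumr_ge0// => k _; exact: expR_ge0.
Qed.

Lemma catprob_sum1 Xi b : \sum_l catprob Xi b l = 1.
Proof.
move: Xi b m0; rewrite /catprob; case: m => // k Xi b _.
exact: (@likelihood1_sum1 R k d).
Qed.

(** The law under [b] is the exponential tilt by [u] of the law under [c]. Both factors are centred,
    so that the normaliser is the moment generating function bounded above and below in the
    preceding section. *)
Lemma catprob_ratio Xi b c l (u := Xi *m (b - c)) :
  catprob Xi b l = catprob Xi c l * expR (catval u l - fmean (catprob Xi c) (catval u)) /
    fmean (catprob Xi c) (fun k => expR (catval u k - fmean (catprob Xi c) (catval u))).
Proof.
pose D b := 1 + \sum_(k < m.-1) expR ((Xi *m b) k 0).
have D0 b' : 0 < D b' by rewrite ltr_pwDl// sumr_ge0// => k _; exact: expR_ge0.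
have E b' l' : catprob Xi b' l' = expR (catval (Xi *m b') l') / D b'.
  by rewrite /catprob /likelihood1 /catval mulmxA.
have S b' : \sum_l' expR (catval (Xi *m b') l') = D b'.
  have := catprob_sum1 Xi b'; under eq_bigr do rewrite E.
  by rewrite -mulr_suml => /(congr1 ( *%R^~ (D b'))); rewrite divfK ?gt_eqF// mul1r.
set M := fmean _ (catval u).
have F k : catprob Xi c k * expR (catval u k - M) = expR (- M) / D c * expR (catval (Xi *m b) k).
  have -> : Xi *m b = Xi *m c + u by rewrite -mulmxDr subrKC.
  by rewrite E catvalD !expRD; ring.
have -> : fmean (catprob Xi c) (fun k => expR (catval u k - M)) = expR (- M) / D c * D b.
  by rewrite -(S b) mulr_sumr; apply: eq_bigr => k _; exact: F.
rewrite F E; field.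
by rewrite !gt_eqF ?expR_gt0.
Qed.

Lemma catval_centered Xi b v l :
  `|catval v l - fmean (catprob Xi b) (catval v)| <= 2 * l2norm v.
Proof.
apply: le_trans (ler_normB _ _) _; rewrite mulrDl mul1r lerD ?catval_abs//.
apply: le_trans (ler_norm_sum _ _ _) _.
rewrite -[leRHS]mul1r -(catprob_sum1 Xi b) mulr_suml; apply: ler_sum => k _.
by rewrite normrM ger0_norm ?catprob_ge0// ler_wpM2l ?catprob_ge0 ?catval_abs.
Qed.
End category.

Section product_law.
Context {R : realType} {m n d : nat}.
Hypothesis m0 : (0 < m)%N.
Variables (X : 'I_n -> 'M[R]_(m.-1, d)) (b0 : 'cV[R]_d).
Implicit Types (z : {ffun 'I_n -> 'I_m}) (b : 'cV[R]_d) (i : 'I_n).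

Local Notation P i := (catprob (X i) b0).
Local Notation lik b z := (likelihood X b (response z)).

Lemma likelihoodE b z : lik b z = \prod_i catprob (X i) b (z i).
Proof. by []. Qed.

Lemma likelihood_ge0 b z : 0 <= lik b z.
Proof. by apply: prodr_ge0 => i _; exact: catprob_ge0. Qed.

(** Independence is the distributivity of a product of sums over the functions [z]. *)
Lemma expect_prod (f : 'I_n -> 'I_m -> R) :
  \sum_z lik b0 z * \prod_i f i (z i) = \prod_i fmean (P i) (f i).
Proof.
rewrite /fmean bigA_distr_bigA/=; apply: eq_bigr => z _.
by rewrite big_split.
Qed.

Lemma expect_1 : \sum_z lik b0 z = 1.
Proof.
transitivity (\prod_i fmean (P i) (fun=> 1)).
  by rewrite -(expect_prod (fun _ _ => 1)); apply: eq_bigr => z _; rewrite big1_eq mulr1.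
by apply: big1 => i _; apply: fmean_cst; exact: catprob_sum1.
Qed.

Lemma expect_coord i (g : 'I_m -> R) : \sum_z lik b0 z * g (z i) = fmean (P i) g.
Proof.
have := expect_prod (fun k l => if k == i then g l else 1).
rewrite (bigD1 i)//= eqxx [X in _ * X]big1 ?mulr1; last first.
  by move=> k /negbTE ->; apply: fmean_cst; exact: catprob_sum1.
move=> <-; apply: eq_bigr => z _; rewrite (bigD1 i)//= eqxx big1 ?mulr1//.
by move=> k /negbTE ->.
Qed.

Lemma expect_coord2 i j (g h : 'I_m -> R) : i != j ->
  \sum_z lik b0 z * (g (z i) * h (z j)) = fmean (P i) g * fmean (P j) h.
Proof.
move=> ij; have ji : j != i by rewrite eq_sym.
have := expect_prod (fun k l => if k == i then g l else if k == j then h l else 1).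
rewrite (bigD1 i)//= eqxx (bigD1 j)//= (negbTE ji) eqxx [X in _ * (_ * X)]big1 ?mulr1; last first.
  by move=> k /andP[/negbTE -> /negbTE ->]; apply: fmean_cst; exact: catprob_sum1.
move=> <-; apply: eq_bigr => z _; rewrite (bigD1 i)//= eqxx (bigD1 j)//= (negbTE ji) eqxx.
by rewrite big1 ?mulr1// => k /andP[/negbTE -> /negbTE ->].
Qed.

Definition centered (v : 'I_n -> 'cV[R]_(m.-1)) z : R :=
  \sum_i (catval (v i) (z i) - fmean (P i) (catval (v i))).

Lemma stackY_centered v z :
  ((stackY z - meanY X b0)^T *m \mxcol_i v i) 0 0 = centered v z.
Proof.
have -> : meanY X b0 = \mxcol_i (\sum_l P i l *: indicator l).
  rewrite /meanY /expect /stackY.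
  transitivity (\sum_z' \mxcol_i (lik b0 z' *: response z' i : 'cV[R]_(m.-1))).
    by apply: eq_bigr => z' _; apply/colP => k; rewrite !mxE.
  rewrite -mxcol_sum; apply/eq_mxcol => i; apply/colP => k; rewrite !summxE.
  rewrite [RHS](eq_bigr (fun l => P i l * (indicator l : 'cV[R]__) k 0)); last first.
    by move=> l _; rewrite mxE.
  rewrite -[RHS](expect_coord i (fun l => (indicator l : 'cV[R]_(m.-1)) k 0)).
  by apply: eq_bigr => z' _; rewrite mxE.
rewrite /stackY -mxcolB tr_mxcol mul_mxrow_mxcol summxE; apply: eq_bigr => i _.
rewrite [(_ - _)^T]linearB/= mulmxBl [LHS]mxE [X in _ + X]mxE; congr (_ - _).
rewrite [X in X *m _](_ : _ = \sum_l P i l *: (indicator l)^T); last first.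
  by rewrite [LHS]linear_sum; apply: eq_bigr => l _; exact: linearZ.
by rewrite mulmx_suml summxE; apply: eq_bigr => l _; rewrite -scalemxAl mxE.
Qed.

End product_law.

(** The default value 0 is kept as a case, since only an upper bound on the norm of W^(1/2) X c is
    used, and it is trivial for 0. Thus no square root has to be constructed. *)
Lemma psd_sqrt_spec (R : realType) k (W : 'M[R]_k) :
  psd_sqrt W = 0 \/ forall w : 'cV[R]_k, l2norm (psd_sqrt W *m w) ^+ 2 = (w^T *m W *m w) 0 0.
Proof.
rewrite /psd_sqrt; case: xgetP => [B _ [[Bsym _] BW]|_]; [right|by left].
by move=> w; rewrite l2norm_sqrE trmx_mul Bsym -BW !mulmxA.
Qed.

Lemma mulmx_outer (R : comNzRingType) k (A V : 'cV[R]_k) :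
  (V^T *m (A *m A^T) *m V) 0 0 = ((A^T *m V) 0 0) ^+ 2.
Proof.
rewrite mulmxA -mulmxA [LHS]mxE big_ord1 expr2; congr (_ * _).
by rewrite !mxE; apply: eq_bigr => i _; rewrite !mxE mulrC.
Qed.

Section moments.
Context {R : realType} {m n d : nat}.
Hypothesis m0 : (0 < m)%N.
Variables (X : 'I_n -> 'M[R]_(m.-1, d)) (b0 : 'cV[R]_d).
Implicit Types (z : {ffun 'I_n -> 'I_m}) (b : 'cV[R]_d) (i : 'I_n).

Local Notation P i := (catprob (X i) b0).
Local Notation lik b z := (likelihood X b (response z)).

(** The centred coordinates are independent with mean 0, so the cross terms vanish. *)
Lemma covY_quad (v : 'I_n -> 'cV[R]_(m.-1)) :
  ((\mxcol_i v i)^T *m covY X b0 *m \mxcol_i v i) 0 0 = \sum_i fvar (P i) (catval (v i)).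
Proof.
set V := \mxcol_i v i.
transitivity (\sum_z lik b0 z * (centered X b0 v z) ^+ 2).
  rewrite /covY /expect mulmx_sumr mulmx_suml summxE; apply: eq_bigr => z _.
  by rewrite -scalemxAr -scalemxAl mxE mulmx_outer stackY_centered.
pose g i l := catval (v i) l - fmean (P i) (catval (v i)).
have g0 i : fmean (P i) (g i) = 0 by apply: fmean_centered; exact: catprob_sum1.
transitivity (\sum_i \sum_j \sum_z lik b0 z * (g i (z i) * g j (z j))).
  transitivity (\sum_z \sum_i \sum_j lik b0 z * (g i (z i) * g j (z j))).
    apply: eq_bigr => z _; rewrite /centered expr2 big_distrlr/= mulr_sumr.
    by apply: eq_bigr => i _; rewrite mulr_sumr.
  by rewrite exchange_big/=; apply: eq_bigr => i _; rewrite exchange_big.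
apply: eq_bigr => i _; rewrite (bigD1 i)//= [X in _ + X]big1 ?addr0; last first.
  by move=> j ji; rewrite (expect_coord2 m0 _ _ (g i) (g j)) 1?eq_sym// g0 mul0r.
rewrite (expect_coord m0 X b0 i (fun l => g i l * g i l)).
by apply: eq_bigr => l _; rewrite expr2.
Qed.

Lemma expect_expR_centered (v : 'I_n -> 'cV[R]_(m.-1)) :
  \sum_z lik b0 z * expR (centered X b0 v z) <= expR (8 / 5 * \sum_i l2norm (v i) ^+ 2).
Proof.
under eq_bigr do rewrite /centered expR_sum.
rewrite (expect_prod X b0 (fun i l => expR (catval (v i) l - fmean (P i) (catval (v i))))).
rewrite mulr_sumr expR_sum; apply: ler_prod => i _; apply/andP; split.
  by apply: sumr_ge0 => l _; rewrite mulr_ge0 ?catprob_ge0 ?expR_ge0.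
apply: fmean_expR_le; [exact: catprob_ge0|exact: catprob_sum1|].
by move=> l l'; exact: catval_sqrB.
Qed.

Lemma likelihood_ratio b z (u := fun i => X i *m (b - b0)) :
  lik b z = lik b0 z * expR (centered X b0 u z) /
    \prod_i fmean (P i) (fun k => expR (catval (u i) k - fmean (P i) (catval (u i)))).
Proof.
rewrite !likelihoodE /centered expR_sum -!big_split/= -prodf_div.
by apply: eq_bigr => i _; rewrite (catprob_ratio m0 (X i) b b0).
Qed.

Lemma likelihood_ge b z :
  lik b0 z * expR (centered X b0 (fun i => X i *m (b - b0)) z -
    8 / 5 * \sum_i l2norm (X i *m (b - b0)) ^+ 2) <= lik b z.
Proof.
rewrite (likelihood_ratio b z) -[leRHS]mulrA ler_wpM2l ?likelihood_ge0//.
rewrite expRD ler_wpM2l ?expR_ge0// expRN lef_pV2 ?posrE ?expR_gt0//.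
  rewrite mulr_sumr expR_sum; apply: ler_prod => i _; apply/andP; split.
    by apply: sumr_ge0 => l _; rewrite mulr_ge0 ?catprob_ge0 ?expR_ge0.
  apply: fmean_expR_le; [exact: catprob_ge0|exact: catprob_sum1|].
  by move=> l l'; exact: catval_sqrB.
apply: prodr_gt0 => i _; apply: lt_le_trans (expR_gt0 _) _; last first.
  by apply: (@expR_fmean _ _ (P i)); [exact: catprob_ge0|exact: catprob_sum1].
Qed.

(** The normaliser of the tilt is bounded below by [fmean_expR_ge]; [B] bounds every centred value,
    and [t] is a common damping for all observations. *)
Lemma likelihood_le b z (B t : R) : (forall i, 2 * l2norm (X i *m (b - b0)) <= B) ->
  0 < t -> t <= 1 -> t * B <= 10^-1 ->
  lik b z <= lik b0 z * expR (centered X b0 (fun i => X i *m (b - b0)) z -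
    9 / 25 * t * \sum_i fvar (P i) (catval (X i *m (b - b0)))).
Proof.
move=> hB t0 t1 tB; rewrite (likelihood_ratio b z) -[leLHS]mulrA ler_wpM2l ?likelihood_ge0//.
have pos : 0 < \prod_i fmean (P i) (fun k => expR (catval (X i *m (b - b0)) k - fmean (P i) (catval (X i *m (b - b0))))).
  apply: prodr_gt0 => i _; apply: lt_le_trans (expR_gt0 _) _; last first.
    by apply: (@expR_fmean _ _ (P i)); [exact: catprob_ge0|exact: catprob_sum1].
rewrite [in leRHS]expRD ler_wpM2l ?expR_ge0// expRN lef_pV2 ?posrE ?expR_gt0//.
rewrite mulr_sumr expR_sum; apply: ler_prod => i _; apply/andP; split.
  exact: expR_ge0.
apply: (@fmean_expR_ge _ _ _ _ _ _ B) => //.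
- exact: catprob_ge0.
- exact: catprob_sum1.
- by move=> l; apply: le_trans (hB i); exact: catval_centered.
Qed.

(** The gradient of the log-likelihood at [b0]. *)
Definition score z : 'cV[R]_d := (stackX X)^T *m (stackY z - meanY X b0).

Lemma centered_score c z :
  centered X b0 (fun i => X i *m c) z = ((score z)^T *m c) 0 0.
Proof.
rewrite -(stackY_centered m0) -mxcol_mul -/(stackX X) /score.
by rewrite trmx_mul trmxK mulmxA.
Qed.

Lemma likelihood_gt0 b z : 0 < lik b z.
Proof.
apply: prodr_gt0 => i _; rewrite divr_gt0 ?expR_gt0//.
by rewrite ltr_pwDl// sumr_ge0// => k _; exact: expR_ge0.
Qed.

Section groups.
Context {p : nat} (G : 'I_p -> {set 'I_d}).
Hypothesis hG : group_partition G.

Lemma mulmx_vecgroup (s c : 'cV[R]_d) :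
  (s^T *m c) 0 0 = \sum_j ((vecgroup G s j)^T *m vecgroup G c j) 0 0.
Proof.
rewrite (mulmx_groups hG) summxE; apply: eq_bigr => j _; congr ((_ *m _) 0 0).
by apply/matrixP => i k; rewrite !mxE.
Qed.

Lemma score_le c z (L : R) : (forall j, l2norm (vecgroup G (score z) j) <= L) ->
  `|centered X b0 (fun i => X i *m c) z| <= L * norm21 G [set: 'I_p]%SET c.
Proof.
move=> hL; rewrite centered_score mulmx_vecgroup (le_trans (ler_norm_sum _ _ _))//.
rewrite /norm21 mulr_sumr [leRHS](eq_bigl predT); last by move=> j; rewrite inE.
apply: ler_sum => j _; apply: le_trans (l2norm_mulmx _ _) _.
by rewrite ler_wpM2r ?l2norm_ge0.
Qed.

Lemma expect_expR_score j (u : 'cV[R]_(gsize G j)) :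
  \sum_z lik b0 z * expR (((vecgroup G (score z) j)^T *m u) 0 0) <=
  expR (8 / 5 * (gnorm G (stackX X) * l2norm u) ^+ 2).
Proof.
apply: (@le_trans _ _ (expR (8 / 5 * \sum_i l2norm (colgroup G (X i) j *m u) ^+ 2))).
  rewrite (le_trans _ (expect_expR_centered _))//.
  rewrite le_eqVlt; apply/orP; left; apply/eqP/eq_bigr => z _; congr (_ * expR _).
  rewrite -(stackY_centered m0) -colgroup_stackX mulmxA; congr ((_ *m _) 0 0).
  rewrite -[LHS]trmxK -[RHS]trmxK; congr (_^T); rewrite trmxK trmx_mul trmxK.
  by apply/colP => i; rewrite !mxE; apply: eq_bigr => k _; rewrite !mxE.
by rewrite ler_expR ler_pM2l//; exact: sum_l2norm_colgroup.
Qed.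
End groups.
End moments.

(** * Sub-Gaussian tails of the score *)

Section gaussian_mixture.
Context {R : realType} {I : finType}.
Implicit Types (w : I -> R) (K a kappa : R).

Let normal_tilt a (x s : R) : 0 < a ->
  expR (s * x) * normal_pdf 0 (Num.sqrt (2 * a)) s =
  expR (a * x ^+ 2) * normal_pdf (2 * a * x) (Num.sqrt (2 * a)) s.
Proof.
move=> a0; have s0 : 0 < Num.sqrt (2 * a) by rewrite sqrtr_gt0; lra.
rewrite /normal_pdf gt_eqF// mulrCA [RHS]mulrCA; congr (_ * _).
rewrite /normal_fun -!expRD sqr_sqrtr; last by lra.
by congr expR; rewrite -mulr_natr; field; lra.
Qed.

Let normal_scale a kappa (s : R) : 0 < a -> 0 < kappa ->
  expR ((1 - kappa ^- 2) / (4 * a) * s ^+ 2) * normal_pdf 0 (Num.sqrt (2 * a)) s =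
  kappa * normal_pdf 0 (kappa * Num.sqrt (2 * a)) s.
Proof.
move=> a0 k0; have s0 : 0 < Num.sqrt (2 * a) by rewrite sqrtr_gt0; lra.
have ks0 : 0 < kappa * Num.sqrt (2 * a) by rewrite mulr_gt0.
have peakE (y : R) : normal_peak (kappa * y) = kappa^-1 * normal_peak y.
  rewrite /normal_peak -invfM; congr (_^-1).
  rewrite (_ : (kappa * y) ^+ 2 * pi *+ 2 = kappa ^+ 2 * (y ^+ 2 * pi *+ 2)); last by ring.
  by rewrite sqrtrM ?sqr_ge0// sqrtr_sqr gtr0_norm.
rewrite /normal_pdf !gt_eqF// peakE mulrCA !mulrA divff ?mul1r ?gt_eqF// -mulrA; congr (_ * _).
rewrite /normal_fun -expRD exprMn sqr_sqrtr; last by lra.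
by congr expR; rewrite -mulr_natr; field; lra.
Qed.

(** exp(a x^2) is the mean of exp(s x) for s normal with variance 2 a. Integrating the assumed bound
    against the same law gives [kappa], as its quadratic exponent multiplies the standard deviation
    of the normal density by [kappa]. *)
Lemma gaussian_mixture1 w K a kappa (x : I -> R) : (forall z, 0 <= w z) -> 0 <= K ->
  0 < a -> 0 < kappa ->
  (forall s, \sum_z w z * expR (s * x z) <= K * expR ((1 - kappa ^- 2) / (4 * a) * s ^+ 2)) ->
  \sum_z w z * expR (a * x z ^+ 2) <= K * kappa.
Proof.
move=> w0 K0 a0 k0 H.
rewrite -lee_fin.
have -> : (\sum_z w z * expR (a * x z ^+ 2))%:E =
  (\int[lebesgue_measure]_s (\sum_z w z * expR (s * x z) * normal_pdf 0 (Num.sqrt (2 * a)) s)%:E)%E.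
  rewrite -sumEFin.
  under [RHS]eq_integral do rewrite -sumEFin.
  rewrite ge0_integral_sum//=; last 2 first.
  - move=> z; apply/measurable_EFinP; apply: measurable_funM; last exact: measurable_normal_pdf.
    by apply: measurable_funM => //; apply: measurableT_comp => //; apply: measurable_funM.
  - by move=> z s _; rewrite lee_fin !mulr_ge0 ?expR_ge0 ?normal_pdf_ge0.
  apply: eq_bigr => z _.
  under eq_integral do rewrite -mulrA normal_tilt// mulrA EFinM.
  rewrite ge0_integralZl//.
  - by rewrite integral_normal_pdf mule1.
  - by apply/measurable_EFinP; exact: measurable_normal_pdf.
  - by move=> s _; rewrite lee_fin normal_pdf_ge0.
  - by rewrite lee_fin mulr_ge0 ?expR_ge0.
have -> : (K * kappa)%:E =
  (\int[lebesgue_measure]_s (K * expR ((1 - kappa ^- 2) / (4 * a) * s ^+ 2) * normal_pdf 0 (Num.sqrt (2 * a)) s)%:E)%E.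
  under eq_integral do rewrite -mulrA normal_scale// mulrA EFinM.
  rewrite ge0_integralZl//.
  - by rewrite integral_normal_pdf mule1.
  - by apply/measurable_EFinP; exact: measurable_normal_pdf.
  - by move=> s _; rewrite lee_fin normal_pdf_ge0.
  - by rewrite lee_fin mulr_ge0// ltW.
apply: ge0_le_integral => //.
- by move=> s _; rewrite lee_fin sumr_ge0// => z _; rewrite !mulr_ge0 ?expR_ge0 ?normal_pdf_ge0.
- apply/measurable_EFinP; apply: measurable_sum => z.
  apply: measurable_funM; last exact: measurable_normal_pdf.
  by apply: measurable_funM => //; apply: measurableT_comp => //; apply: measurable_funM.
- apply/measurable_EFinP; apply: measurable_funM; last exact: measurable_normal_pdf.
  apply: measurable_funM => //; apply: measurableT_comp => //; apply: measurable_funM => //.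
- move=> s _; rewrite lee_fin -mulr_suml ler_wpM2r ?normal_pdf_ge0//.
Qed.

(** One coordinate is mixed at a time. The tilt by exp(s x_j) is absorbed into the weight and its
    bound into [K], so [w] and [K] vary in the induction. *)
Lemma gaussian_mixture (J : eqType) (r : seq J) w K a kappa (x : J -> I -> R) :
  uniq r -> (forall z, 0 <= w z) -> 0 <= K -> 0 < a -> 0 < kappa ->
  (forall u : J -> R, \sum_z w z * expR (\sum_(j <- r) u j * x j z) <=
     K * expR ((1 - kappa ^- 2) / (4 * a) * \sum_(j <- r) u j ^+ 2)) ->
  \sum_z w z * expR (a * \sum_(j <- r) x j z ^+ 2) <= K * kappa ^+ size r.
Proof.
elim: r w K => [|j r IH] w K /= ur w0 K0 a0 k0 H.
  have := H (fun=> 0); rewrite !big_nil mulr0 expR0 expr0 mulr1.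
  by under eq_bigr do rewrite big_nil expR0; under [X in _ -> X <= _]eq_bigr do rewrite big_nil mulr0 expR0.
have [jr {}ur] := andP ur.
pose w' z := w z * expR (a * \sum_(k <- r) x k z ^+ 2).
have -> : \sum_z w z * expR (a * \sum_(k <- j :: r) x k z ^+ 2) =
    \sum_z w' z * expR (a * x j z ^+ 2).
  by apply: eq_bigr => z _; rewrite big_cons mulrDr expRD /w'; ring.
rewrite exprSr mulrA; apply: gaussian_mixture1 => //.
- by move=> z; rewrite mulr_ge0 ?expR_ge0.
- by rewrite mulr_ge0 ?exprn_ge0// ltW.
move=> s; have := IH (fun z => w z * expR (s * x j z))
  (K * expR ((1 - kappa ^- 2) / (4 * a) * s ^+ 2)) ur.
have -> : \sum_z w' z * expR (s * x j z) =
    \sum_z w z * expR (s * x j z) * expR (a * \sum_(k <- r) x k z ^+ 2).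
  by apply: eq_bigr => z _; rewrite /w'; ring.
rewrite (mulrAC K (kappa ^+ _)); apply => //.
- by move=> z; rewrite mulr_ge0 ?expR_ge0.
- by rewrite mulr_ge0 ?expR_ge0.
move=> u; have := H (fun k => if k == j then s else u k).
rewrite big_cons eqxx mulrDr expRD mulrA.
have er F : \sum_(k <- r) F k (if k == j then s else u k) = \sum_(k <- r) F k (u k) :> R.
  by apply: eq_big_seq => k kr; case: eqP => // kj; rewrite -kj kr in jr.
rewrite (er (fun _ y => y ^+ 2)); apply: le_trans.
rewrite le_eqVlt; apply/orP; left; apply/eqP/eq_bigr => z _.
by rewrite big_cons eqxx expRD mulrA (er (fun k y => y * x k z)).
Qed.

(** Markov's inequality for exp(a |xi|^2), which bounds the whole norm without a covering of the
    sphere. With a = 1 / (8 V) and kappa^2 = 5 the exponent (1 - kappa^-2) / (4 a) is exactly 8 V /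
    5. *)
Lemma subgaussian_tail g (w : I -> R) (xi : I -> 'cV[R]_g) (V L : R) :
  (forall z, 0 <= w z) -> 0 < V ->
  (forall u : 'cV[R]_g, \sum_z w z * expR (((xi z)^T *m u) 0 0) <=
     expR (8 / 5 * V * l2norm u ^+ 2)) ->
  0 <= L ->
  \sum_(z | L < l2norm (xi z)) w z <= Num.sqrt 5 ^+ g * expR (- (L ^+ 2 / (8 * V))).
Proof.
move=> w0 V0 H L0; have s5 : 0 < Num.sqrt 5 :> R by rewrite sqrtr_gt0.
have aV : 0 < (8 * V)^-1 by rewrite invr_gt0 mulr_gt0.
have := @gaussian_mixture _ (enum 'I_g) w 1 (8 * V)^-1 (Num.sqrt 5) (fun k z => xi z k 0)
  (enum_uniq _) w0 ler01 aV s5.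
rewrite -cardE card_ord mul1r => h.
have {}h : \sum_z w z * expR ((8 * V)^-1 * l2norm (xi z) ^+ 2) <= Num.sqrt 5 ^+ g.
  under eq_bigr do rewrite l2norm_sqr -big_enum/=.
  apply: h => u; rewrite mul1r.
  have -> : (1 - Num.sqrt 5 ^- 2) / (4 * (8 * V)^-1) = 8 / 5 * V.
    by rewrite sqr_sqrtr//; field; lra.
  have := H (\col_k u k); rewrite l2norm_sqr big_enum/=.
  under [X in _ <= expR (_ * X)]eq_bigr do rewrite mxE.
  apply: le_trans; rewrite le_eqVlt; apply/orP; left; apply/eqP/eq_bigr => z _.
  by congr (_ * expR _); rewrite mxE big_enum/=; apply: eq_bigr => k _; rewrite !mxE mulrC.
rewrite expRN ler_pdivlMr ?expR_gt0//; apply: le_trans h.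
rewrite mulr_suml [leRHS](bigID (fun z => L < l2norm (xi z)))/= ler_wpDr//.
  by apply: sumr_ge0 => z _; rewrite mulr_ge0 ?expR_ge0.
apply: ler_sum => z Lz; rewrite ler_wpM2l// ler_expR mulrC ler_pM2l//.
by rewrite ler_pXn2r ?nnegrE ?l2norm_ge0// ltW.
Qed.
End gaussian_mixture.

Section score_tail.
Context {R : realType} {m n d p : nat}.
Hypothesis m0 : (0 < m)%N.
Variables (X : 'I_n -> 'M[R]_(m.-1, d)) (b0 : 'cV[R]_d) (G : 'I_p -> {set 'I_d}).
Hypothesis hG : group_partition G.
Local Notation lik b z := (likelihood X b (response z)).
Local Notation g := (gnorm G (stackX X)).
Implicit Types (z : {ffun 'I_n -> 'I_m}) (b c : 'cV[R]_d).

Lemma gsize_le_gbar j : (gsize G j <= gbar G)%N.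
Proof. exact: (leq_bigmax (F := gsize G)). Qed.

Definition score_small (L : R) z := [forall j, l2norm (vecgroup G (score X b0 z) j) <= L].

Lemma score_tail (L : R) : 0 <= L -> 0 < g ->
  \sum_(z | ~~ score_small L z) lik b0 z <=
  p%:R * Num.sqrt 5 ^+ gbar G * expR (- (L ^+ 2 / (8 * g ^+ 2))).
Proof.
move=> L0 g0.
have s51 : 1 <= Num.sqrt 5 :> R by rewrite -[leLHS]sqrtr1 ler_wsqrtr// ler1n.
apply: (@le_trans _ _ (\sum_(j < p) \sum_(z | L < l2norm (vecgroup G (score X b0 z) j)) lik b0 z)).
  under [leRHS]eq_bigr do rewrite big_mkcond.
  rewrite exchange_big/= [leLHS]big_mkcond; apply: ler_sum => z _.
  have nn j : 0 <= if L < l2norm (vecgroup G (score X b0 z) j) then lik b0 z else 0.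
    by case: ifP => // _; exact: likelihood_ge0.
  case: ifP => [|_]; last by apply: sumr_ge0.
  rewrite negb_forall => /existsP[j]; rewrite -ltNge => Lj.
  by rewrite (bigD1 j)//= Lj lerDl sumr_ge0.
rewrite -mulrA; set K := Num.sqrt 5 ^+ _ * _.
rewrite mulr_natl -[X in _ *+ X](card_ord p) -sumr_const; apply: ler_sum => j _.
apply: (@le_trans _ _ (Num.sqrt 5 ^+ gsize G j * expR (- (L ^+ 2 / (8 * g ^+ 2))))).
  apply: subgaussian_tail => //.
  - by move=> z; exact: likelihood_ge0.
  - by rewrite exprn_gt0.
  - by move=> u; rewrite -mulrA -exprMn; exact: expect_expR_score.
by rewrite ler_wpM2r ?expR_ge0// ler_weXn2l// gsize_le_gbar.
Qed.
End score_tail.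

(** * Compatibility number and curvature of the likelihood *)

Section compatibility.
Context {R : realType} {m n d p : nat}.
Hypothesis m0 : (0 < m)%N.
Variables (X : 'I_n -> 'M[R]_(m.-1, d)) (b0 : 'cV[R]_d) (G : 'I_p -> {set 'I_d}).
Hypothesis hG : group_partition G.
Hypothesis g0 : 0 < gnorm G (stackX X).
Local Notation g := (gnorm G (stackX X)).
Local Notation N := (norm21 G [set: 'I_p]%SET).
Implicit Types (c : 'cV[R]_d) (S : {set 'I_p}).

(** The quadratic form c^T X^T W X c, by [covY_quad]. *)
Definition logit_var c : R := \sum_i fvar (catprob (X i) b0) (catval (X i *m c)).

Lemma logit_var_ge0 c : 0 <= logit_var c.
Proof.
apply: sumr_ge0 => i _; apply: sumr_ge0 => l _.
by rewrite mulr_ge0 ?sqr_ge0 ?catprob_ge0.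
Qed.

Lemma l2norm_covY c :
  l2norm (psd_sqrt (covY X b0) *m stackX X *m c) ^+ 2 <= logit_var c.
Proof.
rewrite -mulmxA; have [->|->] := psd_sqrt_spec (covY X b0).
  by rewrite mul0mx l2norm0 expr0n logit_var_ge0.
by rewrite /stackX mxcol_mul covY_quad.
Qed.

Lemma logit_var_le c : logit_var c <= l2norm (stackX X *m c) ^+ 2.
Proof.
rewrite l2norm_stackX; apply: ler_sum => i _; set v := X i *m c.
have P0 := catprob_ge0 (X i) b0; have P1 := catprob_sum1 m0 (X i) b0.
set M := fmean (catprob (X i) b0) (catval v).
apply: (@le_trans _ _ (\sum_l catprob (X i) b0 l * (catval v l) ^+ 2)).
  have -> : fvar (catprob (X i) b0) (catval v) =
      \sum_l catprob (X i) b0 l * (catval v l) ^+ 2 - M ^+ 2.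
    transitivity (\sum_l (catprob (X i) b0 l * (catval v l) ^+ 2 -
       2 * M * (catprob (X i) b0 l * catval v l) + M ^+ 2 * catprob (X i) b0 l)).
      by apply: eq_bigr => l _; rewrite -/M; ring.
    have FM : \sum_l catprob (X i) b0 l * catval v l = M by [].
    by rewrite big_split/= sumrB -!mulr_sumr P1 FM; ring.
  by rewrite gerBl sqr_ge0.
rewrite -[leRHS]mul1r -P1 mulr_suml; apply: ler_sum => l _; rewrite ler_wpM2l//.
by rewrite -real_normK ?num_real// ler_pXn2r ?nnegrE ?l2norm_ge0// catval_abs.
Qed.

(** On the cone, a vector of positive norm has a nonzero group in [S], so it competes in the
    infimum. *)
Lemma compat_logit_var S (phi : R) c : 0 <= phi -> (phi%:E <= compat G X b0 S)%E ->
  norm21 G (~: S)%SET c <= 7 * norm21 G S c -> 0 < N c ->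
  (phi * g * N c) ^+ 2 <= #|S|%:R * logit_var c.
Proof.
move=> phi0 hphi cone Nc.
have [j jS cj] : exists2 j, j \in S & vecgroup G c j != 0.
  apply: contrapT => h; have S0 : norm21 G S c = 0.
    rewrite /norm21 big1// => j jS; apply/eqP; rewrite l2norm_eq0.
    by apply: contrapT => /negP cj; apply: h; exists j.
  by move: cone Nc; rewrite (norm21_setC _ S) S0 mulr0 add0r => h1 /lt_le_trans/(_ h1); rewrite ltxx.
have : (phi%:E <= (l2norm (psd_sqrt (covY X b0) *m stackX X *m c) *
    Num.sqrt #|S|%:R / (g * N c))%:E)%E.
  by apply: le_trans hphi _; apply: ereal_inf_lbound; exists c => //=; split => //; exists j.
rewrite lee_fin ler_pdivlMr ?mulr_gt0// mulrA => h.
apply: (@le_trans _ _ ((l2norm (psd_sqrt (covY X b0) *m stackX X *m c) * Num.sqrt #|S|%:R) ^+ 2)).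
  by rewrite ler_pXn2r ?nnegrE ?mulr_ge0 ?l2norm_ge0 ?sqrtr_ge0// ltW.
rewrite exprMn [X in _ * X]sqr_sqrtr// [leLHS]mulrC ler_wpM2l//; exact: l2norm_covY.
Qed.

Lemma compat_finite S : S != finset.set0 ->
  exists phi : R, [/\ compat G X b0 S = phi%:E, 0 <= phi & phi <= 1].
Proof.
move=> S0; have [j0 j0S] := set0Pn _ S0.
have [b [b1 b00 hb]] := sign_group_vector hG (stackX X) S.
have Nb : N b = #|S|%:R.
  rewrite (norm21_setC _ S) [X in _ + X]big1 ?addr0; last first.
    by move=> j; rewrite inE => /b00 ->; exact: l2norm0.
  by rewrite /norm21 (eq_bigr (fun=> 1)) ?sumr_const.
have s0 : 0 < #|S|%:R :> R by rewrite ltr0n card_gt0.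
have le1 : (compat G X b0 S <= 1%:E)%E.
  apply: (@le_trans _ _ (l2norm (psd_sqrt (covY X b0) *m stackX X *m b) *
    Num.sqrt #|S|%:R / (g * N b))%:E).
    apply: ereal_inf_lbound; exists b => //=; split.
      rewrite [leLHS]big1; first by rewrite mulr_ge0 ?norm21_ge0.
      by move=> j; rewrite inE => /b00 ->; exact: l2norm0.
    by exists j0 => //; rewrite -l2norm_eq0 b1// oner_eq0.
  rewrite lee_fin ler_pdivrMr ?mulr_gt0 ?Nb// mul1r.
  rewrite -(@ler_pXn2r _ 2) ?nnegrE ?mulr_ge0 ?l2norm_ge0 ?sqrtr_ge0 ?gnorm_ge0//.
  rewrite exprMn [X in _ * X]sqr_sqrtr// [X in _ <= X](_ : _ = g ^+ 2 * #|S|%:R * #|S|%:R); last by ring.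
  rewrite ler_pM2r//.
  rewrite [leRHS]mulrC.
  by apply: le_trans (l2norm_covY _) _; apply: le_trans (logit_var_le _) hb.
have ge0 : (0%:E <= compat G X b0 S)%E.
  apply: le_ereal_inf_tmp => _ [c _ <-]; rewrite lee_fin.
  by rewrite divr_ge0 ?mulr_ge0 ?l2norm_ge0 ?sqrtr_ge0 ?gnorm_ge0 ?norm21_ge0.
move: le1 ge0; case: (compat G X b0 S) => // phi; rewrite !lee_fin => h1 h2.
by exists phi.
Qed.
End compatibility.

Section likelihood_bound.
Context {R : realType} {m n d p : nat}.
Hypothesis m0 : (0 < m)%N.
Variables (X : 'I_n -> 'M[R]_(m.-1, d)) (b0 : 'cV[R]_d) (G : 'I_p -> {set 'I_d}).
Hypothesis hG : group_partition G.
Local Notation g := (gnorm G (stackX X)).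
Local Notation N := (norm21 G [set: 'I_p]%SET).
Local Notation lik b z := (likelihood X b (response z)).
Local Notation S0 := (gsupp G b0).
Implicit Types (b c : 'cV[R]_d) (S : {set 'I_p}).

Lemma vecgroup_notin_gsupp b j : j \notin gsupp G b -> vecgroup G b j = 0.
Proof. by rewrite inE negbK => /eqP. Qed.

Lemma norm21_support S b : gsupp G b \subset S -> N b = norm21 G S b.
Proof.
move=> bS; rewrite (norm21_setC _ S) [X in _ + X]big1 ?addr0// => j.
rewrite inE => jS; rewrite vecgroup_notin_gsupp ?l2norm0//.
by apply: contra jS; exact: (fintype.subsetP bS).
Qed.

(** Decomposability of the norm: off the support of [b0] the vectors [b] and [b - b0] agree, and on
    it the triangle inequality applies. *)
Lemma norm21_gsupp_diff b :
  N b0 - N b <= norm21 G S0 (b - b0) - norm21 G (~: S0)%SET (b - b0).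
Proof.
rewrite (norm21_support (subxx S0)) (norm21_setC _ S0 b).
have -> : norm21 G (~: S0)%SET (b - b0) = norm21 G (~: S0)%SET b.
  apply: eq_bigr => j; rewrite finset.in_setC => /vecgroup_notin_gsupp bj.
  by rewrite vecgroupD vecgroupN bj subr0.
have := ler_norm21D G S0 (b - b0) (- b).
rewrite addrAC subrr add0r !norm21N; lra.
Qed.

(* [w] stands for [a N / h]; the constants are those of the prior ([8]), of the bound on the
   score ([3]) and of the envelope ([1/2]): [8 + 3 + 1/2 = 23/2] *)
Lemma quadratic_penalty_bound (kappa a h N B v : R) :
  0 < kappa -> kappa <= 10^-1 * (10^-1 * 10^-1) -> 0 < a -> 0 < h -> 0 < N -> 0 <= B ->
  a * N ^+ 2 <= v -> 20 * (B * h) <= kappa * a ->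
  23 / 2 * (h * N) - 9 / 25 * (1 + 20 * (B * N))^-1 * v <= 96 * (h ^+ 2 / a).
Proof.
move=> k0 k1 a0 h0 N0 B0 av Bh; set w := a * N / h.
have w0 : 0 < w by rewrite divr_gt0// mulr_gt0.
have kw0 : 0 < kappa * w by rewrite mulr_gt0.
have kw1 : kappa * w <= 10^-1 * (10^-1 * 10^-1) * w by rewrite ler_pM2r.
have NE : N = w * h / a by rewrite /w; field; rewrite !gt_eqF.
have BN : 20 * (B * N) <= kappa * w.
  rewrite [leRHS](_ : _ = kappa * a * N / h); last by rewrite /w; ring.
  rewrite ler_pdivlMr; last exact: h0.
  by rewrite [leLHS](_ : _ = 20 * (B * h) * N); [rewrite ler_pM2r|ring].
have BN0 : 0 <= 20 * (B * N) by rewrite !mulr_ge0// ltW.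
have h1 : (1 + kappa * w)^-1 * (a * N ^+ 2) <= (1 + 20 * (B * N))^-1 * v.
  apply: ler_pM => //.
  - by rewrite invr_ge0; lra.
  - by rewrite mulr_ge0 ?sqr_ge0// ltW.
  - by rewrite lef_pV2 ?posrE; lra.
have -> : h * N = w * (h ^+ 2 / a) by rewrite NE; field; rewrite gt_eqF.
have h2 : a * N ^+ 2 = w ^+ 2 * (h ^+ 2 / a) by rewrite NE; field; rewrite gt_eqF.
rewrite h2 in h1; set Q := h ^+ 2 / a in h1 *.
have Q0 : 0 < Q by rewrite divr_gt0// exprn_gt0.
clearbody w Q; have key : 23 / 2 * w - 9 / 25 * ((1 + kappa * w)^-1 * w ^+ 2) <= 96.
  set t := (1 + kappa * w)^-1 * w ^+ 2.
  have tE : t * (1 + kappa * w) = w ^+ 2 by rewrite /t mulrAC mulVf ?mul1r// gt_eqF//; lra.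
  (* Above 34 the damped curvature alone beats the linear term, as 23/2 (1 + w / 1000) <= 9/25 w
     from about 33 on. Below 34 the damping costs at most the fraction 34/1000. *)
  have [w33|w33] := leP w 34; last first.
    have ht : w * (23 / 2 * (1 + kappa * w)) <= w * (9 / 25 * w) by rewrite ler_pM2l//; lra.
    have {}ht : 23 / 2 * w * (1 + kappa * w) <= 9 / 25 * t * (1 + kappa * w) by nra.
    rewrite ler_pM2r in ht; lra.
  have : w ^+ 2 * (1 - kappa * w) <= t.
    have : (1 - kappa * w) * (1 + kappa * w) <= 1 by nra.
    rewrite -ler_pdivlMr ?div1r; last by lra.
    by rewrite /t => hi; rewrite [leRHS]mulrC; apply: ler_wpM2l; rewrite ?sqr_ge0.
  have : kappa * w * w ^+ 2 <= 10^-1 * (10^-1 * 10^-1) * 34 * w ^+ 2.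
    by rewrite ler_wpM2r ?sqr_ge0//; lra.
  (* The remaining parabola has its vertex near 33/2 and its maximum near 95. *)
  have := sqr_ge0 (w - 33 / 2); lra.
move: h1 (ler_wpM2r (ltW Q0) key).
set i1 := (1 + kappa * w)^-1; set i2 := (1 + _)^-1; clearbody i1 i2.
by move=> h1 h3; lra.
Qed.

(** Of the penalty 8 h, the score uses 3 h, and h / 2 is kept as the envelope that makes the bound
    integrable over slabs. The number [a] is the curvature on the cone, supplied by
    [Bset_curvature]. *)
Lemma penalized_likelihood_le (kappa h C : R) b z :
  0 < kappa -> kappa <= 10^-1 * (10^-1 * 10^-1) -> 0 < h -> 0 <= C -> score_small X b0 G (3 * h) z ->
  (norm21 G (~: S0)%SET (b - b0) <= 7 * norm21 G S0 (b - b0) -> 0 < N (b - b0) ->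
    exists a : R, [/\ 0 < a, a * N (b - b0) ^+ 2 <= logit_var X b0 (b - b0),
      20 * (gnorm_max G X * h) <= kappa * a & 96 * (h ^+ 2 / a) <= C]) ->
  lik b z * expR (- (8 * h * N b)) <=
  lik b0 z * expR (- (8 * h * N b0)) * expR C * expR (- (h / 2 * N (b - b0))).
Proof.
move=> k0 k1 h0 C0 /forallP hz H; set c := b - b0 in H *.
have Nc0 : 0 <= N c by exact: norm21_ge0.
have B0 := gnorm_max_ge0 G X.
(* With centred values bounded by 2 max_i |X_i| N(c), this choice keeps t B <= 1/10 and t <= 1. *)
set t := (1 + 20 * (gnorm_max G X * N c))^-1.
have BN0 : 0 <= gnorm_max G X * N c by rewrite mulr_ge0.
have t0 : 0 < t by rewrite invr_gt0; lra.
have t1 : t <= 1 by rewrite invf_le1; lra.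
have := @likelihood_le R m n d m0 X b0 b z (2 * (gnorm_max G X * N c)) t.
rewrite -/c => /(_ _ t0 t1)/wrap[].
  move=> i; rewrite ler_pM2l//; apply: le_trans (l2norm_mulmx_norm21 hG _ _) _.
  by rewrite ler_wpM2r// gnorm_le_max.
move=> /(_ _)/wrap[].
  rewrite /t mulrC ler_pdivrMr; lra.
rewrite -/(logit_var X b0 c) => hl.
have sc := le_trans (ler_norm _) (score_le m0 hG c hz).
have v0 := logit_var_ge0 X b0 c.
apply: le_trans (ler_wpM2r (expR_ge0 _) hl) _.
rewrite -!mulrA -!expRD ler_pM2l ?likelihood_gt0// ler_expR.
have := norm21_gsupp_diff b; rewrite -/c => hd.
have Nc := norm21_setC G S0 c.
have x0 : 0 <= norm21 G S0 c by exact: norm21_ge0.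
have y0 : 0 <= norm21 G (~: S0)%SET c by exact: norm21_ge0.
set cen := centered _ _ _ _ in sc *.
have tv0 : 0 <= 9 / 25 * t * logit_var X b0 c by rewrite !mulr_ge0// ltW.
have hd' : 8 * h * N b0 - 8 * h * N b <= 8 * h * (norm21 G S0 c - norm21 G (~: S0)%SET c).
  by rewrite -mulrBr ler_pM2l//; lra.
suff : 3 * h * N c + 8 * h * (norm21 G S0 c - norm21 G (~: S0)%SET c) -
    9 / 25 * t * logit_var X b0 c <= C - h / 2 * N c by lra.
(* The linear terms have coefficient 8 + 3 + 1/2 = 23/2 on the support and - 8 + 3 + 1/2 = - 9/2 off
   it; outside the cone the latter wins since 23/9 < 7. *)
have [cone|cone] := leP (norm21 G (~: S0)%SET c) (7 * norm21 G S0 c); last first.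
  have : h * (23 / 2 * norm21 G S0 c - 9 / 2 * norm21 G (~: S0)%SET c) <= h * 0.
    by rewrite ler_pM2l//; lra.
  rewrite Nc; lra.
have hy : 0 <= h * norm21 G (~: S0)%SET c by rewrite mulr_ge0// ltW.
have [Nc00|Ncp] := eqVneq (N c) 0.
  have [xz yz] : norm21 G S0 c = 0 /\ norm21 G (~: S0)%SET c = 0 by lra.
  rewrite Nc00 xz yz; lra.
have {}Ncp : 0 < N c by rewrite lt_neqAle eq_sym Ncp.
have [a [a0 av aB aC]] := H cone Ncp.
have := @quadratic_penalty_bound kappa a h (N c) (gnorm_max G X) _ k0 k1 a0 h0 Ncp B0 av aB.
rewrite -/t {1}Nc; rewrite Nc in Ncp *; lra.
Qed.
End likelihood_bound.

Lemma ler_half_div (R : realFieldType) (u v w : R) :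
  0 < u -> 0 < v -> 0 < w -> w <= 2 * v -> 2^-1 * (u / v) <= u / w.
Proof.
move=> u0 v0 w0 wv.
have -> : 2^-1 * (u / v) = u / (2 * v) by field; rewrite gt_eqF.
by rewrite ler_pM2l// lef_pV2 ?posrE ?mulr_gt0.
Qed.

(** * Posterior mass of large models *)

Section posterior_integrals.
Context {R : realType} {m n d p : nat}.
Variables (X : 'I_n -> 'M[R]_(m.-1, d)) (G : 'I_p -> {set 'I_d}) (ppi : dim_pmf R p).
Hypothesis hG : group_partition G.
Local Notation N := (norm21 G [set: 'I_p]%SET).
Local Notation lam := (lambda G X).
Implicit Types (b : 'cV[R]_d) (S : {set 'I_p}) (Y : 'I_n -> 'cV[R]_(m.-1)).

Lemma measurable_mulmx_tcol k (A : 'M[R]_(k, d)) i :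
  measurable_fun setT (fun t : d.-tuple R => (A *m tcol t) i 0).
Proof.
under eq_fun do rewrite mxE.
apply: measurable_sum => j; apply: measurable_funM => //.
by under eq_fun do rewrite mxE; exact: measurable_tnth.
Qed.

Lemma measurable_likelihood Y :
  measurable_fun setT (fun t : d.-tuple R => likelihood X (tcol t) Y).
Proof.
apply: measurable_prod => i _; rewrite /likelihood1.
rewrite (_ : (fun t => _) = (fun t : d.-tuple R => expR (((Y i)^T *m X i *m tcol t) 0 0) *
  expR (- ln (1 + \sum_(k < m.-1) expR ((X i *m tcol t) k 0))))); last first.
  apply/funext => t; rewrite expRN lnK// posrE ltr_pwDl//.
  by apply: sumr_ge0 => k _; exact: expR_ge0.
apply: measurable_funM.
  by apply: measurableT_comp => //; exact: measurable_mulmx_tcol.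
apply: measurableT_comp => //; apply: measurableT_comp => //.
apply: (@measurableT_comp _ _ _ _ _ _ (@ln R)); first exact: measurable_ln.
apply: measurable_funD => //; apply: measurable_sum => k.
by apply: measurableT_comp => //; exact: measurable_mulmx_tcol.
Qed.

Lemma measurable_l2norm_vecgroup j :
  measurable_fun setT (fun t : d.-tuple R => l2norm (vecgroup G (tcol t) j)).
Proof.
rewrite /l2norm; apply: measurableT_comp => /=.
  by apply: continuous_measurable_fun; exact: sqrt_continuous.
apply: measurable_sum => i; apply: measurable_funX.
under eq_fun do rewrite !mxE.
exact: measurable_tnth.
Qed.

(** A sum of indicators, from which measurability of the support size follows. *)
Lemma card_gsupp b : #|gsupp G b|%:R = \sum_j (0 < l2norm (vecgroup G b j))%R%:R :> R.
Proof.
rewrite -sum1_card natr_sum big_mkcond/=; apply: eq_bigr => j _.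
by rewrite inE -l2norm_eq0 lt_neqAle l2norm_ge0 andbT [0 == _]eq_sym; case: eqP.
Qed.

Lemma measurable_gsupp (K : R) :
  measurable [set t : d.-tuple R | K < #|gsupp G (tcol t)|%:R].
Proof.
have h : measurable_fun setT (fun t : d.-tuple R => K < #|gsupp G (tcol t)|%:R).
  apply: measurable_fun_ltr => //.
  under eq_fun do rewrite card_gsupp.
  apply: measurable_sum => j; apply: measurable_natb.
  by apply: measurable_fun_ltr => //; exact: measurable_l2norm_vecgroup.
rewrite -[X in measurable X]setTI (_ : [set t | _] =
  (fun t : d.-tuple R => K < #|gsupp G (tcol t)|%:R) @^-1` [set true]).
  exact: h.
by apply/seteqP; split => t.
Qed.

Lemma gsupp_embedS S (t : (dimS G S).-tuple R) : gsupp G (tcol (embedS t)) \subset S.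
Proof.
apply/fintype.subsetP => j; rewrite inE; apply: contraR => jS.
rewrite -l2norm_eq0 l2norm_vecgroup big1 ?sqrtr0// => i ij.
rewrite mxE tnth_mktuple nth_default ?expr0n// size_tuple -(card_coordS S hG) cardE leqNgt.
rewrite index_mem mem_enum; apply: contra jS => /finset.bigcupP[k kS ik].
have [->//|jk] := eqVneq j k.
by rewrite (disjointFr (group_disjoint hG jk) ij) in ik.
Qed.

Lemma slabE S (t : (dimS G S).-tuple R) :
  slab X t = slab_const G X S * expR (- (lam * N (tcol (embedS t)))).
Proof. by rewrite (norm21_support (gsupp_embedS t)). Qed.

Lemma measurable_expRN_norm21 S (a : R) b (c : R) : 
  measurable_fun setT (fun t : (dimS G S).-tuple R =>
    c * expR (- (a * norm21 G S (tcol (embedS t) - b)))).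
Proof.
apply: measurable_funM => //; apply: measurableT_comp => //; apply: measurableT_comp => //.
apply: measurable_funM => //; under eq_fun do rewrite -(norm21_shiftS hG).
apply: (@measurableT_comp _ _ _ _ _ _ (fun t => norm21 G S (tcol (embedS t)))).
  by apply: (measurableT_comp (measurable_norm21 G S)); exact: measurable_embedS.
exact: measurable_taffine.
Qed.

Definition subset_weight S : R := ppi #|S| / 'C(p, #|S|)%:R.

Lemma subset_weight_ge0 S : 0 <= subset_weight S.
Proof. by rewrite divr_ge0 ?dim_pmf_ge0. Qed.

(** The hypothesis replaces the rate [lam] of a slab by [lam / 16] centred at [b0], so a model of
    dimension D integrates to at most 16 ^ D. Models of size at most [K] drop out, because a vector
    drawn from [S] has its support in [S]. *)
Lemma posterior_numerator_le Y b0 (K A : R) :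
  (forall b, likelihood X b Y * expR (- (lam * N b)) <=
     A * expR (- (lam / 16 * N (b - b0)))) ->
  0 < lam -> 0 <= A ->
  (\int[prior G X ppi]_(t in @tcol R d @^-1` [set b | (K < #|gsupp G b|%:R)%R])
     (likelihood X (tcol t) Y)%:E <=
   (A * \sum_(S : {set 'I_p} | (K < #|S|%:R)%R) subset_weight S * 16 ^+ dimS G S)%:E)%E.
Proof.
move=> H lam0 A0; rewrite [_ @^-1` _]/preimage/=.
have lik0 b : 0 <= likelihood X b Y.
  apply: prodr_ge0 => i _; apply: divr_ge0; first exact: expR_ge0.
  by apply: addr_ge0 => //; apply: sumr_ge0 => k _; exact: expR_ge0.
set D := [set t | _].
have mD : measurable D by exact: measurable_gsupp.
rewrite integral_mkcond ge0_integral_prior; last 2 first.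
- apply/(measurable_restrictT _ _).1; [exact: mD|]; apply: measurable_funTS; apply/measurable_EFinP.
  exact: measurable_likelihood.
- by move=> t; apply: erestrict_ge0 => u _; rewrite lee_fin.
rewrite mulr_sumr -sumEFin [leRHS]big_mkcond/=; apply: lee_sum => S _.
have [KS|KS] := ltP K #|S|%:R; last first.
  rewrite integral0_eq ?mule0// => t _; rewrite patchE memNset ?mule0// /D/=.
  by apply/negP; rewrite -leNgt (le_trans _ KS)// ler_nat subset_leq_card ?gsupp_embedS.
rewrite mulrCA [leRHS]EFinM; apply: lee_wpmul2l.
  by rewrite lee_fin subset_weight_ge0.
have -> : 16 ^+ dimS G S = (lam / (lam / 16)) ^+ dimS G S.
  by congr (_ ^+ _); field; rewrite gt_eqF.
have a0 : 0 < lam / 16 by rewrite divr_gt0.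
rewrite EFinM -(integral_slab_scaled hG X S b0 a0).
have mE := @measurable_expRN_norm21 S (lam / 16) b0.
have /measurable_EFinP mE' := mE (slab_const G X S).
rewrite -(ge0_integralZl _ measurableT mE'); last 2 first.
- by move=> t _; rewrite lee_fin mulr_ge0 ?slab_const_ge0 ?expR_ge0.
- by rewrite lee_fin.
apply: ge0_le_integral => //.
- by move=> t _; rewrite mule_ge0 ?lee_fin ?slab_ge0//; apply: erestrict_ge0 => u _; rewrite lee_fin.
- apply: emeasurable_funM; first by apply/measurable_EFinP; exact: measurable_slab.
  apply: (@measurableT_comp _ _ _ _ _ _
    ((fun t : d.-tuple R => (likelihood X (tcol t) Y)%:E) \_ D)); last exact: measurable_embedS.
  apply/(measurable_restrictT _ _).1; [exact: mD|]; apply: measurable_funTS; apply/measurable_EFinP.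
  exact: measurable_likelihood.
- by apply/measurable_EFinP; apply: measurable_funM.
move=> t _; apply: (@le_trans _ _ ((slab X t)%:E * (likelihood X (tcol (embedS t)) Y)%:E)%E).
  rewrite lee_wpmul2l ?lee_fin ?slab_ge0// patchE; case: ifP => // _.
  by rewrite lee_fin.
rewrite -!EFinM lee_fin slabE -[leLHS]mulrA [leRHS]mulrCA ler_wpM2l ?slab_const_ge0//.
rewrite mulrC; apply: le_trans (H _) _; rewrite ler_wpM2l// ler_expR lerN2.
by rewrite ler_wpM2l ?(ltW a0)// ler_norm21_setT.
Qed.

(* the right-hand side is at most [0] once [g * x >= 1] *)
Lemma envelope_expR_le (L g x k : R) : 0 <= k -> 0 <= g -> 0 <= x ->
  expR (- (8 / 5)) * expR (- ((L + 2 * (k * g)) * x)) <=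
  expR (- (L * x) - 8 / 5 * (g * x) ^+ 2) +
  expR (- (8 / 5)) * (expR (- k) * expR (- ((L + k * g) * x))).
Proof.
move=> k0 g0 x0; have gx0 : 0 <= g * x by rewrite mulr_ge0.
rewrite -!expRD.
(* If g x <= 1, the first term on the right is large enough by itself; otherwise the second one
   is. *)
have [gx1|gx1] := leP (g * x) 1.
  apply: ler_wpDr; first exact: expR_ge0.
  have kgx : 0 <= k * (g * x) by rewrite mulr_ge0.
  have : (g * x) ^+ 2 <= 1 by rewrite exprn_ile1.
  by rewrite ler_expR; lra.
apply: ler_wpDl; first exact: expR_ge0.
have : k * 1 <= k * (g * x) by rewrite ler_wpM2l// ltW.
by rewrite ler_expR; lra.
Qed.

(** Only the model of the true support is kept. The Gaussian factor is traded by [envelope_expR_le]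
    for a difference of two exponentials of the norm, both integrable in closed form; with k = D + 1
    the subtracted one is at most half of the other. *)
Lemma posterior_denominator_ge Y b0 (L g A : R) (D := dimS G (gsupp G b0)) :
  (forall b, A * expR (- (L * N (b - b0)) - 8 / 5 * (g * N (b - b0)) ^+ 2) <=
     likelihood X b Y * expR (- (lam * N b))) ->
  0 < lam -> 0 < L -> 0 <= g -> 0 <= A ->
  ((A * (subset_weight (gsupp G b0) *
      (expR (- (8 / 5)) / 2 * (lam / (L + 2 * (D.+1%:R * g))) ^+ D)))%:E <=
   \int[prior G X ppi]_t (likelihood X (tcol t) Y)%:E)%E.
Proof.
move=> H lam0 L0 g0 A0; set S := gsupp G b0 in D *.
have lik0 b : 0 <= likelihood X b Y.
  apply: prodr_ge0 => i _; apply: divr_ge0; first exact: expR_ge0.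
  by apply: addr_ge0 => //; apply: sumr_ge0 => k _; exact: expR_ge0.
have mlik : measurable_fun setT (fun t : d.-tuple R => (likelihood X (tcol t) Y)%:E).
  by apply/measurable_EFinP; exact: measurable_likelihood.
rewrite ge0_integral_prior; [|exact: mlik|by move=> t; rewrite lee_fin].
rewrite (bigD1 S)//=; apply: (@le_trans _ _ ((subset_weight S)%:E *
  \int[lebesgue_tuple (dimS G S)]_t ((slab X t)%:E * (likelihood X (tcol (embedS t)) Y)%:E))%E); last first.
  rewrite leeDl// sume_ge0// => S' _; rewrite mule_ge0 ?lee_fin ?subset_weight_ge0//.
  by apply: integral_ge0 => t _; rewrite mule_ge0 ?lee_fin ?slab_ge0.
rewrite mulrCA EFinM; apply: lee_wpmul2l; first by rewrite lee_fin subset_weight_ge0.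
set Lam := L + 2 * (D.+1%:R * g); pose Lam' := L + D.+1%:R * g.
have Dg0 : 0 <= D.+1%:R * g by rewrite mulr_ge0.
have Lam0 : 0 < Lam by rewrite /Lam; lra.
have Lam'0 : 0 < Lam' by rewrite /Lam'; lra.
set I := (\int[_]_t _)%E.
set A1 := A * expR (- (8 / 5)).
have A10 : 0 <= A1 by rewrite mulr_ge0 ?expR_ge0.
set a := (lam / Lam) ^+ D.
have a0 : 0 <= a by rewrite exprn_ge0// divr_ge0// ltW.
have mE (al : R) : measurable_fun setT (fun t : (dimS G S).-tuple R =>
    (slab_const G X S * expR (- (al * norm21 G S (tcol (embedS t) - b0))))%:E).
  by apply/measurable_EFinP; exact: measurable_expRN_norm21.
have E0 (al : R) t : (0 <= (slab_const G X S * expR (- (al * norm21 G S (tcol (embedS t) - b0))))%:E)%E.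
  by rewrite lee_fin mulr_ge0 ?slab_const_ge0 ?expR_ge0.
have step : ((A1 * a)%:E <= I + (A1 * expR (- D.+1%:R) * (lam / Lam') ^+ D)%:E)%E.
  rewrite !EFinM -(integral_slab_scaled hG X S b0 Lam0) -(integral_slab_scaled hG X S b0 Lam'0).
  rewrite -EFinM -(ge0_integralZl _ measurableT (mE _)); last 2 first.
  - by move=> t _; exact: E0.
  - by rewrite lee_fin.
  rewrite -(ge0_integralZl _ measurableT (mE _)); last 2 first.
  - by move=> t _; exact: E0.
  - by rewrite lee_fin mulr_ge0 ?expR_ge0.
  have mI : measurable_fun setT (fun t : (dimS G S).-tuple R =>
      ((slab X t)%:E * (likelihood X (tcol (embedS t)) Y)%:E)%E).
    apply: emeasurable_funM; first by apply/measurable_EFinP; exact: measurable_slab.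
    by apply: (measurableT_comp mlik); exact: measurable_embedS.
  rewrite -ge0_integralD//; last 3 first.
  - by move=> t _; rewrite mule_ge0 ?lee_fin ?slab_ge0.
  - by move=> t _; rewrite mule_ge0// lee_fin mulr_ge0 ?expR_ge0.
  - exact: measurable_funeM.
  apply: ge0_le_integral => //.
  - by move=> t _; rewrite mule_ge0// lee_fin.
  - exact: measurable_funeM.
  - by apply: emeasurable_funD => //; exact: measurable_funeM.
  move=> t _; set x := norm21 G S (tcol (embedS t) - b0).
  have Nx : N (tcol (embedS t) - b0) = x.
    apply: norm21_support; apply/fintype.subsetP => j; rewrite inE; apply: contraR => jS.
    rewrite vecgroupD vecgroupN !vecgroup_notin_gsupp ?subr0//.
    by apply: contra jS => jb; exact: (fintype.subsetP (gsupp_embedS t)).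
  have := H (tcol (embedS t)); rewrite Nx => Ht.
  have := @envelope_expR_le L g x D.+1%:R (ler0n _ _) g0 (norm21_ge0 _ _ _).
  rewrite -/Lam -/Lam' => hs.
  rewrite -!EFinM -EFinD lee_fin slabE /A1.
  have sc0 := slab_const_ge0 G X S.
  have := ler_wpM2l (mulr_ge0 sc0 A0) hs.
  have := ler_wpM2l sc0 Ht.
  lra.
(* As Lam <= 2 Lam', the slower rate gains at most 2 ^ D, while exp(- (D + 1)) <= 2 ^ - (D + 1). *)
have half : expR (- D.+1%:R) * (lam / Lam') ^+ D <= a / 2 :> R.
  have e2 : expR (- D.+1%:R) <= 2^-1 ^+ D.+1 :> R.
    rewrite -mulN1r expRM_natr ler_pXn2r ?nnegrE ?expR_ge0// expRN lef_pV2 ?posrE ?expR_gt0//.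
    by have := expR_ge1Dx (1 : R); lra.
  apply: (le_trans (ler_wpM2r _ e2)).
    by rewrite exprn_ge0// divr_ge0// ltW.
  rewrite exprSr mulrAC -exprMn ler_pM2r//.
  apply: lerXn2r; rewrite ?nnegrE.
  - by rewrite mulr_ge0// divr_ge0// ltW.
  - by rewrite divr_ge0// ltW.
  - by apply: (ler_half_div lam0 Lam'0 Lam0); rewrite mulrDr lerD2r ler_peMl ?ler1n// ltW.
have : ((A1 * (a / 2))%:E + (A1 * (a / 2))%:E <= I + (A1 * (a / 2))%:E)%E.
  rewrite -EFinD -mulrDr -splitr (le_trans step)// leeD2l// lee_fin -mulrA.
  by rewrite ler_wpM2l.
rewrite leeD2rE// => h; apply: le_trans h; rewrite lee_fin /A1 -!mulrA (mulrC a).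
exact: lexx.
Qed.
End posterior_integrals.

(** * Prior weights of the models *)

Lemma leq_bin_exp p s : ('C(p, s) <= p ^ s)%N.
Proof.
have h : (p ^_ s <= p ^ s)%N.
  elim: s p => [|s IH] p; first by rewrite ffactn0.
  rewrite ffactnS expnS leq_mul2l; apply/orP; right; apply: leq_trans (IH _) _.
  by case: s {IH} => // s; rewrite leq_exp2r ?leq_pred.
by apply: leq_trans h; rewrite -bin_ffact leq_pmulr// fact_gt0.
Qed.

Section subset_sums.
Context {R : realType}.

Lemma sum_geometric_half (s0 P : nat) :
  \sum_(s < P | (s0 < s)%N) 2^-1 ^+ (s - s0) <= 1 :> R.
Proof.
suff : \sum_(s < P | (s0 < s)%N) 2^-1 ^+ (s - s0) <= 1 - 2^-1 ^+ (P.-1 - s0) :> R.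
  by move=> h; apply: le_trans h _; rewrite gerBl exprn_ge0.
elim: P => [|P IH]; first by rewrite big_ord0 sub0n subrr.
rewrite big_mkcond big_ord_recr -big_mkcond/=; case: ltnP => s0P.
  rewrite (le_trans (lerD IH (lexx _)))//.
  have -> : (P - s0 = (P.-1 - s0).+1)%N by case: P s0P {IH} => // P; rewrite ltnS => h; rewrite subSn.
  by rewrite exprS; lra.
rewrite addr0 (le_trans IH)// lerD2l lerN2 (_ : P.-1 - s0 = 0)%N; last first.
  by apply/eqP; rewrite subn_eq0 (leq_trans (leq_pred _)).
by rewrite (_ : P - s0 = 0)%N//; apply/eqP.
Qed.

(** The uniform choice within a size cancels the number of subsets of that size, and a geometric
    series over the sizes remains. *)
Lemma sum_subsets_half (p s0 : nat) :
  \sum_(S : {set 'I_p} | (s0 < #|S|)%N) 'C(p, #|S|)%:R^-1 * 2^-1 ^+ (#|S| - s0) <= 1 :> R.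
Proof.
have cS (S : {set 'I_p}) : (#|S| < p.+1)%N by rewrite ltnS -[leqRHS]card_ord max_card.
rewrite (partition_big (fun S => Ordinal (cS S)) (fun s => s0 < s)%N)//=.
apply: le_trans (sum_geometric_half s0 p.+1); apply: ler_sum => s s0s.
rewrite (eq_bigr (fun=> 'C(p, s)%:R^-1 * 2^-1 ^+ (s - s0))); last first.
  by move=> S /andP[_ /eqP <-].
rewrite (eq_bigl (mem [set S : {set 'I_p} | #|S| == s]%SET)); last first.
  move=> S; rewrite !inE -val_eqE/=; apply/andP/idP => [[]//|h].
  by rewrite h (eqP h).
rewrite sumr_const card_draws card_ord -[leLHS]mulr_natr [leLHS]mulrC mulrA divff ?mul1r//.
by rewrite pnatr_eq0 -lt0n bin_gt0 -ltnS.
Qed.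
End subset_sums.

Section prior_weights.
Context {R : realType} {d p : nat} (n : nat) (G : 'I_p -> {set 'I_d}).
Variables (ppi : dim_pmf R p) (A1 A2 A3 A4 : R).
Hypotheses (p0 : (0 < p)%N) (n0 : (0 < n)%N).
Hypotheses (A10 : 0 < A1) (A20 : 0 < A2) (A40 : 0 < A4).
Hypothesis hdecay : dim_pmf_decay (n := n) G ppi A1 A2 A3 A4.
Local Notation r := (rate (R := R) (n := n) G).

Lemma pn_max_gt0 : 0 < pn_max (R := R) (n := n) G.
Proof. by rewrite ltr0n leq_max p0. Qed.

Lemma ln_pn_max : ln (pn_max (R := R) (n := n) G) = r.
Proof.
have e : (gbar G)%:R * ln n%:R = ln (n ^ gbar G)%:R :> R.
  by rewrite natrX lnXn ?ltr0n// mulr_natl.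
rewrite /pn_max /rate /maxn e; case: ltnP => h.
  by rewrite max_r// ler_ln ?posrE ?ltr0n ?expn_gt0 ?n0// ler_nat ltnW.
by rewrite max_l// ler_ln ?posrE ?ltr0n ?expn_gt0 ?n0// ler_nat.
Qed.

Lemma pn_max_powR x : pn_max (R := R) (n := n) G `^ x = expR (x * r).
Proof. by rewrite /powR gt_eqF ?pn_max_gt0// ln_pn_max. Qed.

Lemma dim_pmf_step s : (s < p)%N ->
  0 < ppi s /\ 0 < ppi s.+1 /\ ppi s.+1 <= ppi s * (A2 * expR (- (A4 * r))).
Proof.
move=> sp; have := hdecay (s := s.+1); rewrite /= sp => /(_ isT)/andP[].
rewrite !pn_max_powR => h1 h2.
(* The lower bound on the ratio forces both weights to be positive, since a quotient by 0 would be
   0. *)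
have q0 : 0 < ppi s.+1 / ppi s by apply: lt_le_trans h1; rewrite divr_gt0 ?expR_gt0.
have s0 : 0 < ppi s.
  rewrite lt_neqAle dim_pmf_ge0 andbT eq_sym; apply/eqP => e.
  by move: q0; rewrite e invr0 mulr0 ltxx.
split => //; split; first by move: q0; rewrite pmulr_lgt0// invr_gt0.
by move: h2; rewrite ler_pdivrMr// expRN mulrC.
Qed.

Lemma dim_pmf_gt0 s : (s <= p)%N -> 0 < ppi s.
Proof.
rewrite leq_eqVlt => /predU1P[->|/dim_pmf_step[]//].
have : (p.-1 < p)%N by rewrite prednK.
by move=> /dim_pmf_step[_ []]; rewrite prednK.
Qed.

Lemma dim_pmf_le s k : (s + k <= p)%N ->
  ppi (s + k)%N <= ppi s * (A2 * expR (- (A4 * r))) ^+ k.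
Proof.
elim: k => [|k IH] h; first by rewrite addn0 expr0 mulr1.
have q0 : 0 <= A2 * expR (- (A4 * r)) by rewrite mulr_ge0 ?expR_ge0// ltW.
rewrite addnS in h *; have [_ [_ hs]] := dim_pmf_step h.
by apply: le_trans hs _; rewrite exprSr [leRHS]mulrA ler_wpM2r// IH// ltnW.
Qed.

Hypothesis hG : group_partition G.

Lemma dimS_le (S : {set 'I_p}) : (dimS G S <= #|S| * gbar G)%N.
Proof.
rewrite /dimS -sum_nat_const; apply: leq_sum => j _.
exact: (leq_bigmax (F := gsize G)).
Qed.

Lemma subset_weight_ge (S : {set 'I_p}) :
  ppi #|S| * expR (- (#|S|%:R * r)) <= subset_weight ppi S.
Proof.
have Sp : (#|S| <= p)%N by rewrite -[leqRHS]card_ord max_card.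
rewrite /subset_weight ler_pM2l ?dim_pmf_gt0// expRN lef_pV2 ?posrE ?expR_gt0 ?ltr0n ?bin_gt0//.
apply: (@le_trans _ _ (p%:R ^+ #|S|)); first by rewrite -natrX ler_nat leq_bin_exp.
rewrite expRM_natl lerXn2r ?nnegrE ?expR_ge0// -[leLHS](lnK (x := p%:R)) ?posrE ?ltr0n//.
by rewrite ler_expR /rate le_max lexx.
Qed.

(** The price of one more group, including 16 ^ gbar, is split in three: 1/2 makes the sum over the
    sizes converge, [eta] is needed once and at least one group is added, and exp(- rho) accumulates
    to exp(- rho (K - s0)). *)
Lemma sum_large_subsets (s0 : nat) (K eta rho : R) :
  0 <= eta -> eta <= 1 -> 0 <= rho -> s0%:R <= K -> (s0 <= p)%N ->
  A2 * expR (- (A4 * r)) * 16 ^+ gbar G <= 2^-1 * eta * expR (- rho) ->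
  \sum_(S : {set 'I_p} | K < #|S|%:R) subset_weight ppi S * 16 ^+ dimS G S <=
  ppi s0 * 16 ^+ (s0 * gbar G) * eta * expR (- (rho * (K - s0%:R))).
Proof.
move=> eta0 eta1 rho0 s0K s0p hq.
set Q := ppi s0 * _ * _ * _.
have Q0 : 0 <= Q by rewrite !mulr_ge0 ?expR_ge0 ?dim_pmf_ge0 ?exprn_ge0.
rewrite -[leRHS]mulr1 (le_trans _ (ler_wpM2l Q0 (@sum_subsets_half R p s0)))// mulr_sumr.
rewrite [leLHS]big_mkcond [leRHS]big_mkcond/=; apply: ler_sum => S _.
have [KS|KS] := ltP K #|S|%:R; last first.
  case: ifP => [_|_]; last exact: lexx.
  by apply: mulr_ge0 => //; apply: mulr_ge0; rewrite ?invr_ge0 ?exprn_ge0.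
have s0S : (s0 < #|S|)%N by rewrite -(ltr_nat R) (le_lt_trans s0K).
rewrite s0S; set k := (#|S| - s0)%N.
have SE : #|S| = (s0 + k)%N by rewrite subnKC// ltnW.
have Sp : (#|S| <= p)%N by rewrite -[leqRHS]card_ord max_card.
have k0 : (0 < k)%N by rewrite subn_gt0.
have C0 : 0 <= 'C(p, #|S|)%:R^-1 :> R by rewrite invr_ge0.
suff key : ppi #|S| * 16 ^+ dimS G S <= Q * 2^-1 ^+ k.
  by rewrite /subset_weight mulrAC [leRHS]mulrCA mulrC ler_wpM2l.
apply: (@le_trans _ _ (ppi s0 * 16 ^+ (s0 * gbar G) * (2^-1 * eta * expR (- rho)) ^+ k)).
  apply: (@le_trans _ _ ((ppi s0 * (A2 * expR (- (A4 * r))) ^+ k) *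
      (16 ^+ (s0 * gbar G) * (16 ^+ gbar G) ^+ k))).
    apply: ler_pM; rewrite ?dim_pmf_ge0 ?exprn_ge0//.
      by rewrite SE; apply: dim_pmf_le; rewrite -SE.
    by rewrite -exprM -exprD ler_weXn2l ?ler1n// (leq_trans (dimS_le S))// SE mulnDl [(k * _)%N]mulnC.
  rewrite mulrACA -exprMn ler_wpM2l ?mulr_ge0 ?dim_pmf_ge0 ?exprn_ge0//.
  by rewrite lerXn2r// nnegrE ?mulr_ge0 ?invr_ge0 ?expR_ge0 ?exprn_ge0// ltW.
rewrite !exprMn /Q -!mulrA; apply: ler_wpM2l; first exact: dim_pmf_ge0.
apply: ler_wpM2l; first by rewrite exprn_ge0.
rewrite mulrC -!mulrA; apply: ler_pM; rewrite ?exprn_ge0 ?mulr_ge0 ?expR_ge0 ?invr_ge0 ?exprn_ge0//.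
  by rewrite -[leRHS]expr1 ler_wiXn2l.
rewrite ler_wpM2r ?exprn_ge0 ?invr_ge0// -expRM_natl ler_expR mulrN lerN2 [leRHS]mulrC ler_wpM2l//.
by rewrite lerBlDr addrC -natrD -SE ltW.
Qed.
End prior_weights.

Section posterior_bounds.
Context {R : realType} {m n d p : nat}.
Variables (X : 'I_n -> 'M[R]_(m.-1, d)) (G : 'I_p -> {set 'I_d}) (ppi : dim_pmf R p).
Implicit Types (B : set 'cV[R]_d) (Y : 'I_n -> 'cV[R]_(m.-1)) (a c : R).

Let lik_ge0 b Y : 0 <= likelihood X b Y.
Proof.
apply: prodr_ge0 => i _; apply: divr_ge0; first exact: expR_ge0.
by apply: addr_ge0 => //; apply: sumr_ge0 => k _; exact: expR_ge0.
Qed.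

(* an infinite denominator is harmless: [fine +oo = 0] and [x / 0 = 0] *)
Lemma posterior_le Y B a c : 0 <= a -> 0 < c ->
  (\int[prior G X ppi]_(t in @tcol R d @^-1` B) (likelihood X (tcol t) Y)%:E <= a%:E)%E ->
  (c%:E <= \int[prior G X ppi]_t (likelihood X (tcol t) Y)%:E)%E ->
  posterior G X ppi Y B <= a / c.
Proof.
move=> a0 c0; rewrite /posterior /Rintegral.
have : (0 <= \int[prior G X ppi]_(t in @tcol R d @^-1` B) (likelihood X (tcol t) Y)%:E)%E.
  by apply: integral_ge0 => t _; rewrite lee_fin.
case: (\int[_]_(t in _ @^-1` _) _)%E => // x; rewrite !lee_fin => x0 xa.
case: (\int[_]_t _)%E => [y| |//]; last by move=> _; rewrite /= invr0 mulr0 divr_ge0// ltW.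
by rewrite /= lee_fin => cy; apply: ler_pM;
  rewrite ?invr_ge0 ?lef_pV2 ?posrE ?(lt_le_trans c0 cy)// ltW// (lt_le_trans c0 cy).
Qed.

Lemma posterior_ge0 Y B : 0 <= posterior G X ppi Y B.
Proof. by rewrite /posterior divr_ge0// Rintegral_ge0. Qed.

Lemma posterior_gsupp_le1 Y (K : R) :
  posterior G X ppi Y [set b | K < #|gsupp G b|%:R] <= 1.
Proof.
rewrite /posterior /Rintegral.
have mD : measurable (@tcol R d @^-1` [set b | K < #|gsupp G b|%:R]) by exact: measurable_gsupp.
have mlik : measurable_fun setT (fun t : d.-tuple R => (likelihood X (tcol t) Y)%:E).
  by apply/measurable_EFinP; exact: measurable_likelihood.
have : (\int[prior G X ppi]_(t in @tcol R d @^-1` [set b | (K < #|gsupp G b|%:R)%R])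
    (likelihood X (tcol t) Y)%:E <= \int[prior G X ppi]_t (likelihood X (tcol t) Y)%:E)%E.
  by apply: ge0_subset_integral => // t _; rewrite lee_fin.
have : (0 <= \int[prior G X ppi]_(t in @tcol R d @^-1` [set b | (K < #|gsupp G b|%:R)%R])
    (likelihood X (tcol t) Y)%:E)%E.
  by apply: integral_ge0 => t _; rewrite lee_fin.
case: (\int[_]_(t in _ @^-1` _) _)%E => [x| |//] x0; case: (\int[_]_t _)%E => [y| |]//=.
- rewrite !lee_fin in x0 * => xy; have [->|y0] := eqVneq y 0; first by rewrite invr0 mulr0.
  by rewrite ler_pdivrMr ?mul1r// lt_neqAle eq_sym y0 (le_trans x0).
- by rewrite invr0 mulr0.
Qed.
End posterior_bounds.

(* [96 E r] comes from the likelihood, and one [s r] each from the weight of the true support,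
   from its slab and from the factor [16 ^ dimS] *)
Lemma contraction_exponent_le (R : realFieldType) (A r E K s : R) :
  0 < A -> 0 < r -> 0 <= s -> s <= E -> s + 3 / A * (s + 33 * E) <= K ->
  96 * E * r - 99 / 100 * A * r * (K - s) <= 3 * - (s * r).
Proof.
move=> A0 r0 s0 sE sK.
have h1 : 3 * (s + 33 * E) <= A * (K - s).
  rewrite [leRHS]mulrC -ler_pdivrMr// lerBrDl (le_trans _ sK)// lerD2l.
  by rewrite mulrAC.
have h2 : r * (3 * (s + 33 * E)) <= r * (A * (K - s)) by rewrite ler_pM2l.
have h3 : r * s <= r * E by rewrite ler_pM2l.
have h4 : 0 <= r * s by rewrite mulr_ge0// ltW.
lra.
Qed.

(** * Posterior of the large models on the event of a small score *)

Section posterior_dimension.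
Context {R : realType} {m n d p : nat}.
Hypothesis m0 : (0 < m)%N.
Variables (X : 'I_n -> 'M[R]_(m.-1, d)) (b0 : 'cV[R]_d) (G : 'I_p -> {set 'I_d}).
Variables (ppi : dim_pmf R p) (A1 A2 A3 A4 : R).
Hypothesis hG : group_partition G.
Hypothesis g0 : 0 < gnorm G (stackX X).
Hypotheses (p0 : (0 < p)%N) (n16 : (16 <= n)%N).
Hypotheses (A10 : 0 < A1) (A20 : 0 < A2) (A40 : 0 < A4).
Hypothesis hdecay : dim_pmf_decay (n := n) G ppi A1 A2 A3 A4.
Local Notation g := (gnorm G (stackX X)).
Local Notation r := (rate (R := R) (n := n) G).
Local Notation h := (g * Num.sqrt r).
Local Notation N := (norm21 G [set: 'I_p]%SET).
Local Notation lik b z := (likelihood X b (response z)).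
Local Notation S0 := (gsupp G b0).

Lemma gbar_gt0 : (0 < gbar G)%N.
Proof. exact: leq_trans (gsize_gt0 hG (Ordinal p0)) (gsize_le_gbar _ _). Qed.

Lemma rate_ge_gbar : (gbar G)%:R * ln n%:R <= r.
Proof. by rewrite /rate le_max lexx orbT. Qed.

Lemma ln_ge1 : 1 <= ln n%:R :> R.
Proof.
have e : expR 1 <= n%:R :> R.
  apply: (@le_trans _ _ 4%:R); last by rewrite ler_nat (leq_trans _ n16).
  rewrite [X in expR X](splitr 1) expRD.
  have : expR (1 / 2) <= 2 :> R.
    rewrite [leRHS](_ : 2 = (1 - 1 / 2)^-1); last by field.
    by apply: expR_le_inv1B; lra.
  have := expR_ge0 (1 / 2 : R); nra.
by rewrite -[leLHS]expRK ler_ln ?posrE ?expR_gt0// ltr0n (leq_trans _ n16).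
Qed.

Lemma rate_ge_ln : ln n%:R <= r.
Proof.
apply: le_trans rate_ge_gbar; rewrite ler_peMl ?ler1n ?gbar_gt0//.
by apply: le_trans ln_ge1.
Qed.

Lemma rate_ge1 : 1 <= r.
Proof. exact: le_trans ln_ge1 rate_ge_ln. Qed.

Lemma exp_gbar_le k : (n%:R : R) ^+ (k * gbar G) <= expR (k%:R * r).
Proof.
rewrite -[n%:R in leLHS]lnK ?posrE ?ltr0n ?(leq_trans _ n16)// -expRM_natl ler_expR natrM -mulrA.
by rewrite ler_wpM2l// rate_ge_gbar.
Qed.

Lemma lambdaE : lambda G X = 8 * h.
Proof. by rewrite /lambda mulrA. Qed.

(** The linear loss 11 h is 8 h from the penalty, by the triangle inequality, and 3 h from the
    score. *)
Lemma likelihood_lower b z : score_small X b0 G (3 * h) z ->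
  lik b0 z * expR (- (lambda G X * N b0)) *
    expR (- (11 * h * N (b - b0)) - 8 / 5 * (g * N (b - b0)) ^+ 2) <=
  lik b z * expR (- (lambda G X * N b)).
Proof.
rewrite lambdaE => /forallP hz; set c := b - b0.
apply: le_trans (ler_wpM2r (expR_ge0 _) (likelihood_ge m0 X b0 b z)).
rewrite -!mulrA -!expRD ler_pM2l ?likelihood_gt0// ler_expR -/c.
have sc : - (3 * h * N c) <= centered X b0 (fun i => X i *m c) z.
  have := score_le m0 hG c hz; rewrite ler_norml => /andP[+ _]; exact.
have q : \sum_i l2norm (X i *m c) ^+ 2 <= (g * N c) ^+ 2.
  rewrite -l2norm_stackX lerXn2r ?nnegrE ?l2norm_ge0 ?mulr_ge0 ?gnorm_ge0 ?norm21_ge0//.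
  exact: l2norm_mulmx_norm21.
have hh0 : 0 <= h by rewrite mulr_ge0 ?gnorm_ge0 ?sqrtr_ge0.
have Nb : N b <= N b0 + N c by rewrite -[b in leLHS](subrKC b0); exact: ler_norm21D.
have := ler_wpM2l hh0 Nb.
move: (N c) (N b) (N b0) (centered _ _ _ _) (\sum_i l2norm _ ^+ 2) sc q Nb => *; lra.
Qed.

(** The slab of the true model thus loses at most n ^ - dim, which is at least exp(- s0 r) by the
    definition of the rate. *)
Lemma lambda_ratio_ge k : (k.+2 <= n)%N ->
  n%:R^-1 <= lambda G X / (11 * h + 2 * (k.+1%:R * g)).
Proof.
move=> kn; rewrite lambdaE.
have s1 : 1 <= Num.sqrt r by rewrite -[leLHS]sqrtr1 ler_wsqrtr// rate_ge1.
have gh : g <= h by rewrite ler_peMr// ltW.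
have kg : k.+1%:R * g <= k.+1%:R * h by rewrite ler_wpM2l.
have hh0 : 0 < h by exact: lt_le_trans gh.
have kg0 : 0 <= k.+1%:R * g by rewrite mulr_ge0// ltW.
have n0 : 0 < n%:R :> R by rewrite ltr0n (leq_trans _ n16).
rewrite -div1r ler_pdivrMr// mulrAC ler_pdivlMr; last by lra.
have kn' : (k.+1%:R : R) <= n%:R by rewrite ler_nat ltnW.
have n16' : (16%:R : R) <= n%:R by rewrite ler_nat.
move: (k.+1%:R : R) (n%:R : R) kn' n16' kg kg0 n0 => K M ? ? ? ? ?.
have : K * h <= M * h by rewrite ler_pM2r.
have : 16 * h <= M * h by rewrite ler_pM2r.
lra.
Qed.

(** In the quotient of the two preceding bounds, the likelihood and the penalty of [b0] cancel. The
    factor 2 exp(8/5) is the inverse of the fraction of the evidence kept in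
    [posterior_denominator_ge]. *)
Lemma posterior_gsupp_le z (E K eta : R) :
  score_small X b0 G (3 * h) z ->
  (forall b, lik b z * expR (- (lambda G X * N b)) <=
    lik b0 z * expR (- (lambda G X * N b0)) * expR (96 * E * r) *
    expR (- (lambda G X / 16 * N (b - b0)))) ->
  #|S0|%:R <= E -> #|S0|%:R + 3 / A4 * (#|S0|%:R + 33 * E) <= K ->
  ((dimS G S0).+2 <= n)%N -> 0 <= eta -> eta <= 1 ->
  A2 * expR (- (A4 * r)) * 16 ^+ gbar G <= 2^-1 * eta * expR (- (99 / 100 * A4 * r)) ->
  posterior G X ppi (response z) [set b | K < #|gsupp G b|%:R] <= 2 * expR (8 / 5) * eta.
Proof.
move=> hz Hpen sE sK hD eta0 eta1 hq.
set s0 := #|S0| in sE sK *; set D := dimS G S0 in hD *.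
have r1 := rate_ge1; have r0 : 0 < r by exact: lt_le_trans r1.
have hh0 : 0 < h by rewrite mulr_gt0 ?sqrtr_gt0.
have lam0 : 0 < lambda G X by rewrite lambdaE mulr_gt0.
have Sp : (s0 <= p)%N by rewrite -[leqRHS]card_ord max_card.
have n0 : (0 < n)%N by rewrite (leq_trans _ n16).
have pi0 : 0 < ppi s0 by exact: (dim_pmf_gt0 p0 n0 A10 hdecay).
have E0 : 0 <= E by apply: le_trans sE.
set A0 := lik b0 z * expR (- (lambda G X * N b0)).
have A00 : 0 < A0 by rewrite mulr_gt0 ?likelihood_gt0 ?expR_gt0.
have KS : s0%:R <= K.
  by apply: le_trans sK; rewrite lerDl mulr_ge0// ?divr_ge0 ?(ltW A40)// addr_ge0// mulr_ge0.
have AC0 : 0 <= A0 * expR (96 * E * r) by rewrite mulr_ge0 ?expR_ge0// ltW.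
have num := @posterior_numerator_le R m n d p X G ppi hG (response z) b0 K _ Hpen lam0 AC0.
have rho0 : 0 <= 99 / 100 * A4 * r by rewrite !mulr_ge0// ltW.
have := sum_large_subsets p0 n0 A10 A20 hdecay eta0 eta1 rho0 KS Sp hq.
set Sg := \sum_(S | _) _ in num * => hSg.
set ratio := lambda G X / (11 * h + 2 * (D.+1%:R * g)).
have den := @posterior_denominator_ge R m n d p X G ppi hG (response z) b0 (11 * h) g A0.
rewrite -/D -/ratio in den.
have h110 : 0 < 11 * h by rewrite mulr_gt0.
have {}den := den (fun b => likelihood_lower b hz) lam0 h110 (ltW g0) (ltW A00).
have w_ge := subset_weight_ge p0 n0 A10 hdecay S0; rewrite -/s0 in w_ge.
(* The evidence loses [u] twice, in the weight of the true support and in its slab, and 16 ^ (s0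
   gbar) is at most 1 / u; [contraction_exponent_le] supplies the matching u ^ 3. *)
set u := expR (- (s0%:R * r)) in w_ge.
have u0 : 0 < u by exact: expR_gt0.
have T_le : 16 ^+ (s0 * gbar G) <= u^-1 :> R.
  rewrite /u expRN invrK; apply: le_trans (exp_gbar_le s0).
  by apply: lerXn2r; rewrite ?nnegrE// ler_nat.
have ratio_ge : u <= ratio ^+ D.
  apply: (@le_trans _ _ (n%:R^-1 ^+ D)); last first.
    apply: lerXn2r; rewrite ?nnegrE ?invr_ge0//; last exact: lambda_ratio_ge.
    exact: le_trans (lambda_ratio_ge hD).
  rewrite exprVn /u expRN lef_pV2 ?posrE ?expR_gt0 ?exprn_gt0 ?ltr0n//.
  apply: le_trans (exp_gbar_le s0); rewrite ler_weXn2l ?ler1n//.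
  exact: dimS_le.
set v := expR (- (8 / 5)) in den.
have v0 : 0 < v by exact: expR_gt0.
have vE : expR (8 / 5) * v = 1 by rewrite -expRD subrr expR0.
set c := A0 * _ in den.
have c_ge : A0 * (ppi s0 * u * (v / 2 * u)) <= c.
  rewrite /c ler_pM2l//; apply: ler_pM => //.
  - by rewrite mulr_ge0// ltW.
  - by rewrite mulr_ge0// ?divr_ge0// ltW.
  - by rewrite ler_pM2l// divr_gt0.
have c'0 : 0 < A0 * (ppi s0 * u * (v / 2 * u)).
  have v2 : 0 < v / 2 by rewrite divr_gt0.
  by apply: mulr_gt0 => //; apply: mulr_gt0; apply: mulr_gt0.
have Sg0 : 0 <= Sg.
  apply: sumr_ge0 => S _; apply: mulr_ge0; first exact: subset_weight_ge0.
  exact: exprn_ge0.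
have a0 : 0 <= A0 * expR (96 * E * r) * Sg by rewrite mulr_ge0.
apply: le_trans (posterior_le a0 (lt_le_trans c'0 c_ge) num den) _.
rewrite ler_pdivrMr ?(lt_le_trans c'0)//.
have c2 : 0 <= 2 * expR (8 / 5) * eta by rewrite !mulr_ge0 ?expR_ge0.
apply: le_trans (ler_wpM2l c2 c_ge).
have -> : 2 * expR (8 / 5) * eta * (A0 * (ppi s0 * u * (v / 2 * u))) =
    A0 * (ppi s0 * eta * u ^+ 2) * (expR (8 / 5) * v) by field.
rewrite vE mulr1 -[X in X <= _]mulrA ler_pM2l//.
set ex := expR (- (99 / 100 * A4 * r * (K - s0%:R))) in hSg.
have final : expR (96 * E * r) * ex <= u ^+ 3.
  rewrite /ex /u -expRD -expRM_natl ler_expR.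
  exact: contraction_exponent_le.
have F0 : 0 <= expR (96 * E * r) by exact: expR_ge0.
apply: le_trans (ler_wpM2l F0 hSg) _.
have reorder (F q T e x : R) : F * (q * T * e * x) = q * e * (T * (F * x)) by ring.
rewrite reorder.
apply: ler_wpM2l; first by rewrite mulr_ge0// ltW.
have ex0 : 0 <= expR (96 * E * r) * ex by rewrite mulr_ge0 ?expR_ge0.
apply: le_trans (ler_pM _ ex0 T_le final) _; first by rewrite exprn_ge0.
by rewrite exprS mulrA mulVf ?mul1r// gt_eqF.
Qed.
End posterior_dimension.

Lemma cvg_expRN_ln (R : realType) (a : R) : 0 < a ->
  expR (- (a * ln n%:R)) @[n --> \oo] --> (0 : R).
Proof.
move=> a0; apply: (@cvg_comp _ _ _ (fun n : nat => a * ln n%:R) (fun x : R => expR (- x)));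
  last exact: cvgr_expR.
apply/cvgryPge => A; near=> n.
rewrite mulrC -ler_pdivrMr// -[leLHS]expRK.
have An : expR (A / a) <= n%:R.
  by apply: ltW; apply: lt_le_trans (truncnS_gt _) _; rewrite ler_nat; near: n; exact: nbhs_infty_ge.
by rewrite ler_ln ?posrE ?expR_gt0// (lt_le_trans (expR_gt0 _) An).
Unshelve. all: by end_near. Qed.

(** * Uniform bound over [Bset] and passage to the limit *)

Section contraction.
Context {R : realType} {m n d p : nat}.
Hypothesis m0 : (0 < m)%N.
Variables (X : 'I_n -> 'M[R]_(m.-1, d)) (G : 'I_p -> {set 'I_d}).
Variables (ppi : dim_pmf R p) (A1 A2 A3 A4 : R).
Hypothesis hG : group_partition G.
Hypothesis hX : stackX X != 0.
Hypothesis n16 : (16 <= n)%N.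
Hypotheses (A10 : 0 < A1) (A20 : 0 < A2) (A40 : 0 < A4).
Hypothesis hdecay : dim_pmf_decay (n := n) G ppi A1 A2 A3 A4.
Local Notation g := (gnorm G (stackX X)).
Local Notation r := (rate (R := R) (n := n) G).
Local Notation h := (g * Num.sqrt r).
Local Notation lik b z := (likelihood X b (response z)).
Local Notation eta := (expR (- (A4 / 200 * ln n%:R)) : R).
Local Notation tail := (Num.sqrt (5 : R) * expR (- (8^-1 * ln n%:R))).

Let g0 : 0 < g. Proof. exact: gnorm_gt0. Qed.

Let p0 : (0 < p)%N.
Proof.
rewrite lt0n; apply/eqP => p00.
have h (k : nat) : (k < p)%N -> False by rewrite p00.
suff : g <= 0 by rewrite leNgt g0.
by apply: bigmax_le => // j _; case: (h _ (ltn_ord j)).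
Qed.

Let n0 : (0 < n)%N. Proof. exact: leq_trans n16. Qed.
Let r1 : 1 <= r. Proof. exact: (rate_ge1 hG p0 n16). Qed.
Let r0 : 0 < r. Proof. exact: lt_le_trans r1. Qed.
Let h0 : 0 < h. Proof. by rewrite mulr_gt0// sqrtr_gt0. Qed.
Let ln0 : 0 <= ln n%:R :> R. Proof. by apply: le_trans (ln_ge1 n16). Qed.

(** The exponent 9 r / 8 splits into r, which pays for the p groups, and r / 8 >= gbar ln(n) / 8,
    which beats the factor sqrt(5) ^ gbar. *)
Lemma score_tail_le b0 : tail <= 1 ->
  \sum_(z | ~~ score_small X b0 G (3 * h) z) lik b0 z <= tail.
Proof.
move=> t1; have hh0 : 0 <= 3 * h by rewrite mulr_ge0// ltW.
apply: le_trans (score_tail m0 b0 hh0 g0) _.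
have -> : (3 * h) ^+ 2 / (8 * g ^+ 2) = r + 8^-1 * r.
  rewrite !exprMn sqr_sqrtr; last exact: ltW.
  by field; rewrite gt_eqF.
have pr : p%:R * expR (- r) <= 1 :> R.
  rewrite expRN ler_pdivrMr ?expR_gt0// mul1r -[leLHS](lnK (x := p%:R)) ?posrE ?ltr0n//.
  by rewrite ler_expR /rate le_max lexx.
have er : expR (- (8^-1 * r)) <= expR (- (8^-1 * ln n%:R)) ^+ gbar G.
  rewrite -expRM_natl ler_expR mulrN lerN2 mulrCA ler_pM2l ?invr_gt0//.
  exact: rate_ge_gbar.
have gb0 := gbar_gt0 hG p0.
apply: (@le_trans _ _ (1 * (Num.sqrt 5 ^+ gbar G * expR (- (8^-1 * ln n%:R)) ^+ gbar G))).
  rewrite opprD expRD mulrACA; apply: ler_pM; last 2 first.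
  - exact: pr.
  - by apply: ler_wpM2l; first by rewrite exprn_ge0 ?sqrtr_ge0.
  - by rewrite mulr_ge0 ?expR_ge0.
  - by rewrite mulr_ge0 ?exprn_ge0 ?sqrtr_ge0 ?expR_ge0.
by rewrite mul1r -exprMn -[leRHS]expr1 ler_wiXn2l// ?mulr_ge0 ?sqrtr_ge0 ?expR_ge0.
Qed.

(** The reserved A4 r / 100 yields eta ^ (2 gbar), since r >= gbar ln n. One half of it absorbs 16 ^
    gbar and [A2], the other half leaves the factor [eta]. *)
Lemma decay_factor_le : 32 * (A2 + 1) * eta <= 1 ->
  A2 * expR (- (A4 * r)) * 16 ^+ gbar G <= 2^-1 * eta * expR (- (99 / 100 * A4 * r)).
Proof.
move=> he; have eta0 : 0 < eta by exact: expR_gt0.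
have gb0 := gbar_gt0 hG p0.
have -> : - (A4 * r) = - (99 / 100 * A4 * r) - 100^-1 * A4 * r by field.
rewrite expRD; set v := expR (- (99 / 100 * A4 * r)); set w := expR _.
have w_le : w * 16 ^+ gbar G <= 16 * eta * eta.
  apply: (@le_trans _ _ ((16 * eta) ^+ gbar G * eta ^+ gbar G)).
    rewrite exprMn -[leRHS]mulrA [leLHS]mulrC; apply: ler_wpM2l; first exact: exprn_ge0.
    rewrite -exprD -expRM_natl ler_expR natrD.
    have := ler_wpM2l (ltW A40) (@rate_ge_gbar R n d p G).
    lra.
  have e16 : 16 * eta <= 1.
    by apply: le_trans he; rewrite ler_pM2r//; have := A20; lra.
  have e1 : eta <= 1 by lra.
  apply: ler_pM; rewrite ?exprn_ge0 ?mulr_ge0 ?(ltW eta0)//.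
  - by rewrite -[leRHS]expr1 ler_wiXn2l ?mulr_ge0 ?(ltW eta0).
  - by rewrite -[leRHS]expr1 ler_wiXn2l ?(ltW eta0).
have v0 : 0 < v by exact: expR_gt0.
have reorder (x y z q : R) : x * (y * z) * q = x * (z * q) * y by ring.
rewrite reorder ler_pM2r//.
apply: le_trans (ler_wpM2l (ltW A20) w_le) _.
have : 32 * A2 * eta <= 1 by apply: le_trans he; rewrite ler_pM2r//; have := A20; lra.
by move=> /(ler_wpM2r (ltW eta0)); lra.
Qed.

Lemma expect_posterior_le b0 (E K : R) :
  tail <= 1 -> 32 * (A2 + 1) * eta <= 1 ->
  (forall c, norm21 G (~: gsupp G b0)%SET c <= 7 * norm21 G (gsupp G b0) c ->
    0 < norm21 G [set: 'I_p]%SET c -> exists a : R, [/\ 0 < a,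
      a * norm21 G [set: 'I_p]%SET c ^+ 2 <= logit_var X b0 c,
      20 * (gnorm_max G X * h) <= 10^-1 * (10^-1 * 10^-1) * a & h ^+ 2 / a <= E * r]) ->
  #|gsupp G b0|%:R <= E ->
  #|gsupp G b0|%:R + 3 / A4 * (#|gsupp G b0|%:R + 33 * E) <= K ->
  ((dimS G (gsupp G b0)).+2 <= n)%N ->
  expect X b0 (V := R^o) (fun z =>
    posterior G X ppi (response z) [set b | K < #|gsupp G b|%:R]) <=
  tail + 2 * expR (8 / 5) * eta.
Proof.
move=> t1 e1 H sE sK hD.
have E0 : 0 <= E by apply: le_trans sE.
have eta0 : 0 <= eta by exact: expR_ge0.
have eta1 : eta <= 1.
  by rewrite -[leRHS]expR0 ler_expR oppr_le0 mulr_ge0// divr_ge0// ltW.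
(* Where the score is large, the posterior probability is bounded by 1. *)
rewrite /expect (bigID (score_small X b0 G (3 * h)))/= addrC; apply: lerD.
  apply: le_trans (score_tail_le b0 t1); apply: ler_sum => z _.
  rewrite -[leRHS]mulr1; apply: ler_wpM2l; first exact: likelihood_ge0.
  exact: posterior_gsupp_le1.
set U := 2 * expR (8 / 5) * eta.
have U0 : 0 <= U by rewrite !mulr_ge0 ?expR_ge0.
apply: (@le_trans _ _ (\sum_z lik b0 z * U)); last by rewrite -mulr_suml expect_1// mul1r.
rewrite [leRHS](bigID (score_small X b0 G (3 * h)))/= ler_wpDr//.
  by apply: sumr_ge0 => z _; rewrite mulr_ge0// likelihood_ge0.
apply: ler_sum => z hz; apply: ler_wpM2l; first exact: likelihood_ge0.
apply: (posterior_gsupp_le m0 hG g0 p0 n16 A10 A20 A40 hdecay hz _ sE sK hD eta0 eta1).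
  move=> b; have k0 : 0 < 10^-1 * (10^-1 * 10^-1) :> R by rewrite !mulr_gt0 ?invr_gt0.
  have C0 : 0 <= 96 * E * r by rewrite !mulr_ge0// ltW.
  have := penalized_likelihood_le m0 hG (b := b) k0 (lexx _) h0 C0 hz.
  move=> /(_ _)/wrap[].
    move=> cone Nc; have [a [a0 av aB aE]] := H _ cone Nc.
    by exists a; split => //; rewrite -mulrA ler_pM2l.
  by rewrite lambdaE (_ : 8 * h / 16 = h / 2)//; field.
exact: decay_factor_le.
Qed.
(* a product of inverses, since the numeral [1000] stands for a unary [nat] *)
Let tau : R := 10^-1 * (10^-1 * 10^-1).

Let tau0 : 0 < tau. Proof. by rewrite !mulr_gt0 ?invr_gt0. Qed.

(** As phi <= 1 and |X| <= sqrt(n) max_i |X_i|, membership in [Bset] bounds s0 sqrt r by a small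
    multiple of sqrt n. Then dim S0 <= s0 gbar <= s0 r <= s0^2 r <= n / 2. *)
Lemma dimS_gsupp_lt b0 : Bset G X (tau / 20) b0 -> ((dimS G (gsupp G b0)).+2 <= n)%N.
Proof.
set S := gsupp G b0; rewrite /Bset/= -/S -/(gnorm_max G X) => hB.
have [S00|S0] := eqVneq S finset.set0.
  by rewrite S00 /dimS big_set0 (leq_trans _ n16).
have [phi [phiE phi0 phi1]] := compat_finite m0 b0 hG g0 S0.
have s1 : 1 <= #|S|%:R :> R by rewrite ler1n card_gt0.
have B0 := gnorm_max_ge0 G X.
rewrite phiE -!EFinM lee_fin -expr2 in hB.
have gB := @gnorm_stackX_le R d p G m n X.
have B1 : 0 < gnorm_max G X.
  rewrite lt_neqAle B0 andbT; apply/eqP => Bz.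
  by move: gB; rewrite -Bz mulr0 leNgt g0.
have sn0 : 0 <= Num.sqrt n%:R :> R by exact: sqrtr_ge0.
have sr0 : 0 <= Num.sqrt r by exact: sqrtr_ge0.
have h1 : #|S|%:R * Num.sqrt r <= tau / 20 * Num.sqrt n%:R.
  rewrite -(ler_pM2r B1); apply: le_trans hB _.
  have t20 : 0 <= tau / 20 by rewrite divr_ge0// ltW.
  apply: (@le_trans _ _ (tau / 20 * g)).
    rewrite ler_pM2r// ler_piMr//; exact: exprn_ile1.
  by rewrite -[leRHS]mulrA ler_wpM2l.
have h2 : #|S|%:R ^+ 2 * r <= (tau / 20) ^+ 2 * n%:R.
  rewrite -[r in leLHS](sqr_sqrtr (ltW r0)) -[n%:R in leRHS](sqr_sqrtr (ler0n R n)).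
  rewrite -[leLHS]exprMn -[leRHS]exprMn.
  by apply: lerXn2r => //; rewrite nnegrE mulr_ge0// divr_ge0// ltW.
have D1 : (dimS G S)%:R <= #|S|%:R * r.
  apply: (@le_trans _ _ (#|S|%:R * (gbar G)%:R)); first by rewrite -natrM ler_nat; exact: dimS_le.
  rewrite ler_wpM2l//; apply: le_trans (@rate_ge_gbar R n d p G).
  by rewrite ler_peMr// ln_ge1.
have D2 : #|S|%:R * r <= #|S|%:R ^+ 2 * r by rewrite ler_pM2r// expr2 ler_peMl.
have t2 : (tau / 20) ^+ 2 <= 2^-1.
  have t1 : tau / 20 <= 2^-1 by rewrite /tau; lra.
  have t20 : 0 <= tau / 20 by rewrite divr_ge0// ltW.
  by move: (tau / 20) t1 t20 => t ? ?; nra.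
have n16' : (16%:R : R) <= n%:R by rewrite ler_nat.
have D3 : (dimS G S)%:R <= 2^-1 * n%:R :> R.
  apply: le_trans D1 _; apply: le_trans D2 _; apply: le_trans h2 _.
  by rewrite ler_wpM2r.
rewrite -(ler_nat R) -addn2 natrD.
move: ((dimS G S)%:R : R) (n%:R : R) n16' D3 => D N ? ?; lra.
Qed.

(** The curvature is a = (phi |X|)^2 / s0. Multiplied by 20 |X|, the condition that defines [Bset]
    is exactly the third conclusion, which fixes the radius [tau / 20]. *)
Lemma Bset_curvature b0 (phi : R) c (S := gsupp G b0) :
  Bset G X (tau / 20) b0 -> S != finset.set0 ->
  compat G X b0 S = phi%:E -> 0 < phi ->
  norm21 G (~: S)%SET c <= 7 * norm21 G S c -> 0 < norm21 G [set: 'I_p]%SET c ->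
  exists a : R, [/\ 0 < a, a * norm21 G [set: 'I_p]%SET c ^+ 2 <= logit_var X b0 c,
    20 * (gnorm_max G X * h) <= tau * a & h ^+ 2 / a <= #|S|%:R / phi ^+ 2 * r].
Proof.
rewrite /Bset/= -/S -/(gnorm_max G X) => hB S0 phiE phi0 cone Nc.
have s0 : 0 < #|S|%:R :> R by rewrite ltr0n card_gt0.
rewrite phiE -!EFinM lee_fin -expr2 in hB.
exists ((phi * g) ^+ 2 / #|S|%:R); split.
- by rewrite divr_gt0// exprn_gt0// mulr_gt0.
- have := @compat_logit_var R m n d p m0 X b0 G g0 S phi c (ltW phi0).
  rewrite phiE lexx => /(_ isT cone Nc) hV.
  by rewrite [leLHS]mulrAC ler_pdivrMr// -exprMn [leRHS]mulrC.
- rewrite [leRHS]mulrA ler_pdivlMr//.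
  have := ler_wpM2l (ltW (mulr_gt0 (ltr0n R 20) g0)) hB.
  have -> : 20 * g * (tau / 20 * phi ^+ 2 * g) = tau * (phi * g) ^+ 2 by field.
  apply: le_trans; rewrite le_eqVlt; apply/orP; left; apply/eqP; ring.
- rewrite !exprMn sqr_sqrtr; last exact: ltW.
  rewrite le_eqVlt; apply/orP; left; apply/eqP; field.
  by rewrite !gt_eqF.
Qed.

(** If phi were 0, membership in [Bset] would force every X_i to have norm 0, against X != 0. *)
Lemma Bset_compat_gt0 b0 (phi : R) (S := gsupp G b0) :
  Bset G X (tau / 20) b0 -> S != finset.set0 -> compat G X b0 S = phi%:E -> 0 <= phi -> 0 < phi.
Proof.
rewrite /Bset/= -/S -/(gnorm_max G X) => hB S0 phiE phi0.
rewrite lt_neqAle phi0 andbT; apply/eqP => phiz.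
have s0 : 0 < #|S|%:R :> R by rewrite ltr0n card_gt0.
rewrite phiE -!EFinM lee_fin -expr2 -phiz expr0n mulr0 mul0r in hB.
have sr : 0 < #|S|%:R * Num.sqrt r by rewrite mulr_gt0// sqrtr_gt0.
rewrite pmulr_rle0// in hB.
have := @gnorm_stackX_le R d p G m n X; rewrite leNgt (le_lt_trans _ g0)//.
by rewrite mulr_ge0_le0 ?sqrtr_ge0.
Qed.

Lemma expect_posterior_gsupp_le (M2 : R) b0 : 3 < M2 -> Bset G X (tau / 20) b0 ->
  tail <= 1 -> 32 * (A2 + 1) * eta <= 1 ->
  expect X b0 (V := R^o) (fun z =>
    posterior G X ppi (response z) [set b |
      ((#|gsupp G b0|%:R)%:E + (M2 / A4)%:E *
         (1 + 33%:E / compat G X b0 (gsupp G b0) ^+ 2) * (#|gsupp G b0|%:R)%:E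
       < (#|gsupp G b|%:R)%:E)%E]) <=
  tail + 2 * expR (8 / 5) * eta.
Proof.
move=> hM2 hB t1 e1; set S := gsupp G b0.
have hD := dimS_gsupp_lt hB; rewrite -/S in hD.
(* For an empty support [compat] is infinite, but the factor s0 = 0 makes the threshold 0. The cone
   then contains no vector of positive norm, so E = K = 0 works. *)
have [S0|S0] := eqVneq S finset.set0.
  have -> : ((#|S|%:R)%:E + (M2 / A4)%:E * (1 + 33%:E / compat G X b0 S ^+ 2) * (#|S|%:R)%:E)%E = (0 : R)%:E.
    by rewrite S0 cards0 mule0 adde0.
  apply: (@expect_posterior_le b0 0 0) => //.
  - move=> c; rewrite -/S S0 [X in _ <= _ * X]big_set0 mulr0 => cone.
    by rewrite (norm21_setC _ finset.set0) [X in X + _]big_set0 add0r ltNge cone.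
  - by rewrite -/S S0 cards0.
  - by rewrite -/S S0 cards0 !(mulr0, addr0).
have [phi [phiE phi_ge0 phi1]] := compat_finite m0 b0 hG g0 S0.
have phi0 := Bset_compat_gt0 hB S0 phiE phi_ge0.
have s0 : 0 < #|S|%:R :> R by rewrite ltr0n card_gt0.
set E := #|S|%:R / phi ^+ 2.
set K := #|S|%:R + M2 / A4 * (1 + 33 / phi ^+ 2) * #|S|%:R.
have -> : ((#|S|%:R)%:E + (M2 / A4)%:E * (1 + 33%:E / compat G X b0 S ^+ 2) * (#|S|%:R)%:E)%E = K%:E.
  by rewrite phiE expe2 -EFinM inver -expr2 gt_eqF// exprn_gt0.
apply: (@expect_posterior_le b0 E K) => //.
- by move=> c; exact: Bset_curvature.
- by rewrite -/S /E ler_peMr// invf_ge1 ?exprn_gt0// exprn_ile1.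
- rewrite -/S /K lerD2l.
  have -> : #|S|%:R + 33 * E = (1 + 33 / phi ^+ 2) * #|S|%:R by rewrite /E; field; rewrite gt_eqF.
  rewrite mulrA ler_pM2r// ler_pM2r; first by rewrite ler_pM2r ?invr_gt0// ltW.
  by rewrite addr_gt0// divr_gt0// exprn_gt0.
Qed.
End contraction.

Theorem theorem1 (R : realType) (m : nat) (A1 A2 A3 A4 : R)
    (hm : (2 <= m)%N) (hA1 : 0 < A1) (hA2 : 0 < A2) (hA3 : 0 < A3)
    (hA4 : 0 < A4) :
  exists2 M1 : R, 0 < M1 &
  forall (d p : nat -> nat)
    (G : forall n, 'I_(p n) -> {set 'I_(d n)})
    (X : forall n, 'I_n -> 'M[R]_(m.-1, d n))
    (ppi : forall n, dim_pmf R (p n)),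
  (forall n, (0 < n)%N ->
     [/\ group_partition (G n), stackX (X n) != 0 &
         dim_pmf_decay (n := n) (G n) (ppi n) A1 A2 A3 A4]) ->
  forall M2 : R, 3 < M2 ->
  (fun n => ereal_sup
     [set (expect (X n) b0 (V := R^o) (fun z =>
             posterior (G n) (X n) (ppi n) (response z)
               [set b : 'cV[R]_(d n) |
                 (((#|gsupp (G n) b0|%:R)%:E +
                   (M2 / A4)%:E *
                   (1 + 33%:E / compat (G n) (X n) b0 (gsupp (G n) b0) ^+ 2) *
                   (#|gsupp (G n) b0|%:R)%:E
                   < (#|gsupp (G n) b|%:R)%:E)%E)]))%:E |
        b0 in Bset (G n) (X n) M1]) @ \oo --> (0%E : \bar R).
Proof.
have m0 : (0 < m)%N by exact: ltnW.
pose tau : R := 10^-1 * (10^-1 * 10^-1).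
have t0 : 0 < tau / 20 by rewrite divr_gt0// !mulr_gt0 ?invr_gt0.
exists (tau / 20); first exact: t0.
move=> d p G X ppi H M2 hM2.
have c0 : 0 < 32 * (A2 + 1) by rewrite mulr_gt0// addr_gt0.
have ci0 : 0 < (32 * (A2 + 1))^-1 by rewrite invr_gt0.
pose tl n : R := Num.sqrt 5 * expR (- (8^-1 * ln n%:R)).
pose et n : R := expR (- (A4 / 200 * ln n%:R)).
have tl_cvg : tl n @[n --> \oo] --> (0 : R).
  rewrite -[X in _ --> X](mulr0 (Num.sqrt 5)); apply: cvgMr.
  by apply: cvg_expRN_ln; rewrite invr_gt0.
have et_cvg : et n @[n --> \oo] --> (0 : R).
  by apply: cvg_expRN_ln; rewrite divr_gt0.
have sum_cvg : tl n + 2 * expR (8 / 5) * et n @[n --> \oo] --> (0 : R).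
  have : tl n + 2 * expR (8 / 5) * et n @[n --> \oo] --> (0 + 2 * expR (8 / 5) * 0 : R).
    by apply: cvgD => //; exact: cvgMr.
  by rewrite mulr0 addr0.
apply: (@squeeze_cvge _ _ _ _ (cst 0%E) _ (fun n => (tl n + 2 * expR (8 / 5) * et n)%:E)).
- near=> n; apply/andP.
  have n16 : (16 <= n)%N by near: n; exact: nbhs_infty_ge.
  have [hG hX hd] := H n (leq_trans (isT : (0 < 16)%N) n16).
  have t1 : tl n <= 1.
    near: n; move/cvgrPdist_le : tl_cvg => /(_ 1 ltr01); apply: filterS => n.
    by rewrite sub0r normrN; apply: le_trans; exact: ler_norm.
  have e1 : 32 * (A2 + 1) * et n <= 1.
    rewrite mulrC -ler_pdivlMr// mul1r.
    near: n; move/cvgrPdist_le : et_cvg => /(_ (32 * (A2 + 1))^-1) h.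
    apply: filterS (h ci0) => n.
    by rewrite sub0r normrN; apply: le_trans; exact: ler_norm.
  split.
    (* The supremum of an empty set would be - oo, so the lower bound 0 needs a point of [Bset]: the
       zero vector. *)
    apply: le_ereal_sup_tmp; eexists.
      exists (0 : 'cV[R]_(d n)); last by [].
      rewrite /Bset/= [gsupp _ _](_ : _ = finset.set0) ?cards0 ?mul0r; last first.
        by apply/setP => j; rewrite !inE /vecgroup linear0 eqxx.
      by rewrite mule_ge0 ?lee_fin ?gnorm_ge0// mule_ge0 ?sqre_ge0// lee_fin ltW.
    rewrite lee_fin; apply: sumr_ge0 => z _; rewrite mulr_ge0//; first exact: likelihood_ge0.
    exact: posterior_ge0.
  apply: ge_ereal_sup => _ [b0 hB <-]; rewrite lee_fin.
  exact: (expect_posterior_gsupp_le m0 hG hX n16 hA1 hA2 hA4 hd hM2 hB t1 e1).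
- exact: cvg_cst.
- apply: cvg_EFin => //; by near=> n.
Unshelve. all: by end_near. Qed.
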